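(* Fix a constant $c_0<\frac12$. For all $\epsilon$ with $\frac1k\le\epsilon\le c_0$, $$n^*(k,\epsilon)\asymp\frac{k}{\log k}\log^2\frac1\epsilon .$$ Furthermore, if $\epsilon\to0$ and $\epsilon=k^{o(1)}$, then as $k\to\infty$, $$\frac{1+o(1)}{2e^2}\,\frac{k}{\log k}\log^2\frac1\epsilon\le n^*(k,\epsilon)\le\frac{1+o(1)}{2.494}\,\frac{k}{\log k}\log^2\frac1\epsilon .$$
   Context: For a probability distribution $P=(p_1,p_2,\dots)$ on $\mathbb{N}$, its support size is $S(P)=\sum_i\mathbf{1}\{p_i>0\}$. For an integer $k$, $\mathcal{D}_k$ denotes the set of all probability distributions on $\mathbb{N}$ whose minimum non-zero mass is at least $1/k$. The sample complexity is $$n^*(k,\epsilon)=\min\{n\ge0:\ \exists\,\hat S\text{ such that }\mathbb{P}[|\hat S-S(P)|\ge\epsilon k]\le0.1\ \text{ for all }P\in\mathcal{D}_k\},$$ where $n$ ranges over integers and $\hat S$ is an integer-valued estimator measurable with respect to $X_1,\dots,X_n$ i.i.d. from $P$. The notation $a\asymp b$ means that $a$ and $b$ are within constant factors of each other: $c\,b\le a\le C\,b$ for constants $0<c\le C<\infty$ not depending on $k$ or $\epsilon$ (with $c_0$ regarded as fixed). Logarithms are natural.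
   Formalization: The first lower bound is stated under the extra condition εk ≤ ⌊k/2⌋; otherwise (only odd k < 1/(1−2c₀)) a constant estimator works with no samples, so n* = 0 and the bound fails, e.g. k = 3, ε = 0.4, c₀ = 0.45. *)

(* Defs.v *)
From mathcomp Require Import all_boot all_order all_algebra.
From mathcomp Require Import all_classical all_reals all_analysis.

Set Implicit Arguments.
Unset Strict Implicit.
Unset Printing Implicit Defensive.

Import Order.TTheory GRing.Theory Num.Theory.
Import numFieldNormedType.Exports.

Local Open Scope classical_set_scope.
Local Open Scope ring_scope.

(* A distribution on the natural numbers is given by its sequence of masses. *)
Definition is_distribution (R : realType) (p : nat -> R) : Prop :=
  (forall i, 0 <= p i) /\ (\sum_(0 <= i <oo) (p i)%:E = 1)%E.

(* Extended-real valued, since the support may be infinite. *)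
Definition support_size (R : realType) (p : nat -> R) : \bar R :=
  (\sum_(0 <= i <oo) ((0 < p i)%R : nat)%:R%:E)%E.

(* Meant for 0 < k only: k%:R^-1 is 0 when k = 0. *)
Definition D_ (R : realType) (k : nat) : set (nat -> R) :=
  [set p | is_distribution p /\ forall i, 0 < p i -> k%:R^-1 <= p i].

(* The probability that (X_1, ..., X_n) lies in A, for X_1, ..., X_n i.i.d.
   with masses p: the n-fold product law, which is discrete. *)
Definition iid_prob (R : realType) (p : nat -> R) (n : nat)
    (A : set (n.-tuple nat)) : \bar R :=
  (\esum_(x in A) (\prod_(j < n) p (tnth x j))%R%:E)%E.

(* The sample space is countable and discrete, so an estimator measurable with
   respect to the sample is an arbitrary function of the sample. *)
Definition achievable (R : realType) (k : nat) (eps : R) (n : nat) : Prop :=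
  exists Shat : n.-tuple nat -> int, forall p : nat -> R, D_ k p ->
    (iid_prob p [set x | ((eps * k%:R)%:E <=
        `| ((Shat x)%:~R)%:E - support_size p |)%E] <= (10^-1)%:E)%E.

(* The infimum of a nonempty set of naturals is its minimum; the value is +oo
   if no sample size is achievable. *)
Definition nstar (R : realType) (k : nat) (eps : R) : \bar R :=
  ereal_inf [set (n%:R)%:E | n in [set n | achievable k eps n]].

Definition rate (R : realType) (k : nat) (eps : R) : R :=
  k%:R / ln k%:R * ln (eps^-1) ^+ 2.

(* Main.v *)
(* Upper bound. Counting a symbol seen m <= L times with weight 1 - a_m / C(n, m), and with weight 1
   when it is seen more often, estimates the support size with a bias of
   sum_m a_m p^m (1 - p)^(n - m) = (1 - p)^n P(p / (1 - p)) per symbol of mass p, where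
   P(y) = sum_m a_m y^m. For P the Chebyshev polynomial of degree L ~ a ln k carried to
   [1/k, ln k / (2 n)] and normalized by P(0) = 1, the bias is about 2 exp(- 2 L sqrt(2 n / (k ln k))).
   The estimator changes by at most a power k^(1/2 - s) when one sample changes, provided that
   a < sinh(q) / 4, where u = e^q satisfies ln u <= (cosh q + 1) / sinh q; this leads to the
   constant 8 a^2 > 2.494. For eps below a power of 1/k, all symbols are seen (coupon collector).

   Lower bound. On the nodes 0, 1 and the Chebyshev extremal points of [A, lam], the weights of the
   divided difference of order L + 3, split into positive and negative parts, give two laws with
   equal mean whose masses at 0 differ by about exp(- 2 L / sqrt lam). Give k symbols masses U_i / k
   with independent U_i drawn from one law or from the other. Exchanging the laws one letter at a
   time, the power of a test changes by a divided difference of a polynomial in U_i, hence by a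
   normalized derivative of order L + 3, which is at most C(n, L + 3) (2 / k)^(L + 3). Together with
   the normalization (lam / 4)^(L + 2) of the laws and the k letters, this is negligible for L ~ ln k
   and lam n / k < 2 e^-2 ln k, whence the constant 1 / (2 e^2). *)
Require Import Defs.
From mathcomp Require Import all_boot all_order all_algebra.
From mathcomp Require Import all_classical all_reals all_analysis.
From mathcomp Require Import polyrcf zify ring lra.
Import Order.TTheory GRing.Theory Num.Theory.
Import numFieldNormedType.Exports.
Local Open Scope classical_set_scope.
Local Open Scope ring_scope.

Set Implicit Arguments.
Unset Strict Implicit.
Unset Printing Implicit Defensive.

(** The sample size is fixed, without Poissonization. In the upper bound this leaves the factor (1 -
    p)^n beside the polynomial in y = p / (1 - p). It has to absorb the growth e^(n y) of the
    Chebyshev polynomial beyond its interval, at the cost of e^(n y^2); masses too large for that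
    are handled by the small chance of seeing such a symbol at most L times. The power k^(1/2 - s)
    is what the variance tolerates: n samples of squared influence k^(1 - 2 s) against (eps k)^2. In
    the lower bound the masses U_i / k do not sum to 1. An additional symbol takes the remainder;
    the laws of U_i get a mean below 1, so that the remainder is positive except with small
    probability, and the power of a test is set to 0 on the other words. [upper_regime] and
    [lower_regime] ask for large ln k and for eps above a small power of 1 / k, with the constants
    left as parameters, so that they serve both the sharp constants and the uniform bounds. In the
    uniform lower bound the remaining pairs (k, eps) are reached by monotonicity in eps and, for
    small k, by the need of at least one sample. *)

Ltac positivity_step :=
  match goal with
  | |- is_true (0 < _ * _) => apply: mulr_gt0
  | |- is_true (0 < _ ^-1) => rewrite invr_gt0
  | |- is_true (0 < _ ^+ _) => apply: exprn_gt0
  | |- is_true (0 < _ + _) => apply: addr_gt0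
  | |- is_true (0 < expR _) => exact: expR_gt0
  | |- is_true (0 <= _ * _) => apply: mulr_ge0
  | |- is_true (0 <= _ ^-1) => rewrite invr_ge0
  | |- is_true (0 <= _ ^+ _) => apply: exprn_ge0
  | |- is_true (0 <= _ + _) => apply: addr_ge0
  | |- is_true (0 <= expR _) => exact: expR_ge0
  | |- is_true (0 <= _%:R) => exact: ler0n
  | H : is_true (0 < ?x) |- is_true (0 <= ?x) => exact: (ltW H)
  end.
Ltac positivity := repeat first [done | positivity_step].
Ltac only_lra := clear; intros; lra.

(** * Chebyshev polynomials *)

Fixpoint chebyshev_rec (R : comNzRingType) (a b : {poly R}) (n : nat) : {poly R} :=
  if n is m.+1 then chebyshev_rec b ('X * b *+ 2 - a) m else a.

Definition chebyshevT (R : comNzRingType) (n : nat) : {poly R} :=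
  chebyshev_rec 1 'X n.

Definition chebyshevU (R : comNzRingType) (n : nat) : {poly R} :=
  chebyshev_rec 1 ('X *+ 2) n.

Lemma chebyshev_recSS (R : comNzRingType) (a b : {poly R}) (n : nat) :
  chebyshev_rec a b n.+2 =
  'X * chebyshev_rec a b n.+1 *+ 2 - chebyshev_rec a b n.
Proof. by elim: n a b => [//|n IHn] a b; rewrite [LHS]IHn. Qed.

Lemma nat_ind2 (P : nat -> Prop) :
  P 0%N -> P 1%N -> (forall n, P n -> P n.+1 -> P n.+2) -> forall n, P n.
Proof.
move=> P0 P1 PSS n; suff [] : P n /\ P n.+1 by [].
by elim: n => [//|n [Pn PSn]]; split=> //; apply: PSS.
Qed.

(** Both sides satisfy the same two-term recurrence. The factor [s] is there for U, whose closed
    forms carry sin t or z - 1/z; for T it is 1. *)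
Lemma horner_chebyshev_rec (R : comNzRingType) (a b : {poly R}) (c s : R)
    (f : nat -> R) :
  (forall n, f n.+2 = c * f n.+1 *+ 2 - f n) ->
  a.[c] * s = f 0%N -> b.[c] * s = f 1%N ->
  forall n, (chebyshev_rec a b n).[c] * s = f n.
Proof.
move=> fSS f0 f1; apply: nat_ind2 => // n IH0 IH1.
rewrite chebyshev_recSS fSS -IH0 -IH1 hornerD hornerN hornerMn hornerM hornerX.
by ring.
Qed.

Lemma chebyshevT_cos (R : realType) (n : nat) (t : R) :
  (chebyshevT R n).[cos t] = cos (n%:R * t).
Proof.
rewrite -[LHS]mulr1.
apply: (@horner_chebyshev_rec _ _ _ _ _ (fun n => cos (n%:R * t))) => [m||].
- have -> : m.+2%:R * t = m.+1%:R * t + t by rewrite -[in LHS]natr1; ring.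
  have -> : m%:R * t = m.+1%:R * t - t by rewrite -[in RHS]natr1; ring.
  by rewrite cosD cosB; ring.
- by rewrite mul0r cos0 hornerC mulr1.
- by rewrite mul1r hornerX mulr1.
Qed.

Lemma chebyshevU_cos (R : realType) (n : nat) (t : R) :
  (chebyshevU R n).[cos t] * sin t = sin (n.+1%:R * t).
Proof.
apply: (@horner_chebyshev_rec _ _ _ _ _ (fun n => sin (n.+1%:R * t))) => [m||].
- have -> : m.+3%:R * t = m.+2%:R * t + t by rewrite -[in LHS]natr1; ring.
  have -> : m.+1%:R * t = m.+2%:R * t - t by rewrite -[in RHS]natr1; ring.
  by rewrite sinD sinB; ring.
- by rewrite mul1r hornerC mul1r.
- have -> : 2%:R * t = t + t by ring.
  by rewrite sinD hornerMn hornerX; ring.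
Qed.

Lemma chebyshevT_joukowsky (F : numFieldType) (n : nat) (z : F) : z != 0 ->
  (chebyshevT F n).[(z + z^-1) / 2] = (z ^+ n + z ^- n) / 2.
Proof.
move=> z0; rewrite -[LHS]mulr1.
apply: (@horner_chebyshev_rec _ _ _ _ _ (fun n => (z ^+ n + z ^- n) / 2)) => [m||].
- have zm0 : z ^+ m != 0 by rewrite expf_neq0.
  by rewrite !exprS; field; rewrite z0 zm0.
- by rewrite hornerC expr0 invr1; field.
- by rewrite hornerX expr1; field.
Qed.

Lemma chebyshevU_joukowsky (F : numFieldType) (n : nat) (z : F) : z != 0 ->
  (chebyshevU F n).[(z + z^-1) / 2] * (z - z^-1) = z ^+ n.+1 - z ^- n.+1.
Proof.
move=> z0.
apply: (@horner_chebyshev_rec _ _ _ _ _ (fun n => z ^+ n.+1 - z ^- n.+1)) => [m||].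
- have zm0 : z ^+ m != 0 by rewrite expf_neq0.
  by rewrite !exprS; field; rewrite z0 zm0.
- by rewrite hornerC !expr1 mul1r.
- by rewrite hornerMn hornerX !expr2; field.
Qed.

Lemma size_chebyshev_rec (R : comNzRingType) (a b : {poly R}) (n : nat) :
  (size a <= 1)%N -> (size b <= 2)%N -> (size (chebyshev_rec a b n) <= n.+1)%N.
Proof.
move=> sa sb; elim/nat_ind2: n => // n IH0 IH1.
rewrite chebyshev_recSS (leq_trans (size_polyD _ _)) // geq_max size_polyN.
rewrite (leq_trans IH0 (leqW (leqnSn _))) andbT.
rewrite mulr2n (leq_trans (size_polyD _ _)) // maxnn.
apply: leq_trans (size_polyMleq _ _) _.
by rewrite size_polyX.
Qed.

Lemma coef_chebyshevU (R : comNzRingType) (n : nat) :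
  (chebyshevU R n)`_n = 2 ^+ n.
Proof.
rewrite /chebyshevU; elim/nat_ind2: n => [||n IH0 IH1]; first by rewrite coefC.
  by rewrite coefMn coefX expr1.
rewrite chebyshev_recSS coefB coefMn coefXM /= IH1.
rewrite [X in _ - X]nth_default ?subr0; first by rewrite [RHS]exprSr mulr_natr.
apply: leq_trans (size_chebyshev_rec _ _ _) _; rewrite ?size_poly1 //.
by rewrite mulr2n (leq_trans (size_polyD _ _)) // maxnn size_polyX.
Qed.

Lemma size_chebyshevT (R : comNzRingType) (n : nat) :
  (size (chebyshevT R n) <= n.+1)%N.
Proof. by apply: size_chebyshev_rec; rewrite ?size_poly1 ?size_polyX. Qed.

Lemma size_chebyshevU (R : comNzRingType) (n : nat) :
  (size (chebyshevU R n) <= n.+1)%N.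
Proof.
apply: size_chebyshev_rec; rewrite ?size_poly1 //.
by rewrite mulr2n (leq_trans (size_polyD _ _)) // maxnn size_polyX.
Qed.

Lemma normr_chebyshevT_le1 (R : realType) (n : nat) (x : R) :
  -1 <= x <= 1 -> `|(chebyshevT R n).[x]| <= 1.
Proof.
move=> x1; rewrite -(acosK x1) chebyshevT_cos ler_norml.
by rewrite cos_geN1 cos_le1.
Qed.

Definition cheb_node (R : realType) (L : nat) (i : nat) : R := cos (i%:R * (pi / L%:R)).

Lemma cheb_node_itv (R : realType) (L i : nat) : (0 < L)%N -> (i <= L)%N ->
  i%:R * (pi / L%:R) \in `[(0 : R), pi].
Proof.
move=> L0 iL; rewrite in_itv /= mulr_ge0 ?divr_ge0 ?ler0n ?pi_ge0 //=.
by rewrite mulrCA ler_piMr ?pi_ge0 // ler_pdivrMr ?ltr0n // mul1r ler_nat.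
Qed.

Lemma ltr_cheb_node (R : realType) (L i j : nat) :
  (0 < L)%N -> (i <= L)%N -> (j <= L)%N ->
  (cheb_node R L i < cheb_node R L j) = (j < i)%N.
Proof.
move=> L0 iL jL; rewrite ltr_cos ?cheb_node_itv // ltr_pM2r ?ltr_nat //.
by rewrite divr_gt0 ?pi_gt0 ?ltr0n.
Qed.

Lemma cheb_node_le (R : realType) (L i : nat) : cheb_node R L i <= 1.
Proof. exact: cos_le1. Qed.

Lemma cheb_node_opp (R : realType) (L i : nat) : (0 < L)%N -> (i <= L)%N ->
  cheb_node R L (L - i) = - cheb_node R L i.
Proof.
move=> L0 iL; rewrite /cheb_node natrB // mulrBl.
rewrite (_ : L%:R * (pi / L%:R) = pi); last by field; rewrite pnatr_eq0 -lt0n.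
by rewrite cosB cospi sinpi; ring.
Qed.

Lemma sin_natpi (R : realType) (i : nat) : sin (i%:R * pi : R) = 0.
Proof.
elim: i => [|i IHi]; first by rewrite mul0r sin0.
by rewrite -natr1 mulrDl mul1r sinD IHi sinpi; ring.
Qed.

Lemma cos_natpi (R : realType) (i : nat) : cos (i%:R * pi : R) = (-1) ^+ i.
Proof.
elim: i => [|i IHi]; first by rewrite mul0r cos0.
by rewrite -natr1 mulrDl mul1r cosD IHi sinpi cospi exprS; ring.
Qed.

Lemma chebyshevT_node (R : realType) (L i : nat) : (0 < L)%N ->
  (chebyshevT R L).[cheb_node R L i] = (-1) ^+ i.
Proof.
move=> L0; rewrite chebyshevT_cos -cos_natpi; congr cos.
by field; rewrite pnatr_eq0 -lt0n.
Qed.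

(** The extremal points of T_(L+1) are the L + 2 roots of (X^2 - 1) U_L, whose leading coefficient
    is 2^L. *)
Lemma prod_cheb_node (R : realType) (L : nat) (s : R) :
  \prod_(i < L.+2) (s - cheb_node R L.+1 i) =
  (s ^+ 2 - 1) * (chebyshevU R L).[s] / 2 ^+ L.
Proof.
set q : {poly R} := ('X^2 - 1%:P) * chebyshevU R L.
pose rs := [seq cheb_node R L.+1 i | i <- iota 0 L.+2].
have lead_q : q`_(L.+2) = 2 ^+ L.
  rewrite /q mulrBl coefB polyC1 mul1r coefXnM !ltnS ltn0 subn2 /= coef_chebyshevU.
  rewrite [X in _ - X]nth_default ?subr0 //.
  exact: leq_trans (size_chebyshevU _ _) _.
have q_le : (size q <= L.+3)%N.
  apply: leq_trans (size_polyMleq _ _) _.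
  rewrite size_XnsubC //= !addSn /= !ltnS.
  exact: size_chebyshevU.
have size_q : size q = L.+3.
  apply/eqP; rewrite eqn_leq q_le ltnNge; apply/negP => le_q.
  move: lead_q; rewrite nth_default // => /esym/eqP.
  by rewrite expf_eq0 pnatr_eq0 andbF.
have rs_root : all (root q) rs.
  apply/allP => _ /mapP[i ii ->]; rewrite mem_iota add0n ltnS in ii.
  rewrite rootM; apply/orP.
  (* Where the sine vanishes the node is 1 or -1, a root of X^2 - 1; elsewhere the sine formula for
     U applies. *)
  case: (eqVneq (sin (i%:R * (pi / L.+1%:R))) (0 : R)) => [s0|s0].
    left; rewrite rootE hornerD hornerN hornerXn hornerC subr_eq0.
    by rewrite -(cos2Dsin2 (i%:R * (pi / L.+1%:R))) s0 expr0n addr0.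
  right; rewrite rootE -(mulIr_eq0 _ (mulIf s0)) chebyshevU_cos.
  by rewrite mulrCA (mulrC L.+1%:R) divfK ?pnatr_eq0 // sin_natpi.
have rs_uniq : uniq rs.
  rewrite map_inj_in_uniq ?iota_uniq // => i j.
  rewrite !mem_iota !add0n !ltnS => /andP[_ ii] /andP[_ jj] ij.
  have lt_node := ltr_cheb_node R (ltn0Sn L).
  case: (ltngtP i j) => // [lij|lji].
    by move: (lt_node _ _ jj ii); rewrite ij ltxx lij.
  by move: (lt_node _ _ ii jj); rewrite ij ltxx lji.
have := @all_roots_prod_XsubC _ q rs; rewrite size_map size_iota size_q.
rewrite uniq_rootsE lead_coefE size_q /= lead_q => /(_ erefl rs_root rs_uniq).
move=> /(congr1 (fun p => p.[s])).
rewrite hornerM hornerD hornerN hornerXn hornerC hornerZ horner_prod => ->.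
rewrite mulrAC mulfV ?mul1r ?expf_neq0 ?pnatr_eq0 //.
rewrite big_map -[iota _ _]/(index_iota 0 L.+2) big_mkord.
by apply: eq_bigr => i _; rewrite hornerXsubC.
Qed.

(** * Divided differences *)

Definition ddiff_weight (F : fieldType) (r : nat) (y : 'I_r.+1 -> F) (i : 'I_r.+1) : F :=
  (\prod_(j | j != i) (y i - y j))^-1.

Definition ddiff (F : fieldType) (r : nat) (y : 'I_r.+1 -> F) (p : {poly F}) : F :=
  \sum_i ddiff_weight y i * p.[y i].

Definition lagrange_interp (F : fieldType) (r : nat) (y : 'I_r.+1 -> F) (p : {poly F}) :
    {poly F} :=
  \sum_i (ddiff_weight y i * p.[y i]) *: \prod_(j | j != i) ('X - (y j)%:P).

Lemma prod_neq_XsubC (F : fieldType) (r : nat) (y : 'I_r.+1 -> F) (i : 'I_r.+1) :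
  \prod_(j | j != i) ('X - (y j)%:P) =
  \prod_(j <- enum (predC1 i)) ('X - (y j)%:P).
Proof. by rewrite big_enum. Qed.

Lemma size_prod_neq_XsubC (F : fieldType) (r : nat) (y : 'I_r.+1 -> F) (i : 'I_r.+1) :
  size (\prod_(j | j != i) ('X - (y j)%:P)) = r.+1.
Proof. by rewrite prod_neq_XsubC size_prod_XsubC -cardE cardC1 card_ord. Qed.

Lemma size_lagrange_interp (F : fieldType) (r : nat) (y : 'I_r.+1 -> F) (p : {poly F}) :
  (size (lagrange_interp y p) <= r.+1)%N.
Proof.
apply: (leq_trans (size_sum _ _ _)); apply/bigmax_leqP => i _.
by rewrite (leq_trans (size_scale_leq _ _)) // size_prod_neq_XsubC.
Qed.

Lemma coef_lagrange_interp (F : fieldType) (r : nat) (y : 'I_r.+1 -> F) (p : {poly F}) :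
  (lagrange_interp y p)`_r = ddiff y p.
Proof.
rewrite coef_sum; apply: eq_bigr => i _; rewrite coefZ.
have := monic_prod_XsubC (enum (predC1 i)) xpredT y.
by rewrite -prod_neq_XsubC monicE lead_coefE size_prod_neq_XsubC /= => /eqP ->; rewrite mulr1.
Qed.

Lemma horner_lagrange_interp (F : fieldType) (r : nat) (y : 'I_r.+1 -> F) (p : {poly F})
    (i : 'I_r.+1) : injective y ->
  (lagrange_interp y p).[y i] = p.[y i].
Proof.
move=> y_inj; rewrite horner_sum (bigD1 i) //= [X in _ + X]big1 ?addr0 => [|k ki]; last first.
  rewrite hornerZ horner_prod (bigD1 i) ?(eq_sym i) //=.
  by rewrite hornerXsubC subrr mul0r mulr0.
rewrite hornerZ horner_prod mulrC mulrA /ddiff_weight.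
under [X in X / _ * _]eq_bigr do rewrite hornerXsubC.
rewrite mulfV ?mul1r //; apply/prodf_neq0 => j ji.
by rewrite subr_eq0 (inj_eq y_inj) eq_sym.
Qed.

(** A polynomial of degree at most r is its own interpolant on r + 1 nodes, and the divided
    difference is the top coefficient of the interpolant. In degree below r it vanishes, which is
    the source of the moment matching. *)
Lemma ddiff_coef (F : fieldType) (r : nat) (y : 'I_r.+1 -> F) (p : {poly F}) :
  injective y -> (size p <= r.+1)%N -> ddiff y p = p`_r.
Proof.
move=> y_inj p_le; rewrite -coef_lagrange_interp; congr (fun q : {poly F} => q`_r).
apply/eqP; rewrite -subr_eq0; apply/negPn/negP => q0.
have r_root : all (root (lagrange_interp y p - p)) [seq y i | i <- enum 'I_r.+1].
  apply/allP => _ /mapP[i _ ->].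
  by rewrite rootE hornerD hornerN horner_lagrange_interp // subrr.
have r_uniq : uniq [seq y i | i <- enum 'I_r.+1].
  by rewrite map_inj_uniq ?enum_uniq.
have := max_poly_roots q0 r_root r_uniq.
rewrite size_map size_enum_ord ltnNge (leq_trans (size_polyD _ _)) //.
by rewrite geq_max size_polyN size_lagrange_interp.
Qed.

(** The bound by [last x s] keeps the new roots inside the old interval, so that Rolle's theorem can
    be iterated. *)
Lemma path_rolle (R : rcfType) (p : {poly R}) (x : R) (s : seq R) :
  path <%R x s -> all (root p) (x :: s) ->
  exists t, [/\ size t = size s, path <%R x t, all (root p^`()) t &
    all (fun z => z <= last x s) t].
Proof.
elim: s x => [|a s IHs] x /=; first by exists [::].
move=> /andP[xa pas] /and3P[rx ra rs].
have [|t [size_t path_t root_t le_t]] := IHs a pas; first by rewrite /= ra.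
have [c] := poly_rolle xa (etrans (eqP rx) (esym (eqP ra))).
rewrite in_itv /= => /andP[xc ca] c0.
exists (c :: t); split => /=; first by rewrite size_t.
- rewrite xc; case: t {size_t root_t le_t} path_t => //= b t /andP[ab ->].
  by rewrite (lt_trans ca ab).
- by rewrite rootE c0 eqxx.
- rewrite le_t andbT (le_trans (ltW ca)) //.
  have [-> //|sN] := eqVneq s [::]; apply: ltW.
  have := order_path_min lt_trans pas; move/allP; apply.
  by case: s sN {IHs pas rs le_t size_t} => //= b s _; exact: mem_last.
Qed.

Lemma iter_rolle (R : rcfType) (n : nat) (p : {poly R}) (x : R) (s : seq R) :
  size s = n -> path <%R x s -> all (root p) (x :: s) ->
  exists2 z, x <= z <= last x s & root p^`(n) z.
Proof.
elim: n p x s => [|n IHn] p x s size_s path_s root_s.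
  rewrite derivn0; exists x; last by move: root_s => /= /andP[].
  by rewrite lexx (size0nil size_s) lexx.
have [t [size_t path_t root_t le_t]] := path_rolle path_s root_s.
case: t size_t path_t root_t le_t => [|a t /=]; first by rewrite size_s.
rewrite size_s => -[size_t] /andP[xa path_t] root_t le_t.
have [z /andP[az zl] rz] := IHn _ _ _ size_t path_t root_t.
exists z; last by rewrite -derivnS derivSn.
rewrite (le_trans (ltW xa) az) (le_trans zl) //.
have /allP := le_t : all (<=%R^~ (last x s)) (a :: t); apply; exact: mem_last.
Qed.

(** The interpolation error vanishes at r + 1 nodes, so by Rolle its r-th derivative has a root.
    There the normalized derivative (the derivative over r!) of [p] equals that of the interpolant,
    which is constant. *)
Lemma ddiff_mean_value (R : rcfType) (r : nat) (y : 'I_r.+1 -> R) (p : {poly R})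
    (lo hi : R) : injective y -> (forall i, lo <= y i <= hi) ->
  exists2 z, lo <= z <= hi & ddiff y p = p^`N(r).[z].
Proof.
move=> y_inj y_itv; set q := p - lagrange_interp y p.
pose s := sort <=%R [seq y i | i <- enum 'I_r.+1].
have s_root : all (root q) s.
  apply/allP => z; rewrite mem_sort => /mapP[i _ ->].
  by rewrite rootE hornerD hornerN horner_lagrange_interp // subrr.
have s_sorted : sorted <%R s.
  by rewrite sort_lt_sorted map_inj_uniq ?enum_uniq.
have s_itv z : z \in s -> lo <= z <= hi.
  by rewrite mem_sort => /mapP[i _ ->].
have size_s : size s = r.+1 by rewrite size_sort size_map size_enum_ord.
case def_s: s size_s => [//|a t] [size_t].
rewrite def_s in s_root s_sorted s_itv.
have [z /andP[az zl] rz] := iter_rolle size_t s_sorted s_root.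
have /andP[loa _] := s_itv a (mem_head _ _).
have /andP[_ lhi] := s_itv _ (mem_last a t).
exists z; first by rewrite (le_trans loa az) (le_trans zl lhi).
move: rz; rewrite rootE nderivn_def hornerMn mulrn_eq0 gtn_eqF ?fact_gt0 //=.
rewrite nderivnB hornerD hornerN subr_eq0 => /eqP ->.
have -> : (lagrange_interp y p)^`N(r) = ((lagrange_interp y p)`_r)%:P.
  apply/polyP => i; rewrite coef_nderivn coefC.
  case: i => [|i]; first by rewrite addn0 binn.
  by rewrite nth_default ?mul0rn // (leq_trans (size_lagrange_interp _ _)) // addnS ltnS leq_addr.
by rewrite hornerC coef_lagrange_interp.
Qed.

(** * Expectations under product measures on words *)

(* The weights need be neither nonnegative nor real: differences of laws and laws with polynomial
   masses are used as well. *)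
Fixpoint Em (R : comNzRingType) (T : finType) (qs : seq (T -> R)) (f : seq T -> R) : R :=
  if qs is q :: qs' then \sum_t q t * Em qs' (fun s => f (t :: s)) else f [::].

Lemma eq_Em (R : comNzRingType) (T : finType) (qs : seq (T -> R)) (f g : seq T -> R) :
  (forall s, size s = size qs -> f s = g s) -> Em qs f = Em qs g.
Proof.
elim: qs f g => [|q qs IHqs] f g fg /=; first exact: fg.
by apply: eq_bigr => t _; congr (_ * _); apply: IHqs => s ss; rewrite fg //= ss.
Qed.

Lemma Em_sum (R : comNzRingType) (T I : finType) (qs : seq (T -> R)) (f : I -> seq T -> R) :
  Em qs (fun s => \sum_i f i s) = \sum_i Em qs (f i).
Proof.
elim: qs f => [//|q qs IHqs] f /=; rewrite exchange_big /=.
by apply: eq_bigr => t _; rewrite IHqs mulr_sumr.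
Qed.

Lemma EmZ (R : comNzRingType) (T : finType) (qs : seq (T -> R)) (c : R) (f : seq T -> R) :
  Em qs (fun s => c * f s) = c * Em qs f.
Proof.
elim: qs f => [//|q qs IHqs] f /=; rewrite mulr_sumr.
by apply: eq_bigr => t _; rewrite IHqs mulrCA.
Qed.

Lemma EmD (R : comNzRingType) (T : finType) (qs : seq (T -> R)) (f g : seq T -> R) :
  Em qs (fun s => f s + g s) = Em qs f + Em qs g.
Proof.
elim: qs f g => [//|q qs IHqs] f g /=; rewrite -big_split.
by apply: eq_bigr => t _; rewrite IHqs mulrDr.
Qed.

Lemma EmB (R : comNzRingType) (T : finType) (qs : seq (T -> R)) (f g : seq T -> R) :
  Em qs (fun s => f s - g s) = Em qs f - Em qs g.
Proof.
rewrite EmD; congr (_ + _).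
by under eq_Em do rewrite -mulN1r; rewrite EmZ mulN1r.
Qed.

Lemma Em_cst (R : comNzRingType) (T : finType) (qs : seq (T -> R)) (c : R) :
  (forall q, q \in qs -> \sum_t q t = 1) -> Em qs (fun=> c) = c.
Proof.
elim: qs => [//|q qs IHqs] qs1 /=; rewrite -mulr_suml qs1 ?mem_head // mul1r.
by apply: IHqs => q' qq'; apply: qs1; rewrite in_cons qq' orbT.
Qed.

Lemma ler_Em (R : numDomainType) (T : finType) (qs : seq (T -> R)) (f g : seq T -> R) :
  (forall q, q \in qs -> forall t, 0 <= q t) ->
  (forall s, size s = size qs -> f s <= g s) -> Em qs f <= Em qs g.
Proof.
elim: qs f g => [|q qs IHqs] f g q0 fg /=; first exact: fg.
apply: ler_sum => t _; rewrite ler_wpM2l ?q0 ?mem_head //.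
apply: IHqs => [q' qq'|s ss]; first by apply: q0; rewrite in_cons qq' orbT.
by rewrite fg //= ss.
Qed.

Lemma ler_norm_Em (R : numDomainType) (T : finType) (qs : seq (T -> R)) (f : seq T -> R) :
  (forall q, q \in qs -> forall t, 0 <= q t) ->
  `|Em qs f| <= Em qs (fun s => `|f s|).
Proof.
elim: qs f => [//|q qs IHqs] f q0 /=.
apply: (le_trans (ler_norm_sum _ _ _)); apply: ler_sum => t _.
rewrite normrM ger0_norm ?q0 ?mem_head // ler_wpM2l ?q0 ?mem_head //.
by apply: IHqs => q' qq'; apply: q0; rewrite in_cons qq' orbT.
Qed.

Lemma Em_mid (R : comNzRingType) (T : finType) (qs1 qs2 : seq (T -> R)) (q : T -> R)
    (f : seq T -> R) :
  Em (qs1 ++ q :: qs2) f =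
  Em (qs1 ++ qs2)
    (fun s => \sum_t q t * f (take (size qs1) s ++ t :: drop (size qs1) s)).
Proof.
elim: qs1 f => [|q1 qs1 IHqs1] f /=.
  by rewrite Em_sum; apply: eq_bigr => t _; rewrite EmZ; congr (_ * _); apply: eq_Em => s _;
    rewrite take0 drop0.
by apply: eq_bigr => t _; rewrite IHqs1.
Qed.

(** Telescoping over the products of i laws [q] followed by K - i laws [q']. Neighbouring products
    differ in one position, where the signed weight q - q' remains. *)
Lemma Em_hybrid (R : numDomainType) (T : finType) (K : nat) (q q' : T -> R)
    (f : seq T -> R) (D : R) :
  (forall i j, (i + j).+1 = K ->
    `|Em (nseq i q ++ (fun t => q t - q' t) :: nseq j q') f| <= D) ->
  `|Em (nseq K q) f - Em (nseq K q') f| <= K%:R * D.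
Proof.
move=> DP; pose H i := Em (nseq i q ++ nseq (K - i) q') f.
have -> : Em (nseq K q) f - Em (nseq K q') f = H K - H 0%N.
  by rewrite /H subnn cats0 subn0.
rewrite -telescope_sumr // (le_trans (ler_norm_sum _ _ _)) //.
rewrite mulr_natl -[X in _ *+ X](subn0 K) -sumr_const_nat.
apply: ler_sum_nat => i /andP[_ iK].
have [j Kj] : exists j, (i + j).+1 = K.
  by exists (K - i.+1)%N; rewrite -addSn subnKC.
have Ki : (K - i = j.+1)%N by rewrite -Kj -addnS addKn.
have Ki1 : (K - i.+1 = j)%N by rewrite subnS Ki.
rewrite /H Ki Ki1 -addn1 nseqD -catA /= !Em_mid -EmB.
have := DP _ _ Kj; rewrite Em_mid.
under eq_Em do under eq_bigr do rewrite mulrBl.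
by under eq_Em do rewrite sumrB.
Qed.

Lemma Em_prod (R : comNzRingType) (T : finType) (n : nat) (q h : T -> R) :
  Em (nseq n q) (fun s => \prod_(t <- s) h t) = (\sum_t q t * h t) ^+ n.
Proof.
elim: n => [|n IHn] /=; first by rewrite big_nil expr0.
rewrite exprS mulr_suml; apply: eq_bigr => t _.
by under eq_Em do rewrite big_cons; rewrite EmZ IHn mulrA.
Qed.

Lemma Em_prod_cat (R : comNzRingType) (T : finType) (i j : nat) (q q' h : T -> R) :
  Em (nseq i q ++ nseq j q') (fun s => \prod_(t <- s) h t) =
  (\sum_t q t * h t) ^+ i * (\sum_t q' t * h t) ^+ j.
Proof.
elim: i => [|i IHi] /=; first by rewrite Em_prod mul1r.
rewrite exprS -mulrA mulr_suml; apply: eq_bigr => t _.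
by under eq_Em do rewrite big_cons; rewrite EmZ IHi mulrA.
Qed.

Lemma tuple_sum_Em (R : comNzRingType) (T : finType) (n : nat) (q : T -> R)
    (f : seq T -> R) :
  \sum_(x : n.-tuple T) (\prod_(j < n) q (tnth x j)) * f x = Em (nseq n q) f.
Proof.
elim: n f => [|n IHn] f /=.
  rewrite (bigD1 [tuple]) //= big_ord0 mul1r big1 ?addr0 // => x.
  by move/negP; case; apply/eqP; rewrite (tuple0 x); apply: val_inj.
rewrite (reindex (fun z : T * n.-tuple T => [tuple of z.1 :: z.2])) /=; last first.
  exists (fun x : n.+1.-tuple T => (thead x, [tuple of behead x])) => [[t x] _|x _].
    by rewrite /thead tnth0; congr (_, _); apply: val_inj.
  by rewrite /= -tuple_eta.
rewrite -(pair_bigA _ (fun t (x : n.-tuple T) =>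
  (\prod_(j < n.+1) q (tnth [tuple of t :: x] j)) * f (t :: x))) /=.
apply: eq_bigr => t _; rewrite -IHn mulr_sumr; apply: eq_bigr => x _.
rewrite big_ord_recl tnth0 -mulrA; congr (_ * (_ * _)).
by apply: eq_bigr => j _; rewrite tnthS.
Qed.

(** A bounded-difference variance bound of Efron-Stein type, by induction on the first letter: the
    variance given that letter, plus the variance of the conditional mean, which moves by at most
    [M]. *)
Lemma Em_var_le (R : realDomainType) (T : finType) (n : nat) (q : T -> R)
    (f : seq T -> R) (M : R) :
  (forall t, 0 <= q t) -> \sum_t q t = 1 ->
  (forall s1 s2 t t', `|f (s1 ++ t :: s2) - f (s1 ++ t' :: s2)| <= M) ->
  Em (nseq n q) (fun s => (f s - Em (nseq n q) f) ^+ 2) <= n%:R * M ^+ 2.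
Proof.
move=> q0 q1; elim: n f => [|n IHn] f fM; first by rewrite /= subrr expr0n mul0r.
have qs0 : forall q', q' \in nseq n q -> forall t, 0 <= q' t.
  by move=> q'; rewrite mem_nseq => /andP[_ /eqP ->].
have qs1 : forall q', q' \in nseq n q -> \sum_t q' t = 1.
  by move=> q'; rewrite mem_nseq => /andP[_ /eqP ->].
set mu := Em (nseq n.+1 q) f.
pose m t := Em (nseq n q) (fun s => f (t :: s)).
have mE : mu = \sum_t q t * m t by [].
have mM t t' : `|m t - m t'| <= M.
  rewrite -EmB (le_trans (ler_norm_Em _ qs0)) // -(Em_cst M qs1).
  by apply: ler_Em => // s _; apply: (fM [::]).
have muM t : `|m t - mu| <= M.
  rewrite -[m t]mul1r -q1 mulr_suml mE -sumrB.
  apply: (le_trans (ler_norm_sum _ _ _)).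
  rewrite -[M]mul1r -q1 mulr_suml; apply: ler_sum => t' _.
  by rewrite -mulrBr normrM ger0_norm // ler_wpM2l.
rewrite /= -natr1 mulrDl mul1r -[X in _ <= X]mul1r -[X in _ <= X * _]q1 mulr_suml.
apply: ler_sum => t _; rewrite ler_wpM2l //.
(* The cross term of the splitting at [m t] vanishes, because f (t :: s) - m t has mean 0. *)
have -> : Em (nseq n q) (fun s => (f (t :: s) - mu) ^+ 2) =
    Em (nseq n q) (fun s => (f (t :: s) - m t) ^+ 2) + (m t - mu) ^+ 2.
  rewrite -[in RHS](Em_cst ((m t - mu) ^+ 2) qs1) -EmD.
  apply/eqP; rewrite -subr_eq0 -EmB; apply/eqP.
  have -> : 0 = 2 * (m t - mu) * Em (nseq n q) (fun s => f (t :: s) - m t).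
    by rewrite EmB Em_cst // subrr mulr0.
  by rewrite -EmZ; apply: eq_Em => s _; ring.
apply: lerD; last by rewrite -[X in X <= _]real_normK ?num_real // lerXn2r // ?nnegrE //
  (le_trans _ (muM t)).
by apply: (IHn (fun s => f (t :: s))) => s1 s2 a b; apply: (fM (t :: s1)).
Qed.

Lemma Em_chebyshev (R : realFieldType) (T : finType) (n : nat) (q : T -> R)
    (f : seq T -> R) (M D : R) :
  (forall t, 0 <= q t) -> \sum_t q t = 1 -> 0 < D ->
  (forall s1 s2 t t', `|f (s1 ++ t :: s2) - f (s1 ++ t' :: s2)| <= M) ->
  Em (nseq n q) (fun s => (D <= `|f s - Em (nseq n q) f|)%R%:R) <=
  n%:R * M ^+ 2 / D ^+ 2.
Proof.
move=> q0 q1 D0 fM; rewrite ler_pdivlMr ?exprn_gt0 //.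
apply: le_trans (Em_var_le n q0 q1 fM); rewrite mulrC -EmZ.
apply: ler_Em => [q'|s _]; first by rewrite mem_nseq => /andP[_ /eqP ->].
case: (leP D) => [Df|_]; last by rewrite mulr0 sqr_ge0.
by rewrite mulr1 -[X in _ <= X]real_normK ?num_real // lerXn2r // nnegrE ltW.
Qed.

Lemma Em_count (R : comNzRingType) (T : finType) (n : nat) (q : T -> R) (i : T)
    (h : nat -> R) : \sum_t q t = 1 ->
  Em (nseq n q) (fun s => h (count_mem i s)) =
  \sum_(m < n.+1) (q i ^+ m * (1 - q i) ^+ (n - m) * h m) *+ 'C(n, m).
Proof.
move=> q1; elim: n h => [|n IHn] h; first by rewrite big_ord1 /= !mul1r.
rewrite /= (bigD1 i) //= eqxx (IHn (fun m => h m.+1)).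
under eq_bigr => t ti do rewrite (negPf ti) (IHn h).
rewrite -mulr_suml (_ : \sum_(t | t != i) q t = 1 - q i); last first.
  by apply/eqP; rewrite eq_sym subr_eq -q1 (bigD1 i) //= addrC.
rewrite [RHS]big_ord_recl.
under [X in _ = _ + X]eq_bigr => j _ do rewrite lift0 binS addnC mulrnDr.
rewrite big_split /= addrCA; congr (_ + _).
  rewrite mulr_sumr; apply: eq_bigr => j _.
  by rewrite subSS exprS mulrnAr; congr (_ *+ _); ring.
have <- : \sum_(m < n.+2) (q i ^+ m * (1 - q i) ^+ (n.+1 - m) * h m) *+ 'C(n, m) =
    (1 - q i) * \sum_(m < n.+1) (q i ^+ m * (1 - q i) ^+ (n - m) * h m) *+ 'C(n, m).
  rewrite big_ord_recr /= bin_small // mulr0n addr0 mulr_sumr.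
  apply: eq_bigr => j _; rewrite subSn; last by rewrite -ltnS.
  by rewrite exprS mulrnAr; congr (_ *+ _); ring.
by rewrite big_ord_recl !bin0.
Qed.

Lemma horner_Em (R : comNzRingType) (T : finType) (n : nat) (Q : T -> {poly R})
    (f : seq T -> R) (u : R) :
  (Em (nseq n Q) (fun s => (f s)%:P)).[u] = Em (nseq n (fun t => (Q t).[u])) f.
Proof.
elim: n f => [|n IHn] f /=; first by rewrite hornerC.
by rewrite horner_sum; apply: eq_bigr => t _; rewrite hornerM IHn.
Qed.

Lemma nderivn_linM (R : comNzRingType) (a d : R) (p : {poly R}) (n : nat) :
  ((d *: 'X + a%:P) * p)^`N(n.+1) =
  d *: p^`N(n) + (d *: 'X + a%:P) * p^`N(n.+1).
Proof.
have -> : (d *: 'X + a%:P) * p = d *: (p * 'X + 0%:P) + a *: p.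
  by rewrite polyC0 addr0 mulrDl mul_polyC -scalerAl mulrC.
rewrite nderivnD !nderivnZ nderivnMXaddC scalerDr mulrDl mul_polyC addrA.
by rewrite -scalerAl [p^`N(_) * 'X]mulrC.
Qed.

(** By Leibniz' rule the normalized derivative selects r of the n affine factors. A selected
    position contributes its slopes, of absolute sum at most [D]; any other position contributes
    weights of absolute sum at most 1 at [z]. Pascal's rule does the counting. *)
Lemma norm_nderivn_Em (R : realFieldType) (T : finType) (n r : nat) (a d : T -> R)
    (f : seq T -> R) (z D : R) :
  \sum_t `|d t * z + a t| <= 1 -> \sum_t `|d t| <= D -> (forall s, `|f s| <= 1) ->
  `|(Em (nseq n (fun t => d t *: 'X + (a t)%:P)) (fun s => (f s)%:P))^`N(r).[z]|
  <= 'C(n, r)%:R * D ^+ r.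
Proof.
move=> a1 dD f1.
have D0 : 0 <= D by apply: le_trans dD; apply: sumr_ge0.
elim: n r f f1 => [|n IHn] r f f1 /=.
  rewrite nderivnC; case: r => [|r] /=; first by rewrite hornerC mul1r.
  by rewrite horner0 normr0 bin0n mul0r.
rewrite (big_morph (fun p : {poly R} => p^`N(r)) (nderivnD r) (nderivn_poly0 _)) ?size_poly0 //.
rewrite horner_sum (le_trans (ler_norm_sum _ _ _)) //.
case: r => [|r].
  rewrite bin0 expr0 mul1r; apply: le_trans a1; apply: ler_sum => t _.
  rewrite nderivn0 hornerM hornerD hornerZ hornerX hornerC normrM ler_piMr //.
  by have := IHn 0%N (fun s => f (t :: s)) (fun s => f1 _); rewrite nderivn0 bin0 mul1r.
rewrite binS natrD mulrDl.
apply: (@le_trans _ _ (\sum_t (`|d t * z + a t| * ('C(n, r.+1)%:R * D ^+ r.+1)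
    + `|d t| * ('C(n, r)%:R * D ^+ r)))).
  apply: ler_sum => t _; rewrite nderivn_linM hornerD hornerM.
  rewrite hornerD !hornerZ hornerX hornerC addrC (le_trans (ler_normD _ _)) //.
  by rewrite !normrM lerD // ler_wpM2l // IHn.
rewrite big_split /= -!mulr_suml lerD //.
  by rewrite ler_piMl // mulr_ge0 ?exprn_ge0.
by rewrite mulrCA exprS ler_wpM2l // ler_wpM2r ?exprn_ge0.
Qed.

(** * Reduction to a finite alphabet *)

Lemma esum_finType (R : realType) (T : finType) (a : T -> R) : (forall x, 0 <= a x) ->
  (\esum_(x in [set: T]) (a x)%:E)%E = (\sum_x a x)%:E.
Proof.
move=> a0; rewrite esum_fset; [|exact: finite_finset|by move=> x _; rewrite lee_fin].
have -> : [set: T] = [set` enum T] by apply/seteqP; split=> x //= _; rewrite mem_enum.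
by rewrite -fsbig_seq ?enum_uniq // big_enum sumEFin.
Qed.

(** Words with a letter beyond the alphabet have probability 0, so the sum over all words lives on
    the image of the words over 'I_m. *)
Lemma iid_prob_Em (R : realType) (m n : nat) (p : nat -> R) (P : pred (seq nat)) :
  (forall i, 0 <= p i) -> (forall i, (m <= i)%N -> p i = 0) ->
  iid_prob p [set x : n.-tuple nat | P x] =
  (Em (nseq n (fun i : 'I_m => p i)) (fun s => (P (map val s))%:R))%:E.
Proof.
move=> p0 pm; rewrite /iid_prob.
pose h (x : n.-tuple 'I_m) : n.-tuple nat := [tuple of map val x].
pose g (x : n.-tuple nat) : \bar R := (\prod_(j < n) p (tnth x j) * (P x)%:R)%R%:E.
have h_inj : injective h.
  by move=> x y /(congr1 val) /= /(inj_map val_inj) /val_inj.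
rewrite esum_mkcond (_ : (fun _ => _) = g); last first.
  apply/funext => x; rewrite /g; case: ifPn => [|/negP].
    by rewrite inE /= => ->; rewrite mulr1.
  by rewrite inE /= => /negP/negPf ->; rewrite mulr0.
have -> : (\esum_(x in [set: n.-tuple nat]) g x = \esum_(x in range h) g x)%E.
  rewrite [RHS]esum_mkcond; congr esum; apply/funext => x.
  case: ifPn => // /negP; rewrite inE /= => xh.
  rewrite /g; suff [j pj] : exists j, p (tnth x j) = 0.
    by rewrite (bigD1 j) //= pj !mul0r.
  apply: contrapT => xj; apply: xh.
  have xm j : (tnth x j < m)%N.
    by rewrite ltnNge; apply/negP => /pm pj; apply: xj; exists j.
  exists [tuple (Ordinal (xm j)) | j < n] => //.
  by apply: eq_from_tnth => j; rewrite tnth_map tnth_mktuple.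
rewrite (reindex_esum [set: n.-tuple 'I_m] _ h); last first.
  by split => [x _|x y _ _ /h_inj|x [y _ <-]].
rewrite /g esum_finType => [|x]; last by rewrite mulr_ge0 ?prodr_ge0 ?ler0n.
rewrite -(tuple_sum_Em _ _ (fun s : seq 'I_m => (P (map val s))%:R)); congr EFin.
apply: eq_bigr => x _; congr (_ * _); apply: eq_bigr => j _.
by rewrite tnth_map.
Qed.

Lemma nneseries_finite (R : realType) (m : nat) (a : nat -> R) :
  (forall i, 0 <= a i) -> (forall i, (m <= i)%N -> a i = 0) ->
  (\sum_(0 <= i <oo) (a i)%:E)%E = (\sum_(i < m) a i)%:E.
Proof.
move=> a0 am.
rewrite (@nneseries_split _ _ 0 m) => [|k _]; last by rewrite lee_fin.
rewrite add0n eseries0 => [|i mi _]; last by rewrite am.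
by rewrite adde0 sumEFin big_mkord.
Qed.

(** The masses tend to 0 as terms of a convergent series, while the nonzero ones stay above 1 / k;
    hence only finitely many are nonzero. *)
Lemma finite_support (R : realType) (k : nat) (p : nat -> R) : (0 < k)%N -> D_ k p ->
  exists m, [/\ forall i, (m <= i)%N -> p i = 0, \sum_(i < m) p i = 1 &
    support_size p = (\sum_(i < m) (0 < p i)%R%:R)%:E].
Proof.
move=> k0 [[p0 p1] pk].
have k0' : (0 : R) < k%:R^-1 by rewrite invr_gt0 ltr0n.
have cvg0 : p i @[i --> \oo] --> (0 : R).
  apply: cvg_series_cvg_0.
  have : (\sum_(0 <= i <oo) (p i)%:E < +oo)%E by rewrite p1 ltry.
  by apply: nnseries_is_cvg.
have [m _ pm] : \forall i \near \oo, `|0 - p i| < k%:R^-1.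
  by move/cvgrPdist_lt: cvg0; apply.
have pm0 i : (m <= i)%N -> p i = 0.
  move=> mi; have := pm i mi; rewrite /= sub0r normrN ger0_norm // => pik.
  apply/eqP; rewrite eq_le p0 andbT leNgt; apply/negP => /pk.
  by rewrite leNgt pik.
exists m; split => //.
- by apply/EFin_inj; rewrite -(nneseries_finite p0 pm0).
- rewrite /support_size (@nneseries_finite _ m (fun i => (0 < p i)%R%:R)) //.
  by move=> i /pm0 ->; rewrite ltxx.
Qed.

(** * The extremal priors *)

Lemma prod_sign_gt (R : comNzRingType) (r : nat) (i : 'I_r.+1) :
  \prod_(j < r.+1 | j != i) (if (i < j)%N then -1 else 1) = (-1) ^+ (r - i) :> R.
Proof.
transitivity (\prod_(j < r.+1) (if (i < j)%N then -1 else 1) : R).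
  by rewrite [RHS](bigD1 i) //= ltnn mul1r.
rewrite -(big_mkord xpredT (fun j => if (i < j)%N then -1 else 1)).
rewrite (@big_cat_nat _ _ _ i.+1) //=.
rewrite big_nat big1 ?mul1r => [|j /andP[_ ji]]; last by rewrite ltnNge -ltnS ji.
rewrite big_nat (eq_bigr (fun=> -1)) => [|j /andP[-> _] //].
by rewrite -big_nat prodr_const_nat subSS.
Qed.

Lemma ddiff_weight_sign (R : realFieldType) (r : nat) (y : 'I_r.+1 -> R) (i : 'I_r.+1) :
  {homo y : i j / (i < j)%N >-> i < j} -> 0 < ddiff_weight y i * (-1) ^+ (r - i).
Proof.
move=> y_inc; rewrite -invr_gt0 invfM invrK invr_sign -prod_sign_gt -big_split /=.
apply: prodr_gt0 => j ji; case: ltngtP => [ij|ji'|/val_inj ij].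
- by rewrite mulrN1 opprB subr_gt0 y_inc.
- by rewrite mulr1 subr_gt0 y_inc.
- by rewrite ij eqxx in ji.
Qed.

(* In increasing order: 0, 1, and the Chebyshev extremal points carried to [A, lam]. *)
Definition ext_node (R : realType) (N : nat) (A lam : R) (i : nat) : R :=
  if i is j.+2 then (lam + A) / 2 - (lam - A) / 2 * cheb_node R N j else i%:R.

Lemma ext_node_inc (R : realType) (N : nat) (A lam : R) (i j : nat) :
  (0 < N)%N -> 1 < A -> A < lam -> (j <= N.+2)%N -> (i < j)%N ->
  ext_node N A lam i < ext_node N A lam j.
Proof.
move=> N0 A1 Alam.
have nA m : A <= ext_node N A lam m.+2.
  rewrite /= lerBrDr -lerBrDl; apply: (@le_trans _ _ ((lam - A) / 2)); last by lra.
  by rewrite ler_piMr ?cheb_node_le //; lra.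
case: j => [|[|j]] jN; first by rewrite ltn0.
  by case: i => //= _; exact: ltr01.
case: i => [|[|i]] ij.
- by apply: lt_le_trans (nA j); rewrite /=; lra.
- by apply: lt_le_trans (nA j).
- rewrite /= ltrD2l ltrN2 ltr_pM2l; last by lra.
  have ij' : (i < j)%N by [].
  have jN' : (j <= N)%N by [].
  by rewrite ltr_cheb_node // (leq_trans (ltnW ij')).
Qed.

Lemma ext_node_itv (R : realType) (N : nat) (A lam : R) (i : nat) :
  (0 < N)%N -> 1 < A -> A < lam -> (i <= N.+2)%N ->
  0 <= ext_node N A lam i <= lam.
Proof.
move=> N0 A1 Alam iN; apply/andP; split.
  case: i iN => [|i] iN; first by rewrite /= lexx.
  by rewrite ltW // -[0]/(ext_node N A lam 0) ext_node_inc.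
have le_max : ext_node N A lam N.+2 = lam.
  have := @cheb_node_opp R N 0 N0 isT; rewrite subn0 /= => ->.
  by rewrite /cheb_node mul0r cos0; field.
rewrite -[X in _ <= X]le_max; case: ltngtP iN => // [iN _|-> _] //.
by rewrite ltW // ext_node_inc.
Qed.

Lemma prod_ext_node (R : realType) (L : nat) (A lam s : R) : A < lam ->
  \prod_(i < L.+2) (ext_node L.+1 A lam i.+2 - s) =
  ((lam - A) / 2) ^+ L.+2 * ((((lam + A) / 2 - s) / ((lam - A) / 2)) ^+ 2 - 1)
  * (chebyshevU R L).[((lam + A) / 2 - s) / ((lam - A) / 2)] / 2 ^+ L.
Proof.
move=> Alam; set b := (lam - A) / 2; set c := ((lam + A) / 2 - s) / b.
have b0 : b != 0 by rewrite /b; lra.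
have -> : b ^+ L.+2 * (c ^+ 2 - 1) * (chebyshevU R L).[c] / 2 ^+ L =
  b ^+ L.+2 * ((c ^+ 2 - 1) * (chebyshevU R L).[c] / 2 ^+ L) by rewrite !mulrA.
have -> : b ^+ L.+2 = \prod_(i < L.+2) b by rewrite prodr_const card_ord.
rewrite -prod_cheb_node -big_split /=.
by apply: eq_bigr => i _; rewrite /c mulrBr mulrCA mulfV // mulr1 addrAC.
Qed.

Definition ext_weight (R : realType) (L : nat) (A lam : R) (i : 'I_L.+4) : R :=
  ddiff_weight (fun j : 'I_L.+4 => ext_node L.+1 A lam j) i.

(** The affine map that sends A to 1 and lam to -1. The points 0 and 1, to the left of the interval,
    thus go beyond 1, where T and U are hyperbolic. *)
Definition ext_arg (R : realType) (A lam s : R) : R :=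
  ((lam + A) / 2 - s) / ((lam - A) / 2).

Lemma ext_node_inj (R : realType) (L : nat) (A lam : R) : 1 < A -> A < lam ->
  injective (fun j : 'I_L.+4 => ext_node L.+1 A lam j).
Proof.
move=> A1 Alam i j /= ij; apply: val_inj => /=; case: (ltngtP i j) => // lij.
  by have := ext_node_inc (ltn0Sn L) A1 Alam (ltn_ord j) lij; rewrite ij ltxx.
by have := ext_node_inc (ltn0Sn L) A1 Alam (ltn_ord i) lij; rewrite ij ltxx.
Qed.

Lemma ext_weight_sign (R : realType) (L : nat) (A lam : R) (i : 'I_L.+4) :
  1 < A -> A < lam -> 0 < ext_weight A lam i * (-1) ^+ (L.+3 - i).
Proof.
move=> A1 Alam; apply: ddiff_weight_sign => j k jk.
by apply: ext_node_inc => //; rewrite -ltnS.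
Qed.

Lemma norm_ext_weight0 (R : realType) (L : nat) (A lam : R) : 1 < A -> A < lam ->
  `|ext_weight A lam (ord0 : 'I_L.+4)| =
  (\prod_(i < L.+2) ext_node L.+1 A lam i.+2)^-1.
Proof.
move=> A1 Alam; rewrite /ext_weight /ddiff_weight normfV normr_prod; congr (_^-1).
rewrite big_mkcond [LHS]big_ord_recl /= mul1r [LHS]big_ord_recl /= sub0r normrN normr1 mul1r.
apply: eq_bigr => i _; rewrite sub0r normrN ger0_norm //.
by have /andP[] := @ext_node_itv R L.+1 A lam i.+2 isT A1 Alam (ltn_ord i).
Qed.

Lemma norm_ext_weight1 (R : realType) (L : nat) (A lam : R) : 1 < A -> A < lam ->
  `|ext_weight A lam (lift ord0 ord0 : 'I_L.+4)| =
  (\prod_(i < L.+2) (ext_node L.+1 A lam i.+2 - 1))^-1.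
Proof.
move=> A1 Alam; rewrite /ext_weight /ddiff_weight normfV normr_prod; congr (_^-1).
rewrite big_mkcond [LHS]big_ord_recl /= subr0 normr1 mul1r [LHS]big_ord_recl /= mul1r.
apply: eq_bigr => i _; rewrite -normrN opprB ger0_norm //= subr_ge0.
exact: (ltW (@ext_node_inc R L.+1 A lam 1 i.+2 isT A1 Alam (ltn_ord i) isT)).
Qed.

(** The polynomial X T_(L+1)(ext_arg X) has degree at most L + 2, so its divided difference of order
    L + 3 vanishes. At the Chebyshev nodes T has, up to a common sign, the sign of the weight, which
    turns the terms into |w_i| y_i; the factor X kills the node 0, and only the node 1 is left
    over. *)
Lemma sum_norm_ext_weight (R : realType) (L : nat) (A lam : R) : 1 < A -> A < lam ->
  \sum_(i < L.+4) `|ext_weight A lam i| * ext_node L.+1 A lam i =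
  `|ext_weight A lam (lift ord0 ord0 : 'I_L.+4)|
    * (1 + (chebyshevT R L.+1).[ext_arg A lam 1]).
Proof.
move=> A1 Alam; have b0 : (lam - A) / 2 != 0 by lra.
pose q : {poly R} := - ((lam - A) / 2)^-1 *: 'X + ((lam + A) / 2 / ((lam - A) / 2))%:P.
have qE s : q.[s] = ext_arg A lam s.
  by rewrite hornerD hornerZ hornerX hornerC /ext_arg; field; lra.
pose p := 'X * (chebyshevT R L.+1 \Po q).
have := @ddiff_coef R L.+3 (fun j : 'I_L.+4 => ext_node L.+1 A lam j) p (ext_node_inj A1 Alam).
have size_p : (size p <= L.+3)%N.
  rewrite (leq_trans (size_polyMleq _ _)) // size_polyX /= ltnS.
  rewrite (leq_trans (size_comp_poly_leq _ _)) // ltnS.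
  have sq : ((size q).-1 <= 1)%N.
    have : (size q <= 2)%N.
      rewrite (leq_trans (size_polyD _ _)) // geq_max (leq_trans (size_scale_leq _ _))
        ?size_polyX //.
      by rewrite (leq_trans (size_polyC_leq1 _)).
    by case: (size q) => [|[|[|]]].
  have sT : ((size (chebyshevT R L.+1)).-1 <= L.+1)%N.
    by have := size_chebyshevT R L.+1; case: (size _).
  by rewrite -[X in (_ <= X)%N]muln1 leq_mul.
rewrite (nth_default 0 size_p) (leqW size_p) => /(_ isT) dd0.
have normw (i : 'I_L.+4) : `|ext_weight A lam i| = ext_weight A lam i * (-1) ^+ (L.+3 - i).
  have /gtr0_norm <- := ext_weight_sign i A1 Alam.
  by rewrite normrM normrX normrN1 expr1n mulr1.
pose i1 : 'I_L.+4 := lift ord0 ord0.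
have -> : \sum_(i < L.+4) `|ext_weight A lam i| * ext_node L.+1 A lam i =
    \sum_(i < L.+4) (`|ext_weight A lam i| * ext_node L.+1 A lam i -
      (-1) ^+ L.+3 * (ext_weight A lam i * p.[ext_node L.+1 A lam i])).
  by rewrite sumrB -mulr_sumr [X in _ - _ * X]dd0 mulr0 subr0.
rewrite (bigD1 i1) //= big1 => [|i i1i].
  rewrite addr0 normw hornerM hornerX horner_comp qE /= subSS subn0.
  by rewrite [(-1) ^+ L.+3]exprS (_ : (bump 0 0)%:R = 1 :> R) //; ring.
rewrite hornerM hornerX horner_comp qE normw.
case: i i1i => -[|[|j]] ji //= _; first by rewrite mulr0 mul0r !mulr0 subrr.
have -> : ext_arg A lam ((lam + A) / 2 - (lam - A) / 2 * cheb_node R L.+1 j) =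
    cheb_node R L.+1 j by rewrite /ext_arg; field; lra.
rewrite chebyshevT_node // !subSS.
have -> : (-1) ^+ L.+3 = (-1) ^+ (L.+1 - j) * (-1) ^+ j :> R.
  by rewrite -exprD subnK; [rewrite !exprS !mulN1r opprK|rewrite -ltnS].
apply/eqP; rewrite subr_eq0; apply/eqP.
have E (u v x t : R) : t ^+ 2 = 1 -> u * v * x = v * t * (u * (x * t)).
  by move=> t1; rewrite -[LHS]mulr1 -t1; ring.
by apply: E; rewrite sqrr_sign.
Qed.

Lemma joukowsky_ge1 (R : rcfType) (c : R) : 1 <= c ->
  exists2 z : R, 1 <= z & c = (z + z^-1) / 2.
Proof.
move=> c1; pose s := Num.sqrt (c ^+ 2 - 1).
have s2 : s ^+ 2 = c ^+ 2 - 1 by rewrite sqr_sqrtr //; nra.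
have s0 : 0 <= s by rewrite sqrtr_ge0.
exists (c + s); first by lra.
have -> : (c + s)^-1 = c - s.
  by apply: (mulfI (_ : c + s != 0)); [lra|rewrite mulfV; [nra|lra]].
by field.
Qed.

Lemma chebyshevU_sinh (R : rcfType) (L : nat) (z : R) : z != 0 ->
  (((z + z^-1) / 2) ^+ 2 - 1) * (chebyshevU R L).[(z + z^-1) / 2] =
  ((z - z^-1) / 2) * ((z ^+ L.+1 - z ^- L.+1) / 2).
Proof. by move=> z0; rewrite -(chebyshevU_joukowsky _ z0); field. Qed.

Lemma expVn_sub_le (R : realFieldType) (n : nat) (z : R) : 1 <= z ->
  z ^+ n - z ^- n <= n%:R * z ^+ n * (z - z^-1).
Proof.
move=> z1; have z0 : 0 < z by lra.
have zV : z^-1 <= 1 by rewrite invf_le1.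
elim: n => [|n IHn]; first by rewrite expr0 invr1 subrr !mul0r.
have zn0 : 0 < z ^+ n by rewrite exprn_gt0.
have znV : z ^- n <= z ^+ n.+1.
  by rewrite (@le_trans _ _ 1) ?exprn_ege1 // invf_le1 // exprn_ege1.
have -> : z ^+ n.+1 - z ^- n.+1 = z * (z ^+ n - z ^- n) + z ^- n * (z - z^-1).
  by rewrite exprS; field; rewrite !gt_eqF.
rewrite -natr1 !mulrDl mul1r; apply: lerD; last by rewrite ler_wpM2r //; lra.
by rewrite exprS [n%:R * _]mulrCA -mulrA ler_wpM2l // ltW.
Qed.

Lemma bernoulli_ge (R : realFieldType) (n : nat) (h : R) : 0 <= h ->
  1 + n%:R * h <= (1 + h) ^+ n.
Proof.
move=> h0; elim: n => [|n IHn]; first by rewrite mul0r addr0.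
rewrite exprS; apply: (@le_trans _ _ ((1 + h) * (1 + n%:R * h))).
  by rewrite -natr1; have := ler0n R n; nra.
by rewrite ler_wpM2l //; lra.
Qed.

(** For z = e^t the right side is tanh(n t / 2) = (z^n - 1) / (z^n + 1), and s = sinh t. Bernoulli
    gives z^n >= 1 + n (z - 1), and s <= z - 1. *)
Lemma tanh_ge (R : realFieldType) (n : nat) (z s : R) : 1 <= z ->
  s = (z - z^-1) / 2 ->
  n%:R * s / (2 + n%:R * s) <=
  ((z ^+ n - z ^- n) / 2) / (1 + (z ^+ n + z ^- n) / 2).
Proof.
move=> z1 sE; have z0 : 0 < z by lra.
have Z1 : 1 + n%:R * (z - 1) <= z ^+ n.
  by rewrite -[z in z ^+ n](subrKC 1) bernoulli_ge //; lra.
have Z0 : 0 < z ^+ n by rewrite exprn_gt0.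
have -> : ((z ^+ n - z ^- n) / 2) / (1 + (z ^+ n + z ^- n) / 2) =
    (z ^+ n - 1) / (z ^+ n + 1).
  have Z2 : 0 < z ^+ n * 2 + (z ^+ n * z ^+ n + 1) by nra.
  have Z3 : 0 < z ^+ n + 1 by lra.
  by field; rewrite !gt_eqF.
have s0 : 0 <= s.
  by rewrite sE divr_ge0 // subr_ge0 (@le_trans _ _ 1) // invf_le1.
have sz : s <= z - 1.
  rewrite -subr_ge0 (_ : z - 1 - s = (z - 1) ^+ 2 / (2 * z)); last by rewrite sE; field; lra.
  by rewrite divr_ge0 ?sqr_ge0 //; lra.
have ns : n%:R * s <= n%:R * (z - 1) by rewrite ler_wpM2l.
have ns0 : 0 <= n%:R * s by rewrite mulr_ge0.
rewrite ler_pdivrMr; last by lra.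
by rewrite mulrAC ler_pdivlMr; [nra|lra].
Qed.

Lemma ext_arg_ge1 (R : realType) (A lam s : R) : 1 < A -> A < lam -> s <= 1 ->
  1 <= ext_arg A lam s.
Proof. by move=> A1 Al s1; rewrite /ext_arg ler_pdivlMr; lra. Qed.

(** A lower bound for 2 |w_0| / W, where W is the sum of the |w_i| y_i: the difference of the masses
    at 0 of the two laws of mean 1. The exponent [y] bounds N ln w for w = (sqrt lam + sqrt A) /
    (sqrt lam - sqrt A), the parameter with [ext_arg A lam 0] = (w + 1/w) / 2; the last factor comes
    from [tanh_ge]. *)
Definition separation (R : realType) (N A lam : R) : R :=
  let y := 2 * N * Num.sqrt A / (Num.sqrt lam - Num.sqrt A) in
  (A - 1) * (lam - 1) / (A * lam) * expR (- y) / (1 + y / 2).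

(** The left side is 2 / W, the scale at which the positive and the negative part of the weights
    have mean 1. The base (lam - A) / 4 <= lam / 4 is the capacity of [A, lam]. The hypothesis 3 A
    <= lam keeps [ext_arg A lam 1] at most 2, so that the other factors are bounded by a
    constant. *)
Lemma ext_cst_le (R : realType) (L : nat) (A lam : R) : 1 < A -> 3 * A <= lam ->
  2 * \prod_(i < L.+2) (ext_node L.+1 A lam i.+2 - 1) /
    (1 + (chebyshevT R L.+1).[ext_arg A lam 1]) <= 16 * (lam / 4) ^+ L.+2.
Proof.
move=> A1 Al; have Al' : A < lam by lra.
rewrite prod_ext_node // -/(ext_arg A lam 1).
have [z z1 cz] := joukowsky_ge1 (ext_arg_ge1 A1 Al' (lexx 1)).
have c2 : ext_arg A lam 1 <= 2 by rewrite /ext_arg ler_pdivrMr; lra.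
rewrite cz in c2 *; have z0 : 0 < z by lra.
rewrite chebyshevT_joukowsky ?gt_eqF //; set b := (lam - A) / 2.
have zV : z^-1 <= 1 by rewrite invf_le1.
have zz : z * z^-1 = 1 by rewrite mulfV ?gt_eqF.
have zV0 : 0 < z^-1 by rewrite invr_gt0.
have Zn0 : 0 < z ^+ L.+1 by rewrite exprn_gt0.
have ZV0 : 0 < z ^- L.+1 by rewrite invr_gt0.
rewrite -[b ^+ _ * _ * _]mulrA chebyshevU_sinh ?gt_eqF //.
set S := (z ^+ L.+1 - _) / 2; set T := (z ^+ L.+1 + _) / 2.
have ST : S <= 1 + T by rewrite /S /T; lra.
have T0 : 0 < 1 + T by rewrite /T; lra.
have s2 : (z - z^-1) / 2 <= 2 by nra.
have s0 : 0 <= (z - z^-1) / 2 by lra.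
have b0 : 0 < b by rewrite /b; lra.
have P0 : 0 < 2 ^+ L :> R by rewrite exprn_gt0.
rewrite ler_pdivrMr //.
apply: (@le_trans _ _ (2 * (b ^+ L.+2 * (2 * (1 + T)) / 2 ^+ L))).
  rewrite ler_pM2l // ler_pM2r ?invr_gt0 // ler_pM2l ?exprn_gt0 //.
  apply: (@le_trans _ _ ((z - z^-1) / 2 * (1 + T))); first by rewrite ler_wpM2l.
  by rewrite ler_wpM2r // ltW.
have -> : 2 * (b ^+ L.+2 * (2 * (1 + T)) / 2 ^+ L) = 16 * (b / 2) ^+ L.+2 * (1 + T).
  by rewrite !exprMn exprVn [2 ^+ L.+2]exprS [2 ^+ L.+1]exprS; field; rewrite gt_eqF.
rewrite ler_pM2r // ler_pM2l // lerXn2r ?nnegrE ?divr_ge0 ?ltW //; rewrite /b; lra.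
Qed.

Lemma ext_separation_ge (R : realType) (L : nat) (A lam : R) : 1 < A -> A < lam ->
  separation L.+1%:R A lam <=
  2 * (\prod_(i < L.+2) (ext_node L.+1 A lam i.+2 - 1) /
       \prod_(i < L.+2) ext_node L.+1 A lam i.+2) /
  (1 + (chebyshevT R L.+1).[ext_arg A lam 1]).
Proof.
move=> A1 Al.
under [X in _ <= 2 * (_ / X) / _]eq_bigr do rewrite -[ext_node _ _ _ _]subr0.
rewrite !prod_ext_node // -/(ext_arg A lam 1) -/(ext_arg A lam 0).
rewrite /separation; lazy zeta.
set m := Num.sqrt lam; set a := Num.sqrt A.
have aE : A = a ^+ 2 by rewrite sqr_sqrtr //; lra.
have mE : lam = m ^+ 2 by rewrite sqr_sqrtr //; lra.
have a0 : 0 < a by rewrite sqrtr_gt0; lra.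
have am : a < m by rewrite ltr_sqrt; lra.
clearbody a m.
have ma : 0 < m - a by lra.
have ma' : 0 < m + a by lra.
have ma2 : 0 < m ^+ 2 - a ^+ 2 by nra.
have [z z1 cz] := joukowsky_ge1 (ext_arg_ge1 A1 Al (lexx 1)).
have z0 : 0 < z by lra.
pose w := (m + a) / (m - a).
have w1 : 1 <= w by rewrite /w ler_pdivlMr; lra.
have w0 : 0 < w by lra.
have cw : ext_arg A lam 0 = (w + w^-1) / 2.
  rewrite /ext_arg /w aE mE; field.
  by rewrite !gt_eqF.
rewrite cz cw chebyshevT_joukowsky ?gt_eqF //.
set b := (lam - A) / 2; have b0 : 0 < b by rewrite /b; lra.
rewrite -![b ^+ _ * _ * _]mulrA !chebyshevU_sinh ?gt_eqF //.
set N := L.+1; set s := (z - z^-1) / 2; set t := (w - w^-1) / 2.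
set S := (z ^+ N - z ^- N) / 2; set S0 := (w ^+ N - w ^- N) / 2.
set T := (z ^+ N + z ^- N) / 2.
have s2 : s ^+ 2 = (A - 1) * (lam - 1) / b ^+ 2.
  have -> : s ^+ 2 = ((z + z^-1) / 2) ^+ 2 - 1 by rewrite /s; field; rewrite gt_eqF.
  by rewrite -cz /ext_arg /b; field; lra.
have tE : t = 2 * m * a / (m ^+ 2 - a ^+ 2).
  by rewrite /t /w; field; rewrite !gt_eqF.
have t2 : t ^+ 2 = A * lam / b ^+ 2.
  have -> : t ^+ 2 = ((w + w^-1) / 2) ^+ 2 - 1 by rewrite /t; field; rewrite gt_eqF.
  by rewrite -cw /ext_arg /b; field; lra.
have s0 : 0 < s.
  suff : 0 <= s /\ s != 0 by case=> s0 sN; rewrite lt_neqAle eq_sym sN.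
  split; first by rewrite /s divr_ge0 // subr_ge0 (@le_trans _ _ 1) // invf_le1.
  rewrite -sqrf_eq0 s2 mulf_neq0 ?invr_neq0 ?sqrf_eq0 ?gt_eqF //; nra.
have t0 : 0 < t by rewrite tE divr_gt0; nra.
have P0 : 0 < 2 ^+ L :> R by rewrite exprn_gt0.
have wN1 : 1 <= w ^+ N by rewrite exprn_ege1.
have zN0 : 0 < z ^+ N by rewrite exprn_gt0.
have zNV0 : 0 < z ^- N by rewrite invr_gt0.
have T0 : 0 < 1 + T by rewrite /T; lra.
have N0 : 0 < N%:R :> R by rewrite ltr0n.
have S0t : S0 <= N%:R * w ^+ N * t.
  by have := expVn_sub_le N w1; rewrite /S0 /t; lra.
have S00 : 0 < S0.
  rewrite /S0 divr_gt0 // subr_gt0 (@le_lt_trans _ _ 1) // ?invf_le1 //; first lra.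
  rewrite exprn_egt1 // /w ltr_pdivlMr; lra.
have ST := @tanh_ge _ N z s z1 erefl.
(* With [z] and [w] the parameters of the points 1 and 0, the powers of [b] cancel. There remain s /
   t, whose square is explicit, a hyperbolic tangent, and 1 / S0, of order w^(-N) up to a factor
   N. *)
have -> : 2 * (b ^+ N.+1 * (s * S / 2 ^+ L / (b ^+ N.+1 * (t * S0 / 2 ^+ L)))) / (1 + T)
    = 2 * s / t * (S / (1 + T)) / S0.
  by field; rewrite !gt_eqF // exprn_gt0.
have Ns0 : 0 < N%:R * s by rewrite mulr_gt0.
have wN0 : 0 < w ^+ N by lra.
have D0 : 0 < 2 + N%:R * s by rewrite addr_gt0.
apply: (@le_trans _ _ (2 * s / t * (N%:R * s / (2 + N%:R * s)) / (N%:R * w ^+ N * t))); last first.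
  apply: ler_pM.
  - by apply: ltW; positivity.
  - by apply: ltW; positivity.
  - by rewrite ler_wpM2l //; apply: ltW; positivity.
  - by rewrite lef_pV2 // posrE; positivity.
have -> : 2 * s / t * (N%:R * s / (2 + N%:R * s)) / (N%:R * w ^+ N * t) =
    s ^+ 2 / t ^+ 2 * (w ^+ N)^-1 / (1 + N%:R * s / 2).
  by field; rewrite !gt_eqF.
have -> : s ^+ 2 / t ^+ 2 = (A - 1) * (lam - 1) / (A * lam).
  have A0 : 0 < A by rewrite (lt_trans ltr01).
  by rewrite s2 t2; field; rewrite !gt_eqF // (lt_trans A0).
have st : s <= t.
  rewrite -(ler_pXn2r (ltn0Sn 1)) ?nnegrE ?(ltW s0) ?(ltW t0) // s2 t2.
  by rewrite ler_pM2r ?invr_gt0 ?exprn_gt0 //; nra.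
have ta : t <= 2 * a / (m - a).
  rewrite tE ler_pdivrMr // (_ : _ * (m ^+ 2 - a ^+ 2) = 2 * a * (m + a)); first by nra.
  by field; rewrite gt_eqF.
set y := 2 * N%:R * _ / _.
have yE : y = N%:R * (2 * a / (m - a)) by rewrite /y; field; rewrite gt_eqF.
have y0 : 0 < y by rewrite yE; positivity.
have wy : w ^+ N <= expR y.
  rewrite yE mulrC expRM_natr lerXn2r ?nnegrE ?expR_ge0 ?(ltW w0) //.
  apply: le_trans (expR_ge1Dx _); rewrite /w le_eqVlt; apply/orP; left; apply/eqP.
  by field; rewrite gt_eqF.
have A0 : 0 < A - 1 by rewrite subr_gt0.
have A2 : 0 < A by rewrite (lt_trans ltr01).
have l0 : 0 < lam - 1 by rewrite subr_gt0 (lt_trans A1).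
have l2 : 0 < lam by rewrite (lt_trans A2).
apply: ler_pM.
- by apply: ltW; positivity.
- by rewrite invr_ge0 addr_ge0 // divr_ge0 // ltW.
- by rewrite ler_pM2l ?expRN ?lef_pV2 ?posrE ?expR_gt0 //; positivity.
- rewrite lef_pV2 ?posrE; [|by positivity|by positivity].
  rewrite lerD2l ler_pM2r ?invr_gt0 //.
  by rewrite yE ler_pM2l // (le_trans st).
Qed.

(* Away from the node 0, [pi] and [pi'] are the positive and the negative part of the weights of a
   divided difference, scaled to mean [al]; they match because the divided difference of 'X is 0. *)
Lemma matching_priors (R : realType) (L : nat) (A lam al : R) :
  1 < A -> 3 * A <= lam -> 0 <= al <= 1 ->
  exists (pi pi' : 'I_L.+4 -> R) (kap : R),
  [/\ [/\ forall i, 0 <= pi i, forall i, 0 <= pi' i, \sum_i pi i = 1 & \sum_i pi' i = 1],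
      \sum_i pi i * ext_node L.+1 A lam i = al /\
      \sum_i pi' i * ext_node L.+1 A lam i = al,
      forall i, pi i - pi' i = kap * ext_weight A lam i,
      `|kap| <= al * (16 * (lam / 4) ^+ L.+2) &
      al * separation L.+1%:R A lam <=
      \sum_i pi i * (0 < i)%N%:R - \sum_i pi' i * (0 < i)%N%:R].
Proof.
move=> A1 Al3 /andP[al0 al1]; have Al : A < lam by lra.
pose y (i : 'I_L.+4) := ext_node L.+1 A lam i.
pose w (i : 'I_L.+4) := ext_weight A lam i.
have ymom (p : {poly R}) : (size p <= L.+3)%N -> \sum_i w i * p.[y i] = 0.
  move=> sp; have := ddiff_coef (ext_node_inj A1 Al) (leqW sp).
  by rewrite (nth_default 0 sp).
have w0 : \sum_i w i = 0.
  have := ymom 1; rewrite size_poly1 => /(_ isT) e; rewrite -[RHS]e.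
  by apply: eq_bigr => i _; rewrite hornerC mulr1.
have wy0 : \sum_i w i * y i = 0.
  have := ymom 'X; rewrite size_polyX => /(_ isT) e; rewrite -[RHS]e.
  by apply: eq_bigr => i _; rewrite hornerX.
have y0 i : 0 <= y i by have /andP[] := @ext_node_itv _ L.+1 A lam i isT A1 Al (ltn_ord i).
have y1 i : i != ord0 -> 1 <= y i.
  case: i => [[|[|i]] iN]; rewrite -val_eqE ?eqxx // => _.
  exact: (ltW (@ext_node_inc _ L.+1 A lam 1 i.+2 isT A1 Al iN isT)).
pose W := \sum_i `|w i| * y i.
have WE : W = `|w (lift ord0 ord0)| * (1 + (chebyshevT R L.+1).[ext_arg A lam 1]).
  exact: sum_norm_ext_weight.
set T := (chebyshevT R L.+1).[_] in WE.
have P1pos : 0 < \prod_(i < L.+2) (ext_node L.+1 A lam i.+2 - 1).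
  apply: prodr_gt0 => i _; rewrite subr_gt0.
  exact: (@ext_node_inc _ L.+1 A lam 1 i.+2 isT A1 Al (ltn_ord i) isT).
have T0 : 0 < 1 + T.
  have := ext_separation_ge L A1 Al; rewrite -/T.
  have [z z1 cz] := joukowsky_ge1 (ext_arg_ge1 A1 Al (lexx 1)).
  have z0 : 0 < z by lra.
  rewrite /T cz chebyshevT_joukowsky ?gt_eqF // => _.
  by positivity.
have w1pos : 0 < `|w (lift ord0 ord0)| by rewrite norm_ext_weight1 // invr_gt0.
have W0 : 0 < W by rewrite WE; positivity.
pose c := 2 / W.
have c0 : 0 < c by rewrite /c; positivity.
have cE : c = 2 * \prod_(i < L.+2) (ext_node L.+1 A lam i.+2 - 1) / (1 + T).
  by rewrite /c WE norm_ext_weight1 //; field; rewrite !gt_eqF.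
(* The sign [e] selects the positive or the negative part of the weights. Since the w_i y_i sum to
   0, both parts have first moment W / 2, which [c] scales to 1. *)
pose F (e : R) i := al * c * Num.max (e * w i) 0.
(* The missing mass goes to the node 0, where it does not change the mean. *)
pose G (e : R) i := if i == ord0 then 1 - \sum_(j | j != ord0) F e j else F e i.
have F0 e i : 0 <= F e i by rewrite /F; positivity; rewrite le_max lexx orbT.
have maxE (x : R) : Num.max x 0 = (x + `|x|) / 2.
  by case: (leP x 0) => x0; [rewrite ler0_norm // subrr mul0r|rewrite gtr0_norm //; field].
have Fy e : `|e| = 1 -> \sum_i F e i * y i = al.
  move=> e1; transitivity (\sum_i al * c / 2 * (e * (w i * y i) + `|w i| * y i)).
    apply: eq_bigr => i _; rewrite /F maxE normrM e1 mul1r; ring.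
  by rewrite -mulr_sumr big_split /= -mulr_sumr wy0 mulr0 add0r -/W /c; field; rewrite gt_eqF.
(* All nodes but 0 are at least 1, so the mass away from 0 is at most the mean [al]. *)
have sF e : `|e| = 1 -> \sum_(i | i != ord0) F e i <= 1.
  move=> e1; apply: le_trans al1; rewrite -(Fy e e1) [leRHS](bigD1 ord0) //=.
  rewrite -[leLHS]add0r; apply: lerD; first exact: mulr_ge0.
  apply: ler_sum => i i0.
  by rewrite -[leLHS]mulr1 ler_wpM2l ?y1.
have G0 e i : `|e| = 1 -> 0 <= G e i.
  by move=> e1; rewrite /G; case: ifP => _ //; rewrite subr_ge0 sF.
have GN e i : i != ord0 -> G e i = F e i by rewrite /G => /negPf ->.
have G1 e : \sum_i G e i = 1.
  rewrite (bigD1 ord0) //= {1}/G eqxx.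
  by rewrite [X in _ + X](eq_bigr (F e)) ?subrK // => i; exact: GN.
have Gy e : `|e| = 1 -> \sum_i G e i * y i = al.
  move=> e1; rewrite -(Fy e e1); apply: eq_bigr => i _.
  by have [->|/GN -> //] := eqVneq i ord0; rewrite !mulr0.
have FB e i : F e i - F (- e) i = al * c * e * w i.
  by rewrite /F !maxE mulNr normrN; field.
have GB e i : G e i - G (- e) i = al * c * e * w i.
  have [->|i0] := eqVneq i ord0; last by rewrite !GN.
  transitivity (- (\sum_(j | j != ord0) F e j - \sum_(j | j != ord0) F (- e) j)).
    by rewrite /G eqxx; ring.
  rewrite -sumrB; under eq_bigr do rewrite FB.
  have : \sum_(j | j != ord0) w j = - w ord0.
    by apply/eqP; rewrite -addr_eq0 addrC -[X in _ == X]w0 [X in _ == X](bigD1 ord0).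
  by rewrite -mulr_sumr -mulrN => ->; rewrite opprK.
have pos0 : (0 < (ord0 : 'I_L.+4))%N%:R = 0 :> R by [].
have GP e : \sum_i G e i * (0 < i)%N%:R = 1 - G e ord0.
  have := G1 e; rewrite (bigD1 ord0) // => E.
  rewrite -[X in _ = X - _]E addrC addKr [LHS](bigD1 ord0) //= mulr0 add0r.
  by apply: eq_bigr => i i0; rewrite lt0n i0 mulr1.
(* With this sign the first law has the smaller mass at 0, hence the larger expected support. *)
exists (G (- Num.sg (w ord0))), (G (Num.sg (w ord0))), (al * c * - Num.sg (w ord0)).
have w00 : w ord0 != 0.
  have := ext_weight_sign (ord0 : 'I_L.+4) A1 Al; rewrite -/(w ord0).
  by apply: contraTneq => ->; rewrite mul0r ltxx.
have e1 : `|Num.sg (w ord0)| = 1 by rewrite normr_sg w00.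
split.
- by split => // i; apply: G0; rewrite ?normrN.
- by split; apply: Gy; rewrite ?normrN.
- by move=> i; rewrite -GB opprK.
- rewrite normrM normrN e1 mulr1 ger0_norm; last by positivity.
  by rewrite ler_wpM2l // cE ext_cst_le.
- rewrite !GP (_ : 1 - _ - _ = - (G (- Num.sg (w ord0)) ord0 - G (- - Num.sg (w ord0)) ord0)).
    rewrite GB mulrN mulNr opprK -(mulrA al) -mulrA -(mulrA c) ler_wpM2l //.
    rewrite -normrEsg norm_ext_weight0 // cE.
    apply: le_trans (ext_separation_ge L A1 Al) _; rewrite -/T.
    by rewrite le_eqVlt; apply/orP; left; apply/eqP; ring.
  by rewrite opprK; ring.
Qed.

(** * The lower bound *)

Lemma Em_add (R : comNzRingType) (T : finType) (n : nat) (q h : T -> R) :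
  \sum_t q t = 1 ->
  Em (nseq n q) (fun s => \sum_(t <- s) h t) = n%:R * \sum_t q t * h t.
Proof.
move=> q1; elim: n => [|n IHn] /=; first by rewrite big_nil mul0r.
under eq_bigr => t _.
  under eq_Em do rewrite big_cons.
  rewrite EmD IHn Em_cst; last by move=> q'; rewrite mem_nseq => /andP[_ /eqP ->].
  over.
under eq_bigr do rewrite mulrDr.
by rewrite big_split /= -mulr_suml q1 mul1r -natr1 mulrDl mul1r addrC.
Qed.

Lemma expR_le_lin (R : realType) (tau u : R) : 0 <= u <= tau -> tau < 1 ->
  expR u <= 1 + u / (1 - tau).
Proof.
move=> /andP[u0 ut] t1.
have u1 : 0 < 1 - u by lra.
have t0 : 0 < 1 - tau by lra.
have : 1 - u <= expR (- u) by exact: expR_ge1Dx.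
rewrite expRN => h; have e0 := expR_gt0 u.
have : expR u <= (1 - u)^-1 by rewrite -[leLHS]invrK lef_pV2 // posrE invr_gt0.
move/le_trans; apply; rewrite -[leLHS]mul1r ler_pdivrMr //.
have -> : (1 + u / (1 - tau)) * (1 - u) = 1 + u * (tau - u) / (1 - tau).
  by field; rewrite gt_eqF.
by rewrite lerDl divr_ge0 ?mulr_ge0 ?subr_ge0 // ltW.
Qed.

Definition word_sum (R : realType) (L : nat) (A lam : R) (s : seq 'I_L.+4) : R :=
  \sum_(t <- s) ext_node L.+1 A lam t.

(** Take th = tau / lam, so that th y <= tau on the nodes, where e^u <= 1 + u / (1 - tau). This
    linear bound loses one factor 1 - tau of the mean (1 - tau)^2; the moment generating function is
    at most e^(th (1 - tau)), and a drift of tau below the threshold k remains per letter. *)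
Lemma chernoff_word_sum (R : realType) (L i j k : nat) (A lam tau b : R)
    (pi pi' : 'I_L.+4 -> R) :
  1 < A -> A < lam -> 0 < tau < 1 -> (i + j <= k)%N ->
  (forall t, 0 <= pi t) -> (forall t, 0 <= pi' t) ->
  \sum_t pi t = 1 -> \sum_t pi' t = 1 ->
  \sum_t pi t * ext_node L.+1 A lam t = (1 - tau) ^+ 2 ->
  \sum_t pi' t * ext_node L.+1 A lam t = (1 - tau) ^+ 2 ->
  Em (nseq i pi ++ nseq j pi') (fun s => (b < word_sum A lam s)%R%:R) <=
  expR (tau / lam * (k%:R * (1 - tau) - b)).
Proof.
move=> A1 Al /andP[t0 t1] ijk pi0 pi'0 pi1 pi'1 piy pi'y.
have l0 : 0 < lam by lra.
pose th := tau / lam; have th0 : 0 < th by rewrite /th; positivity.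
pose h (t : 'I_L.+4) := expR (th * ext_node L.+1 A lam t).
have mgf (q : 'I_L.+4 -> R) : (forall t, 0 <= q t) -> \sum_t q t = 1 ->
    \sum_t q t * ext_node L.+1 A lam t = (1 - tau) ^+ 2 ->
    0 <= \sum_t q t * h t <= expR (th * (1 - tau)).
  move=> q0 q1 qy; rewrite sumr_ge0 /= => [|t _]; last by rewrite mulr_ge0 ?expR_ge0.
  apply: le_trans (expR_ge1Dx _).
  apply: (@le_trans _ _ (\sum_t (q t + th / (1 - tau) * (q t * ext_node L.+1 A lam t)))).
    apply: ler_sum => t _.
    have /andP[y0 yl] := @ext_node_itv _ L.+1 A lam t isT A1 Al (ltn_ord t).
    have -> : q t + th / (1 - tau) * (q t * ext_node L.+1 A lam t) =
        q t * (1 + th * ext_node L.+1 A lam t / (1 - tau)) by field; lra.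
    rewrite ler_wpM2l // expR_le_lin // mulr_ge0 ?(ltW th0) //=.
    by rewrite /th mulrAC ler_pdivrMr // ler_pM2l.
  rewrite big_split /= q1 -mulr_sumr qy le_eqVlt; apply/orP; left; apply/eqP.
  by field; lra.
apply: (@le_trans _ _ (expR (- th * b) *
    Em (nseq i pi ++ nseq j pi') (fun s => \prod_(t <- s) h t))).
  rewrite -EmZ; apply: ler_Em => [q|s _].
    by rewrite mem_cat !mem_nseq => /orP[] /andP[_ /eqP ->].
  have -> : \prod_(t <- s) h t = expR (th * word_sum A lam s).
    by rewrite /word_sum mulr_sumr expR_sum.
  rewrite -expRD; case: ltP => bs /=; last exact: expR_ge0.
  by rewrite -expR0 ler_expR; nra.
rewrite Em_prod_cat.
have /andP[g0 g1] := mgf _ pi0 pi1 piy; have /andP[g'0 g'1] := mgf _ pi'0 pi'1 pi'y.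
apply: (@le_trans _ _ (expR (- th * b) *
    (expR (th * (1 - tau)) ^+ i * expR (th * (1 - tau)) ^+ j))).
  rewrite ler_wpM2l ?expR_ge0 // ler_pM ?exprn_ge0 //.
    by rewrite lerXn2r // nnegrE expR_ge0.
  by rewrite lerXn2r // nnegrE expR_ge0.
rewrite -!expRM_natr -!expRD ler_expR.
have : (i + j)%:R <= k%:R :> R by rewrite ler_nat.
rewrite natrD -/th => ijk'.
have : th * (1 - tau) * (i%:R + j%:R) <= th * (1 - tau) * k%:R.
  by rewrite ler_wpM2l // mulr_ge0 //; lra.
lra.
Qed.

(* The law with masses [y t / k] for the letters [t] of [s], completed to a probability by the
   mass of the symbol [0]. *)
Definition word_mass (R : realType) (L : nat) (A lam : R) (k : nat) (s : seq 'I_L.+4)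
    (j : nat) : R :=
  if j is i.+1 then ext_node L.+1 A lam (nth ord0 s i) / k%:R
  else 1 - word_sum A lam s / k%:R.

Lemma sum_word_mass (R : realType) (L : nat) (A lam : R) (k : nat) (s : seq 'I_L.+4) :
  size s = k -> \sum_(j < k.+1) word_mass A lam k s j = 1.
Proof.
move=> sk; rewrite big_ord_recl /= (_ : \sum_(i < k) _ = word_sum A lam s / k%:R) ?subrK //.
rewrite /word_sum mulr_suml (big_nth ord0) sk big_mkord; apply: eq_bigr => i _.
by [].
Qed.

Lemma word_mass_ge0 (R : realType) (L : nat) (A lam : R) (k : nat) (s : seq 'I_L.+4) :
  (0 < k)%N -> 1 < A -> A < lam -> word_sum A lam s <= k%:R ->
  forall j, 0 <= word_mass A lam k s j.
Proof.
move=> k0 A1 Al sk [|j] /=.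
  by rewrite subr_ge0 ler_pdivrMr ?ltr0n // mul1r.
rewrite divr_ge0 //.
by have /andP[] := @ext_node_itv _ L.+1 A lam (nth ord0 s j) isT A1 Al (ltn_ord (nth ord0 s j)).
Qed.

Lemma nth_mid (T : Type) (x0 t : T) (s1 s2 : seq T) (i : nat) :
  nth x0 (s1 ++ t :: s2) i = if i == size s1 then t else nth x0 (s1 ++ x0 :: s2) i.
Proof.
rewrite !nth_cat; case: ltngtP => [//|lt|->]; last by rewrite subnn.
by case: (i - size s1)%N (subn_gt0 (size s1) i) => [|m]; rewrite ?lt.
Qed.

Lemma word_sum_mid (R : realType) (L : nat) (A lam : R) (s1 s2 : seq 'I_L.+4) (t : 'I_L.+4) :
  word_sum A lam (s1 ++ t :: s2) = word_sum A lam (s1 ++ s2) + ext_node L.+1 A lam t.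
Proof. by rewrite /word_sum !big_cat big_cons /= addrCA addrC. Qed.

(** The masses are affine in the node value of one letter: its own symbol moves with slope 1 / k and
    the symbol 0 compensates with slope - 1 / k. The absolute slopes sum to the 2 / k of the
    derivative bound. *)
Lemma word_mass_mid (R : realType) (L : nat) (A lam : R) (k : nat) (s1 s2 : seq 'I_L.+4)
    (t : 'I_L.+4) (j : nat) :
  word_mass A lam k (s1 ++ t :: s2) j =
  ((j == (size s1).+1)%:R - (j == 0)%:R) / k%:R * ext_node L.+1 A lam t +
  word_mass A lam k (s1 ++ ord0 :: s2) j.
Proof.
case: j => [|j] /=.
  by rewrite !word_sum_mid /=; ring.
rewrite eqSS subr0 nth_mid; case: eqP => [->|_]; last by rewrite !mul0r add0r.
by rewrite nth_cat ltnn subnn /= mul0r addr0; ring.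
Qed.

Lemma norm_sum_mid_le (R : realType) (L n k : nat) (A lam kap : R)
    (dpi : 'I_L.+4 -> R) (f : seq 'I_k.+1 -> R) (s1 s2 : seq 'I_L.+4) :
  (0 < k)%N -> 1 < A -> A < lam ->
  (forall t, dpi t = kap * ext_weight A lam t) -> (forall s, `|f s| <= 1) ->
  (size s1 + size s2).+1 = k -> word_sum A lam (s1 ++ s2) + lam <= k%:R ->
  `|\sum_t dpi t * Em (nseq n (fun j : 'I_k.+1 => word_mass A lam k (s1 ++ t :: s2) j)) f|
  <= `|kap| * ('C(n, L.+3)%:R * (2 / k%:R) ^+ L.+3).
Proof.
move=> k0 A1 Al dpiE f1 sk s_le; have k0' : 0 < k%:R :> R by rewrite ltr0n.
pose d (j : 'I_k.+1) : R := ((j == (size s1).+1 :> nat)%:R - (j == 0 :> nat)%:R) / k%:R.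
pose a (j : 'I_k.+1) := word_mass A lam k (s1 ++ ord0 :: s2) j.
pose q := Em (nseq n (fun j => d j *: 'X + (a j)%:P)) (fun s => (f s)%:P).
have -> : \sum_t dpi t * Em (nseq n (fun j : 'I_k.+1 => word_mass A lam k (s1 ++ t :: s2) j)) f
    = kap * ddiff (fun t : 'I_L.+4 => ext_node L.+1 A lam t) q.
  rewrite mulr_sumr; apply: eq_bigr => t _; rewrite dpiE -mulrA; congr (_ * (_ * _)).
  rewrite /q horner_Em; congr (Em (nseq n _) f); apply/funext => j.
  by rewrite word_mass_mid hornerD hornerZ hornerX hornerC.
have y_itv (t : 'I_L.+4) := @ext_node_itv _ L.+1 A lam t isT A1 Al (ltn_ord t).
have [z /andP[z0 zl] ->] := ddiff_mean_value q (ext_node_inj A1 Al) y_itv.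
have sum_d (i : nat) : (i <= k)%N -> \sum_(j < k.+1) (j == i :> nat)%:R = 1 :> R.
  move=> ik; rewrite (bigD1 (Ordinal (ik : (i < k.+1)%N))) //= eqxx big1 ?addr0 // => j.
  by rewrite -val_eqE /= => /negPf ->.
have sk1 : ((size s1).+1 <= k)%N by rewrite -sk ltnS leq_addr.
rewrite normrM ler_wpM2l // norm_nderivn_Em //.
(* The intermediate point [z] need not be a node. As the other letters leave room for lam, the
   masses at [z] are still nonnegative, so their absolute sum is 1. *)
- have dza0 j : 0 <= d j * z + a j.
    case: j => -[|j] jk; rewrite /d /a /=.
      have -> : (0 - 1) / k%:R * z + (1 - word_sum A lam (s1 ++ ord0 :: s2) / k%:R) =
          (k%:R - (word_sum A lam (s1 ++ s2) + z)) / k%:R.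
        by rewrite word_sum_mid /= addr0; field; rewrite gt_eqF.
      by rewrite divr_ge0 ?(ltW k0') // subr_ge0; lra.
    have /andP[y0 _] := y_itv (nth ord0 (s1 ++ ord0 :: s2) j).
    by rewrite subr0 addr_ge0 ?mulr_ge0 ?invr_ge0 // ltW.
  rewrite (eq_bigr (fun j => d j * z + a j)) => [|j _]; last by rewrite ger0_norm.
  rewrite big_split /= -mulr_suml sum_word_mass; last by rewrite size_cat /= addnS.
  by rewrite -mulr_suml sumrB !sum_d // subrr !mul0r add0r.
- apply: (@le_trans _ _ (\sum_(j < k.+1) ((j == (size s1).+1 :> nat)%:R / k%:R
      + (j == 0 :> nat)%:R / k%:R))).
    apply: ler_sum => j _; rewrite /d mulrBl (le_trans (ler_normB _ _)) //.
    by rewrite !ger0_norm // divr_ge0.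
  by rewrite big_split /= -!mulr_suml !sum_d // -mulrDl.
Qed.

(** Beyond k the mass of the symbol 0 would be negative; the value 0 there keeps the power in
    [0, 1]. *)
Definition word_power (R : realType) (L n k : nat) (A lam : R) (f : seq 'I_k.+1 -> R)
    (s : seq 'I_L.+4) : R :=
  if word_sum A lam s < k%:R
  then Em (nseq n (fun j : 'I_k.+1 => word_mass A lam k s j)) f else 0.

Lemma word_power_itv (R : realType) (L n k : nat) (A lam : R) (f : seq 'I_k.+1 -> R)
    (s : seq 'I_L.+4) :
  (0 < k)%N -> 1 < A -> A < lam -> (forall x, 0 <= f x <= 1) -> size s = k ->
  0 <= word_power n A lam f s <= 1.
Proof.
move=> k0 A1 Al f01 sk; rewrite /word_power; case: ltP => sk'; last by rewrite lexx ler01.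
have m0 := word_mass_ge0 k0 A1 Al (ltW sk').
set q := fun j : 'I_k.+1 => _.
have q0 : forall q', q' \in nseq n q -> forall t, 0 <= q' t.
  by move=> q'; rewrite mem_nseq => /andP[_ /eqP ->] t; apply: m0.
have q1 : forall q', q' \in nseq n q -> \sum_t q' t = 1.
  by move=> q'; rewrite mem_nseq => /andP[_ /eqP ->]; apply: sum_word_mass.
apply/andP; split.
  rewrite -(Em_cst 0 q1); apply: ler_Em => // x _; by case/andP: (f01 x).
rewrite -[X in _ <= X](Em_cst 1 q1); apply: ler_Em => // x _; by case/andP: (f01 x).
Qed.

(* Exchanging the law of one letter costs [kap] times a divided difference of order L + 3, that is
   a derivative of the expectation in that letter; [B] pays for the words whose sum is so close to
   [k] that the power is cut off for some values of that letter only. *)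
Lemma word_power_hybrid (R : realType) (L n k : nat) (A lam kap B : R)
    (pi pi' : 'I_L.+4 -> R) (f : seq 'I_k.+1 -> R) :
  (0 < k)%N -> 1 < A -> A < lam ->
  (forall t, 0 <= pi t) -> (forall t, 0 <= pi' t) ->
  \sum_t pi t = 1 -> \sum_t pi' t = 1 ->
  (forall t, pi t - pi' t = kap * ext_weight A lam t) ->
  (forall x, 0 <= f x <= 1) ->
  (forall i j, (i + j).+1 = k ->
    Em (nseq i pi ++ nseq j pi')
      (fun s => (k%:R - lam - 1 < word_sum A lam s)%R%:R) <= B) ->
  `|Em (nseq k pi) (word_power n A lam f) - Em (nseq k pi') (word_power n A lam f)| <=
  k%:R * (`|kap| * ('C(n, L.+3)%:R * (2 / k%:R) ^+ L.+3) + 2 * B).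
Proof.
move=> k0 A1 Al pi0 pi'0 pi1 pi'1 piB f01 bad; apply: Em_hybrid => i j ijk.
set Del := `|kap| * _.
have Del0 : 0 <= Del by rewrite /Del; positivity; rewrite ?ltr0n.
have qs0 : forall q, q \in nseq i pi ++ nseq j pi' -> forall t, 0 <= q t.
  by move=> q; rewrite mem_cat !mem_nseq => /orP[] /andP[_ /eqP ->].
have qs1 : forall q, q \in nseq i pi ++ nseq j pi' -> \sum_t q t = 1.
  by move=> q; rewrite mem_cat !mem_nseq => /orP[] /andP[_ /eqP ->].
rewrite Em_mid (le_trans (ler_norm_Em _ qs0)) //.
apply: (@le_trans _ _ (Em (nseq i pi ++ nseq j pi')
  (fun s => Del + 2 * (k%:R - lam - 1 < word_sum A lam s)%R%:R))); last first.
  by rewrite EmD Em_cst // EmZ lerD2l ler_pM2l // bad.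
apply: ler_Em => // s; rewrite !size_cat !size_nseq => sij.
set s1 := take i s; set s2 := drop i s.
have s12 : s1 ++ s2 = s by rewrite cat_take_drop.
have size12 : (size s1 + size s2).+1 = k by rewrite -size_cat s12 sij.
have sizet t : size (s1 ++ t :: s2) = k by rewrite size_cat /= addnS.
case: ltP => [_|s_le] /=; rewrite ?mulr1 ?mulr0 ?addr0.
  rewrite (le_trans (ler_norm_sum _ _ _)) // -[leLHS]add0r lerD //.
  apply: (@le_trans _ _ (\sum_t (pi t + pi' t))); last by rewrite big_split /= pi1 pi'1.
  apply: ler_sum => t _; rewrite normrM.
  have /andP[p0 p1] := word_power_itv n k0 A1 Al f01 (sizet t).
  rewrite (ger0_norm p0) -[leRHS]mulr1 ler_pM // (le_trans (ler_normB _ _)) //.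
  by rewrite !ger0_norm.
have -> : \sum_t (pi t - pi' t) * word_power n A lam f (s1 ++ t :: s2) =
    \sum_t (pi t - pi' t) * Em (nseq n (fun j : 'I_k.+1 => word_mass A lam k (s1 ++ t :: s2) j)) f.
  apply: eq_bigr => t _; congr (_ * _); rewrite /word_power ifT // word_sum_mid s12.
  have /andP[_ yl] := @ext_node_itv _ L.+1 A lam t isT A1 Al (ltn_ord t).
  lra.
rewrite /Del; apply: (@norm_sum_mid_le _ _ _ _ _ _ _ (fun t => pi t - pi' t)) => //; last by
  rewrite s12; lra.
by move=> x; have /andP[f0 f1] := f01 x; rewrite ger0_norm.
Qed.

(** The slack of 1 in the sum leaves the symbol 0 a mass of at least 1 / k, and this symbol is the
    summand 1 of the support size. The other masses qualify because 1 is the least positive node. *)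
Lemma word_law (R : realType) (L k : nat) (A lam : R) (s : seq 'I_L.+4) :
  (0 < k)%N -> 1 < A -> A < lam -> size s = k -> word_sum A lam s <= k%:R - 1 ->
  [/\ D_ k (word_mass A lam k s),
      forall j, (k.+1 <= j)%N -> word_mass A lam k s j = 0 &
      support_size (word_mass A lam k s) = (1 + \sum_(t <- s) (0 < t)%N%:R)%:E].
Proof.
move=> k0 A1 Al sk s_le; have k0' : 0 < k%:R :> R by rewrite ltr0n.
have m0 : forall j, 0 <= word_mass A lam k s j.
  by apply: word_mass_ge0 => //; lra.
have mk j : (k.+1 <= j)%N -> word_mass A lam k s j = 0.
  by case: j => [//|j] kj; rewrite /= nth_default ?mul0r // sk.
have pos_node (t : 'I_L.+4) : (0 < ext_node L.+1 A lam t) = (0 < t)%N.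
  case: t => -[|t] tL; first by rewrite ltxx.
  exact: (@ext_node_inc _ L.+1 A lam 0 t.+1 isT A1 Al tL isT).
have node1 (t : 'I_L.+4) : (0 < t)%N -> 1 <= ext_node L.+1 A lam t.
  case: t => -[|[|t]] tL //= _.
  exact: (ltW (@ext_node_inc _ L.+1 A lam 1 t.+2 isT A1 Al tL isT)).
have mass0 : k%:R^-1 <= word_mass A lam k s 0.
  rewrite -subr_ge0 /=.
  have -> : 1 - word_sum A lam s / k%:R - k%:R^-1 = (k%:R - 1 - word_sum A lam s) / k%:R.
    by field; rewrite gt_eqF.
  by rewrite divr_ge0 ?subr_ge0 // ltW.
split => //.
- split; first split=> //.
    by rewrite (nneseries_finite m0 mk) sum_word_mass.
  move=> [_|j]; first exact: mass0.
  rewrite /= pmulr_lgt0 ?invr_gt0 // pos_node => /node1 h.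
  by rewrite ler_pdivlMr // mulVf // gt_eqF.
- rewrite /support_size (@nneseries_finite _ k.+1 (fun j => (0 < word_mass A lam k s j)%R%:R)) //.
    rewrite big_ord_recl (lt_le_trans _ mass0) ?invr_gt0 //=; congr (_ + _)%:E.
    rewrite (big_nth ord0) sk big_mkord; apply: eq_bigr => i _.
    by rewrite pmulr_lgt0 ?invr_gt0 // pos_node.
  by move=> j /mk ->; rewrite ltxx.
Qed.

(** Thresholding the estimator midway between the two mean support sizes gives a test of power at
    least 9/10 under one prior and at most 1/10 under the other, up to exceptional words. The terms
    to be kept below the gap 8/10 are the exchange of k letters, the words with sum near k (2 k
    times in the exchange, once for each prior), and the words whose support size deviates by [D]
    from its mean, again for both priors. *)
Lemma not_achievable_core (R : realType) (L n k : nat) (eps A lam tau D : R) :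
  (0 < k)%N -> 1 < A -> 3 * A <= lam -> 0 < tau < 1 -> 0 < D ->
  2 * (eps * k%:R) + 2 * D <= k%:R * ((1 - tau) ^+ 2 * separation L.+1%:R A lam) ->
  k%:R * (16 * (lam / 4) ^+ L.+2 * ('C(n, L.+3)%:R * (2 / k%:R) ^+ L.+3)) +
  (2 * k%:R + 2) * expR (tau / lam * (lam + 1 - tau * k%:R)) +
  2 * k%:R / D ^+ 2 < 8 / 10 ->
  ~ achievable k eps n.
Proof.
move=> k0 A1 Al3 t01 D0 sep small [Shat ach].
have Al : A < lam by lra.
have k0' : 0 < k%:R :> R by rewrite ltr0n.
have al01 : 0 <= (1 - tau) ^+ 2 <= 1 by case/andP: t01 => t0 t1; nra.
have [pi [pi' [kap [[pi0 pi'0 pi1 pi'1] [piy pi'y] piB kap_le sep_le]]]] :=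
  @matching_priors R L A lam _ A1 Al3 al01.
pose nz (s : seq 'I_L.+4) : R := \sum_(t <- s) (0 < t)%N%:R.
set mu := Em (nseq k pi) nz; set mu' := Em (nseq k pi') nz.
have muB : mu - mu' >= 2 * (eps * k%:R) + 2 * D.
  rewrite /mu /mu' !Em_add // -mulrBr (le_trans sep) // ler_pM2l //.
pose Sh (s : seq nat) : R :=
  if insub s is Some x then (Shat x : int)%:~R else 0.
(* The summand 1 counts the symbol 0, which is in every support. *)
pose mid := 1 + (mu + mu') / 2.
pose f (x : seq 'I_k.+1) : R := (mid < Sh (map val x))%R%:R.
have f01 x : 0 <= f x <= 1 by rewrite /f; case: (_ < _); rewrite ?lexx ?ler01.
pose F (s : seq 'I_L.+4) := word_power n A lam f s.
pose B := expR (tau / lam * (lam + 1 - tau * k%:R)).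
have bad i j : (i + j <= k)%N ->
    Em (nseq i pi ++ nseq j pi') (fun s => (k%:R - lam - 1 < word_sum A lam s)%R%:R) <= B.
  move=> ijk; apply: le_trans (chernoff_word_sum (k%:R - lam - 1) A1 Al t01 ijk pi0 pi'0 pi1
    pi'1 piy pi'y) _.
  by rewrite ler_expR le_eqVlt; apply/orP; left; apply/eqP; congr (_ * _); ring.
have hyb : `|Em (nseq k pi) F - Em (nseq k pi') F| <=
    k%:R * (`|kap| * ('C(n, L.+3)%:R * (2 / k%:R) ^+ L.+3) + 2 * B).
  apply: (word_power_hybrid n k0 A1 Al pi0 pi'0 pi1 pi'1 piB f01) => i j ijk.
  by apply: bad; rewrite -ijk leqnSn.
have err (s : seq 'I_L.+4) : size s = k -> word_sum A lam s <= k%:R - 1 ->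
    Em (nseq n (fun j : 'I_k.+1 => word_mass A lam k s j))
      (fun x => (eps * k%:R <= `|Sh (map val x) - (1 + nz s)|)%R%:R) <= 10^-1.
  move=> sk s_le; have [Dk m_out supp] := word_law k0 A1 Al sk s_le.
  have m0 : forall j, 0 <= word_mass A lam k s j by case: Dk => -[].
  have := ach _ Dk; rewrite supp.
  rewrite (_ : [set _ | _] = [set x : n.-tuple nat | eps * k%:R <= `|Sh x - (1 + nz s)|]); last
    first.
    by apply/funext => x /=; rewrite /Sh valK lee_fin.
  by rewrite (iid_prob_Em n (fun x => eps * k%:R <= `|Sh x - (1 + nz s)|) m0 m_out) lee_fin.
have mass_qs (s : seq 'I_L.+4) : size s = k -> word_sum A lam s <= k%:R - 1 ->
    (forall q, q \in nseq n (fun j : 'I_k.+1 => word_mass A lam k s j) -> forall t, 0 <= q t) /\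
    (forall q, q \in nseq n (fun j : 'I_k.+1 => word_mass A lam k s j) -> \sum_t q t = 1).
  move=> sk s_le; split=> q; rewrite mem_nseq => /andP[_ /eqP ->]; last exact: sum_word_mass.
  by move=> t; apply: word_mass_ge0 => //; lra.
have hi (s : seq 'I_L.+4) : size s = k -> word_sum A lam s <= k%:R - 1 -> mu - D < nz s -> 9 /
  10 <= F s.
  move=> sk s_le nzs; have [q0 q1] := mass_qs s sk s_le.
  rewrite /F /word_power ifT; last by lra.
  suff : 1 - Em (nseq n (fun j : 'I_k.+1 => word_mass A lam k s j)) f <= 10^-1 by lra.
  rewrite -{1}(Em_cst 1 q1) -EmB; apply: le_trans (err s sk s_le).
  apply: ler_Em => // x _; rewrite /f; case: (ltP mid) => Sx /=; first by rewrite subrr ler0n.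
  rewrite subr0 ler1n lt0b ler_normr; apply/orP; right; rewrite /mid in Sx; lra.
have lo (s : seq 'I_L.+4) : size s = k -> word_sum A lam s <= k%:R - 1 -> nz s < mu' + D -> F s
  <= 10^-1.
  move=> sk s_le nzs; have [q0 q1] := mass_qs s sk s_le.
  rewrite /F /word_power ifT; last by lra.
  apply: le_trans (err s sk s_le).
  apply: ler_Em => // x _; rewrite /f; case: (ltP mid) => Sx /=; last by rewrite ler0n.
  rewrite ler1n lt0b ler_normr; apply/orP; left; rewrite /mid in Sx; lra.
have F01 (s : seq 'I_L.+4) : size s = k -> 0 <= F s <= 1 by exact: word_power_itv.
have qsP (q : 'I_L.+4 -> R) : (forall t, 0 <= q t) -> forall q', q' \in nseq k q -> forall t, 0
  <= q' t.
  by move=> q0 q'; rewrite mem_nseq => /andP[_ /eqP ->].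
have dev (q : 'I_L.+4 -> R) : (forall t, 0 <= q t) -> \sum_t q t = 1 ->
    Em (nseq k q) (fun s => (D <= `|nz s - Em (nseq k q) nz|)%R%:R) <= k%:R / D ^+ 2.
  move=> q0 q1; have -> : k%:R / D ^+ 2 = k%:R * 1 ^+ 2 / D ^+ 2 by rewrite expr1n mulr1.
  apply: Em_chebyshev => // s1 s2 t t'.
  rewrite /nz !big_cat !big_cons /= opprD addrACA subrr add0r opprD addrACA subrr addr0.
  by case: (0 < t)%N; case: (0 < t')%N; rewrite ?subrr ?normr0 ?subr0 ?normr1 ?sub0r ?normrN
    ?normr1 ?ler01.
have bad1 : Em (nseq k pi) (fun s => (k%:R - lam - 1 < word_sum A lam s)%R%:R) <= B.
  by have := bad k 0%N; rewrite addn0 cats0; apply.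
have bad2 : Em (nseq k pi') (fun s => (k%:R - lam - 1 < word_sum A lam s)%R%:R) <= B.
  by have := bad 0%N k; rewrite add0n; apply.
have b0 (b : bool) : 0 <= b%:R :> R by exact: ler0n.
have lower : 9 / 10 - B - k%:R / D ^+ 2 <= Em (nseq k pi) F.
  apply: (@le_trans _ _ (Em (nseq k pi) (fun s => 9 / 10 -
      (k%:R - lam - 1 < word_sum A lam s)%R%:R - (D <= `|nz s - mu|)%R%:R))).
    rewrite !EmB Em_cst; last by move=> q; rewrite mem_nseq => /andP[_ /eqP ->].
    by rewrite lerB ?lerB ?dev.
  apply: ler_Em; first exact: qsP.
  move=> s; rewrite size_nseq => sk; have /andP[F0 F1] := F01 s sk.
  case: (ltP _ (word_sum _ _ _)) => s_le /=; first by have := b0 (D <= `|nz s - mu|); lra.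
  rewrite ?subr0 ?addr0; case: (leP D) => nzs /=; first by lra.
  rewrite !subr0; apply: hi => //; first by lra.
  by move: nzs; rewrite ltr_norml; lra.
have upper : Em (nseq k pi') F <= 10^-1 + B + k%:R / D ^+ 2.
  apply: (@le_trans _ _ (Em (nseq k pi') (fun s => 10^-1 +
      (k%:R - lam - 1 < word_sum A lam s)%R%:R + (D <= `|nz s - mu'|)%R%:R))); last first.
    rewrite !EmD Em_cst; last by move=> q; rewrite mem_nseq => /andP[_ /eqP ->].
    by rewrite lerD ?lerD ?dev.
  apply: ler_Em; first exact: qsP.
  move=> s; rewrite size_nseq => sk; have /andP[F0 F1] := F01 s sk.
  case: (ltP _ (word_sum _ _ _)) => s_le /=; first by have := b0 (D <= `|nz s - mu'|); lra.
  rewrite ?subr0 ?addr0; case: (leP D) => nzs /=; first by lra.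
  rewrite !addr0; apply: lo => //; first by lra.
  by move: nzs; rewrite ltr_norml; lra.
have {}hyb := le_trans (ler_norm _) hyb.
move: small; rewrite -/B; set E := 'C(n, _)%:R * _; set X := k%:R / D ^+ 2.
have E0 : 0 <= E by rewrite /E mulr_ge0 ?exprn_ge0 ?divr_ge0.
have kapE : k%:R * (`|kap| * E) <= k%:R * (16 * (lam / 4) ^+ L.+2 * E).
  have /andP[al0 al1] := al01.
  rewrite ler_pM2l // ler_wpM2r // (le_trans kap_le) // ler_piMl //.
  by rewrite mulr_ge0 ?exprn_ge0 ?divr_ge0 //; lra.
rewrite -(mulrA 2 k%:R) -/X; move: hyb lower upper; rewrite -/E -/X mulrDr; lra.
Qed.

(** * Linear estimators *)

(* The weight of a symbol seen [m] times; [a 0 = 1] gives weight 0 to unseen symbols. *)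
Definition linear_coef (R : realType) (n L : nat) (a : nat -> R) (m : nat) : R :=
  if (m <= L)%N then 1 - a m / 'C(n, m)%:R else 1.

(** The division by C(n, m) in [linear_coef] cancels the binomial coefficient, so that the bias is a
    form with freely chosen coefficients [a m]. *)
Lemma Em_linear_coef (R : realType) (T : finType) (n L : nat) (q : T -> R) (i : T)
    (a : nat -> R) : (L <= n)%N -> \sum_t q t = 1 ->
  Em (nseq n q) (fun s => linear_coef n L a (count_mem i s)) =
  1 - \sum_(m < L.+1) a m * (q i ^+ m * (1 - q i) ^+ (n - m)).
Proof.
move=> Ln q1; rewrite (Em_count _ _ (linear_coef n L a) q1).
have bin1 : \sum_(m < n.+1) (q i ^+ m * (1 - q i) ^+ (n - m)) *+ 'C(n, m) = 1.
  have := Em_count n i (fun=> 1) q1; rewrite Em_cst; last first.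
    by move=> q'; rewrite mem_nseq => /andP[_ /eqP ->].
  by move=> {2}->; apply: eq_bigr => m _; rewrite mulr1.
rewrite -[X in _ = X - _]bin1.
rewrite (big_ord_widen_cond n.+1 xpredT (fun m => a m * (q i ^+ m * (1 - q i) ^+ (n - m)))) //.
rewrite [X in _ = _ - X]big_mkcond /= -sumrB; apply: eq_bigr => m _.
rewrite /linear_coef ltnS; case: leqP => mL; last by rewrite mulr1 subr0.
have C0 : 'C(n, m)%:R != 0 :> R by rewrite pnatr_eq0 -lt0n bin_gt0 -ltnS.
by move: (_ ^+ m * _) => x; rewrite -(mulr_natr x) -(mulr_natr (x * _)); field.
Qed.

Definition linear_estimator (R : realType) (n L : nat) (a : nat -> R) (s : seq nat) : R :=
  \sum_(v <- undup s) linear_coef n L a (count_mem v s).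

Lemma linear_estimator_val (R : realType) (n L m : nat) (a : nat -> R) (s : seq 'I_m) :
  a 0%N = 1 ->
  linear_estimator n L a (map val s) = \sum_(i < m) linear_coef n L a (count_mem i s).
Proof.
move=> a0; rewrite /linear_estimator undup_map_inj; last exact: val_inj.
rewrite big_map big_uniq ?undup_uniq //= [LHS]big_mkcond /=.
apply: eq_bigr => i _; rewrite mem_undup.
have -> : count_mem (val i) (map val s) = count_mem i s.
  by rewrite count_map; apply: eq_count => j /=; rewrite val_eqE.
case: ifPn => // /count_memPn ->.
by rewrite /linear_coef leq0n a0 bin0 divr1 subrr.
Qed.

Lemma ler_sum_support (R : realType) (k : nat) (p : nat -> R) (m : nat) : (0 < k)%N ->
  (forall i, 0 < p i -> k%:R^-1 <= p i) -> (forall i, 0 <= p i) -> \sum_(i < m) p i = 1 ->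
  \sum_(i < m) (0 < p i)%R%:R <= k%:R :> R.
Proof.
move=> k0 pk p0 p1; rewrite -[leRHS]mulr1 -[X in _ <= _ * X]p1 mulr_sumr.
apply: ler_sum => i _; case: ltP => [/pk pi|_] /=; last by rewrite mulr_ge0.
by rewrite -ler_pdivrMl ?ltr0n // mulr1.
Qed.

(** The error consists of the bias, at most [b] for each of at most k symbols, of 1 for rounding to
    an integer, and of a deviation [D] controlled by Chebyshev's inequality. Replacing one sample
    changes two counts, hence two weights by at most 2 (1 + G) each. *)
Lemma linear_achievable (R : realType) (k n L : nat) (eps G b D : R) (a : nat -> R) :
  (0 < k)%N -> (L <= n)%N -> a 0%N = 1 -> 0 < D ->
  (forall m, (m <= L)%N -> `|a m| <= G * 'C(n, m)%:R) ->
  (forall p : R, k%:R^-1 <= p <= 1 ->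
    `|\sum_(m < L.+1) a m * (p ^+ m * (1 - p) ^+ (n - m))| <= b) ->
  k%:R * b + 1 + D <= eps * k%:R ->
  n%:R * (4 * (1 + G)) ^+ 2 / D ^+ 2 <= 10^-1 ->
  achievable k eps n.
Proof.
move=> k0 Ln a0 D0 aG ab bD var.
exists (fun x : n.-tuple nat => Num.floor (linear_estimator n L a x)) => p Dk.
have [m [pm p1 supp]] := finite_support k0 Dk.
have [[p0 _] pk] := Dk.
set S := \sum_(i < m) _ in supp.
have k0' : 0 < k%:R :> R by rewrite ltr0n.
rewrite supp (_ : [set _ | _] = [set x : n.-tuple nat |
    eps * k%:R <= `|(Num.floor (linear_estimator n L a x))%:~R - S|]); last first.
  by apply/funext => x /=; rewrite lee_fin.
rewrite (iid_prob_Em n (fun s => eps * k%:R <= `|(Num.floor (linear_estimator n L a s))%:~R -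
  S|) p0 pm) lee_fin.
pose q (i : 'I_m) := p i.
pose f (s : seq 'I_m) := \sum_(i < m) linear_coef n L a (count_mem i s).
have q0 t : 0 <= q t by exact: p0.
have G0 : 0 <= G.
  by have := aG 0%N isT; rewrite bin0 mulr1; apply: le_trans; exact: normr_ge0.
have p_le1 (i : 'I_m) : p i <= 1.
  by rewrite -p1 (bigD1 i) //= lerDl sumr_ge0.
have mean : `|Em (nseq n q) f - S| <= k%:R * b.
  rewrite /f Em_sum /S -sumrB (le_trans (ler_norm_sum _ _ _)) //.
  have b0 : 0 <= b.
    apply: le_trans (ab 1 _); first exact: normr_ge0.
    by rewrite lexx andbT invf_le1 // ler1n.
  apply: (@le_trans _ _ (\sum_(i < m) (0 < p i)%R%:R * b)).
    apply: ler_sum => i _; rewrite (Em_linear_coef i a Ln p1) /q.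
    case: (ltP 0 (p i)) => [pi0|] /=.
      by rewrite mul1r addrAC subrr add0r normrN ab // pk //= p_le1.
    rewrite le_eqVlt ltNge p0 orbF => /eqP ->.
    rewrite big_ord_recl big1 => [|j _]; last by rewrite exprS !mul0r mulr0.
    by rewrite expr0 mul1r !subr0 expr1n mulr1 addr0 a0 subrr normr0 mul0r.
  by rewrite -mulr_suml ler_wpM2r // ler_sum_support.
have lc (c : nat) : `|linear_coef n L a c| <= 1 + G.
  rewrite /linear_coef; case: leqP => cL; last by rewrite normr1 lerDl.
  have C0 : 0 < 'C(n, c)%:R :> R by rewrite ltr0n bin_gt0 (leq_trans cL).
  rewrite (le_trans (ler_normB _ _)) // normr1 lerD2l normrM normfV (gtr0_norm C0).
  by rewrite ler_pdivrMr // aG.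
have bd s1 s2 t t' : `|f (s1 ++ t :: s2) - f (s1 ++ t' :: s2)| <= 4 * (1 + G).
  rewrite /f -sumrB (le_trans (ler_norm_sum _ _ _)) //.
  apply: (@le_trans _ _ (\sum_(i < m) ((t == i)%:R + (t' == i)%:R) * (2 * (1 + G)))).
    apply: ler_sum => i _; rewrite !count_cat /=.
    have d2 c c' : `|linear_coef n L a c - linear_coef n L a c'| <= 2 * (1 + G).
      by rewrite (le_trans (ler_normB _ _)) // mulr2n mulrDl mul1r lerD.
    have GG : 0 <= 2 * (1 + G) by rewrite mulr_ge0 // addr_ge0.
    case: (t == i); case: (t' == i); rewrite /= ?subrr ?normr0 ?add0r ?addr0 ?mul0r //.
    - by rewrite mulr_ge0.
    - by rewrite mul1r.
    - by rewrite mul1r.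
  rewrite -mulr_suml big_split /=.
  have sum1 (u : 'I_m) : \sum_(i < m) (u == i)%:R = 1 :> R.
    by rewrite (bigD1 u) //= eqxx big1 ?addr0 // => i; rewrite eq_sym => /negPf ->.
  by rewrite !sum1 mulrA; lra.
apply: le_trans var; apply: le_trans (Em_chebyshev n q0 p1 D0 bd).
apply: ler_Em => [q'|s _]; first by rewrite mem_nseq => /andP[_ /eqP ->].
rewrite ler_nat; case: leP => //= dev; rewrite lt0b.
set mu := Em _ f in mean *.
have fl := floor_itv (linear_estimator n L a (map val s)).
move: dev fl; rewrite linear_estimator_val // -/(f s) => dev /andP[fl1 fl2].
rewrite leNgt; apply/negP => dev'.
move: dev; apply/negP; rewrite -ltNge.
move: mean dev'; rewrite !ltr_norml !ler_norml => /andP[me1 me2] /andP[d1 d2].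
rewrite intrD1 in fl2.
apply/andP; split; lra.
Qed.

(** The estimator counts the distinct symbols seen. It and the support size are integers, so a
    nonzero error is at least 1, and Markov's inequality bounds its probability by the expected
    number of unseen symbols. *)
Lemma coupon_achievable (R : realType) (k n : nat) (eps : R) : (0 < k)%N -> 0 < eps ->
  k%:R * (1 - k%:R^-1) ^+ n <= 10^-1 :> R -> achievable k eps n.
Proof.
move=> k0 eps0 kn; exists (fun x => (size (undup x) : int)) => p Dk.
have [m [pm p1 supp]] := finite_support k0 Dk.
have [[p0 _] pk] := Dk.
set S := \sum_(i < m) _ in supp.
have k0' : 0 < k%:R :> R by rewrite ltr0n.
rewrite supp (_ : [set _ | _] = [set x : n.-tuple nat |
    eps * k%:R <= `|(size (undup x))%:R - S|]); last first.
  by apply/funext => x /=; rewrite lee_fin.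
rewrite (iid_prob_Em n (fun s => eps * k%:R <= `|(size (undup s))%:R - S|) p0 pm) lee_fin.
pose q (i : 'I_m) := p i.
have q0 t : 0 <= q t by exact: p0.
have p_le1 (i : 'I_m) : p i <= 1.
  by rewrite -p1 (bigD1 i) //= lerDl sumr_ge0.
have qs0 : forall q', q' \in nseq n q -> forall t, 0 <= q' t.
  by move=> q'; rewrite mem_nseq => /andP[_ /eqP ->].
pose h (i : 'I_m) (c : nat) : R := `|(0 < c)%N%:R - (0 < p i)%R%:R|.
apply: (@le_trans _ _ (Em (nseq n q) (fun s => \sum_(i < m) h i (count_mem i s)))).
  apply: ler_Em => // s _.
  have dist : `|(size (undup (map val s)))%:R - S| <= \sum_(i < m) h i (count_mem i s).
    have -> : (size (undup (map val s)))%:R = \sum_(i < m) (0 < count_mem i s)%N%:R :> R.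
      rewrite undup_map_inj ?size_map; last exact: val_inj.
      rewrite -[size _]sum1_size natr_sum big_uniq ?undup_uniq //= big_mkcond /=.
      by apply: eq_bigr => i _; rewrite mem_undup -has_pred1 has_count; case: (_ < _)%N.
    by rewrite /S -sumrB (le_trans (ler_norm_sum _ _ _)).
  apply: le_trans dist; case: (leP (eps * k%:R)) => [dev|_] /=; last exact: normr_ge0.
  have [N SN] : exists N : nat, S = N%:R.
    by exists (\sum_(i < m) (0 < p i)%R)%N; rewrite /S natr_sum.
  have : 0 < `|(size (undup (map val s)))%:R - S|.
    by apply: lt_le_trans dev; rewrite mulr_gt0.
  rewrite SN -[_%:R]/((size (undup (map val s)) : int)%:~R) -[N%:R]/((N : int)%:~R).
  by rewrite -intrB -intr_norm ltr0z ler1z.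
rewrite (Em_sum (nseq n q) (fun i s => h i (count_mem i s))); apply: le_trans kn.
apply: (@le_trans _ _ (\sum_(i < m) (0 < p i)%R%:R * (1 - k%:R^-1) ^+ n)).
  apply: ler_sum => i _; rewrite (Em_count n i (h i) p1) /q big_ord_recl /= /h ltnn.
  rewrite bin0 mulr1n expr0 mul1r subn0 sub0r normrN.
  case: (ltP 0 (p i)) => [pi0|] /=; last first.
    rewrite le_eqVlt ltNge p0 orbF => /eqP ->; rewrite normr0 mulr0 mul0r add0r big1 // => j _.
    by rewrite exprS !mul0r mul0rn.
  rewrite big1 ?addr0 => [|j _]; last by rewrite subrr normr0 mulr0 mul0rn.
  rewrite normr1 mulr1 mul1r lerXn2r ?nnegrE ?subr_ge0 ?p_le1 ?lerD2l ?lerN2 ?pk //.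
  by rewrite invf_le1 // ler1n.
rewrite -mulr_suml ler_wpM2r ?ler_sum_support // exprn_ge0 // subr_ge0.
by rewrite invf_le1 // ler1n.
Qed.

Lemma le_achievable (R : realType) (k n : nat) (eps eps' : R) : (0 < k)%N ->
  eps <= eps' -> achievable k eps n -> achievable k eps' n.
Proof.
move=> k0 le_eps [Shat ach]; exists Shat => p Dk; apply: le_trans (ach p Dk).
have [m [pm p1 supp]] := finite_support k0 Dk; have [[p0 _] _] := Dk.
pose Sh (s : seq nat) : R := if insub s is Some x then (Shat x : int)%:~R else 0.
rewrite supp; set S := \sum_(i < m) _.
have setE (e : R) : [set x | ((e * k%:R)%:E <= `|((Shat x)%:~R)%:E - S%:E|)%E] =
    [set x : n.-tuple nat | e * k%:R <= `|Sh x - S|].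
  by apply/funext => x /=; rewrite /Sh valK lee_fin.
rewrite !setE (iid_prob_Em n (fun s => eps * k%:R <= `|Sh s - S|) p0 pm).
rewrite (iid_prob_Em n (fun s => eps' * k%:R <= `|Sh s - S|) p0 pm) lee_fin.
apply: ler_Em => [q|s _]; first by rewrite mem_nseq => /andP[_ /eqP ->].
rewrite ler_nat; case: (leP (eps' * _)) => //= h.
by rewrite lt0b (le_trans _ h) // ler_wpM2r.
Qed.

(** Without samples the estimate is a constant [z]. The uniform laws on 1 and on k symbols force the
    integers |z - 1| and |z - k| below floor(k/2), so that their sum is at most k - 2, against the
    triangle inequality. *)
Lemma achievable_gt0 (R : realType) (k n : nat) (eps : R) : (0 < k)%N ->
  eps * k%:R <= k./2%:R -> achievable k eps n -> (0 < n)%N.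
Proof.
move=> k0 ek [Shat ach]; case: n Shat ach => [|//] Shat ach; exfalso.
have k0' : 0 < k%:R :> R by rewrite ltr0n.
pose u (j i : nat) : R := if (i < j)%N then j%:R^-1 else 0.
have u0 j i : 0 <= u j i by rewrite /u; case: ifP => // _; rewrite invr_ge0.
have uj j i : (j <= i)%N -> u j i = 0 by rewrite /u ltnNge => ->.
have supp j : (0 < j)%N -> support_size (u j) = j%:R%:E.
  move=> j0; rewrite /support_size (@nneseries_finite _ j (fun i => (0 < u j i)%R%:R)) //; last
    first.
    by move=> i /uj ->; rewrite ltxx.
  rewrite (eq_bigr (fun=> 1)) ?sumr_const ?card_ord // => i _.
  by rewrite /u ltn_ord invr_gt0 ltr0n j0.
have Dj j : (0 < j <= k)%N -> D_ k (u j).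
  move=> /andP[j0 jk]; split; first split=> //.
    rewrite (nneseries_finite (u0 j) (uj j)) (eq_bigr (fun=> j%:R^-1)) => [|i _]; last by
      rewrite /u ltn_ord.
    by rewrite sumr_const card_ord -[_ *+ _]mulr_natl mulfV // pnatr_eq0 -lt0n.
  move=> i; rewrite /u; case: ifP => [_ _|_]; last by rewrite ltxx.
  by rewrite lef_pV2 ?posrE ?ltr0n // ler_nat.
pose z := Shat [tuple].
have close j : (0 < j <= k)%N -> `|z%:~R - j%:R| < k./2%:R :> R.
  move=> jk; have := ach _ (Dj j jk); have /andP[j0 _] := jk; rewrite supp //.
  rewrite (_ : [set _ | _] = [set x : 0.-tuple nat | (fun=> eps * k%:R <= `|z%:~R - j%:R|) (x :
    seq nat)]); last first.
    by apply/funext => x /=; rewrite (tuple0 x) lee_fin.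
  rewrite (iid_prob_Em 0 (fun=> eps * k%:R <= `|z%:~R - j%:R|) (u0 j) (uj j)) lee_fin /=.
  case: (leP (eps * k%:R)) => [_|/lt_le_trans h _]; last exact: h.
  by rewrite /=; lra.
have h1 := close 1%N k0.
have hk : `|z%:~R - k%:R| < k./2%:R :> R by apply: close; rewrite k0 leqnn.
have {}h1 : `|z - 1%:Z| < k./2%:Z.
  by rewrite -(ltr_int R) intr_norm intrB.
have {}hk : `|z - k%:Z| < k./2%:Z.
  by rewrite -(ltr_int R) intr_norm intrB.
move: h1 hk; rewrite !ltr_norml.
have := odd_double_half k; rewrite -muln2; lia.
Qed.

(** * The Chebyshev estimator *)

Lemma coef_linM (R : comNzRingType) (b c : R) (p : {poly R}) (m : nat) :
  ((b *: 'X + c%:P) * p)`_m = b * (if m == 0 then 0 else p`_m.-1) + c * p`_m.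
Proof. by rewrite mulrDl coefD -scalerAl coefZ coefXM mul_polyC coefZ. Qed.

Lemma comp_chebyshevSS (R : comNzRingType) (n : nat) (q : {poly R}) :
  chebyshevT R n.+2 \Po q = q * (chebyshevT R n.+1 \Po q) *+ 2 - (chebyshevT R n \Po q).
Proof. by rewrite /chebyshevT chebyshev_recSS raddfB raddfMn /= comp_polyM comp_polyX. Qed.

Lemma coef_chebyshev_lin_sign (R : comNzRingType) (n m : nat) (b c : R) :
  (chebyshevT R n \Po (- b *: 'X + c%:P))`_m =
  (-1) ^+ m * (chebyshevT R n \Po (b *: 'X + c%:P))`_m.
Proof.
elim/nat_ind2: n m => [||n IH0 IH1] m.
- by rewrite /chebyshevT /= -polyC1 !comp_polyC !coefC; case: m => [|m]; rewrite ?mul1r ?mulr0.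
- rewrite /chebyshevT /= !comp_polyX !coefD !coefZ !coefX !coefC.
  by case: m => [|[|m]] /=; ring.
- rewrite !comp_chebyshevSS !coefB !coefMn !coef_linM IH0 !IH1.
  case: m => [|m] /=; first by rewrite expr0; ring.
  by rewrite exprS; ring.
Qed.

(** The induction carries the increments along: with q = b X + c, T_(n+2)(q) - T_(n+1)(q) =
    (T_(n+1)(q) - T_n(q)) + 2 (q - 1) T_(n+1)(q), and q - 1 has nonnegative coefficients. *)
Lemma coef_chebyshev_lin_ge0 (R : realFieldType) (n m : nat) (b c : R) :
  0 <= b -> 1 <= c -> 0 <= (chebyshevT R n \Po (b *: 'X + c%:P))`_m.
Proof.
move=> b0 c1; set q := b *: 'X + c%:P.
suff [] : (forall m, 0 <= (chebyshevT R n \Po q)`_m) /\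
    (forall m, 0 <= (chebyshevT R n.+1 \Po q - (chebyshevT R n \Po q))`_m) by [].
elim: n {m} => [|n [IH0 IH1]].
  rewrite /chebyshevT /= -polyC1 comp_polyC comp_polyX; split=> m.
    by rewrite coefC; case: m => [|m].
  by rewrite coefB coefD coefZ coefX !coefC; case: m => [|[|m]] /=; lra.
have IH2 m : 0 <= (chebyshevT R n.+1 \Po q)`_m.
  by rewrite -(subrK (chebyshevT R n \Po q) (_ \Po _)) coefD addr_ge0.
split => // m; rewrite comp_chebyshevSS.
move: IH0 IH1 IH2; set t1 := _ n.+1 \Po q; set t0 := _ n \Po q => IH0 IH1 IH2.
have -> : q * t1 *+ 2 - t0 - t1 = (t1 - t0) + (b *: 'X + (c - 1)%:P) * t1 *+ 2.
  by rewrite /q polyCB polyC1; ring.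
rewrite coefD coefMn coef_linM addr_ge0 // mulrn_wge0 // addr_ge0 // mulr_ge0 ?subr_ge0 //.
by case: (m == 0).
Qed.

(** Up to sign the coefficients are those for c + b X, all nonnegative, so a single term is at most
    the whole value at x. The point x is free; it will be m / n. *)
Lemma norm_coef_chebyshev_lin (R : realFieldType) (n m : nat) (b c x : R) :
  0 <= b -> 1 <= c -> 0 <= x ->
  `|(chebyshevT R n \Po (- b *: 'X + c%:P))`_m| * x ^+ m <= (chebyshevT R n).[b * x + c].
Proof.
move=> b0 c1 x0; rewrite coef_chebyshev_lin_sign normrM normrX normrN1 expr1n mul1r.
set p := _ \Po _; have p0 i : 0 <= p`_i by exact: coef_chebyshev_lin_ge0.
rewrite ger0_norm //.
have -> : (chebyshevT R n).[b * x + c] = p.[x].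
  by rewrite /p horner_comp hornerD hornerZ hornerX hornerC.
case: (ltnP m (size p)) => mp; last first.
  rewrite nth_default // mul0r horner_coef sumr_ge0 // => i _.
  by rewrite mulr_ge0 ?exprn_ge0.
rewrite horner_coef (bigD1 (Ordinal mp)) //= lerDl sumr_ge0 // => i _.
by rewrite mulr_ge0 ?exprn_ge0.
Qed.

(** Hyperbolic cosine and sine of ln u, kept rational in u for the sake of the final numerical
    check. *)
Definition coshu (R : realType) (u : R) : R := (u + u^-1) / 2.
Definition sinhu (R : realType) (u : R) : R := (u - u^-1) / 2.

Lemma sinhu_gt0 (R : realType) (u : R) : 1 < u -> 0 < sinhu u.
Proof.
move=> u1; have : u^-1 < 1 by rewrite invf_lt1 //; lra.
by rewrite /sinhu => ?; lra.
Qed.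

(* The exponent is the tangent at [coshu u] of the concave function arcosh. *)
Lemma chebyshevT_le_exp (R : realType) (L : nat) (u Y : R) : 1 < u -> 1 <= Y ->
  1 <= (chebyshevT R L).[Y] <= expR (L%:R * (ln u + (Y - coshu u) / sinhu u)).
Proof.
move=> u1 Y1; have [z z1 ->] := joukowsky_ge1 Y1.
have z0 : 0 < z by lra.
have u0 : 0 < u by lra.
have Z1 : 1 <= z ^+ L by rewrite exprn_ege1.
have Z0 : 0 < z ^+ L by lra.
have ZV : z ^- L <= 1 by rewrite invf_le1.
have ZV0 : 0 < z ^- L by rewrite invr_gt0.
have ZZ : z ^+ L * z ^- L = 1 by rewrite mulfV ?gt_eqF.
rewrite chebyshevT_joukowsky ?gt_eqF //; apply/andP; split.
  by rewrite ler_pdivlMr // mul1r; nra.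
apply: (@le_trans _ _ (z ^+ L)); first by lra.
rewrite expRM_natl lerXn2r ?nnegrE ?(ltW z0) ?expR_ge0 //.
have S0 := sinhu_gt0 u1.
pose d := ln z - ln u.
have zE : z = u * expR d by rewrite /d expRB !lnK ?posrE // mulrCA mulfV ?mulr1 ?gt_eqF.
rewrite -[leLHS]lnK ?posrE // ler_expR -lerBlDl -/d ler_pdivlMr //.
have e1 := expR_ge1Dx d; have e2 := expR_ge1Dx (- d).
have uV : 0 < u^-1 by rewrite invr_gt0.
rewrite -subr_ge0 (_ : _ - _ = (u * (expR d - 1 - d) + u^-1 * (expR (- d) - 1 + d)) / 2).
  by rewrite divr_ge0 // addr_ge0 // mulr_ge0 ?(ltW u0) ?(ltW uV) //; lra.
by rewrite {1 2}zE expRN /coshu /sinhu; field; rewrite !gt_eqF ?expR_gt0.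
Qed.

(** The argument is (z + 1/z) / 2 for z = (1 + x) / (1 - x), and ln z >= 2 x - x^2. *)
Lemma chebyshevT_ge_exp (R : realType) (L : nat) (x : R) : 0 <= x < 1 ->
  expR (L%:R * (2 * x - x ^+ 2)) / 2 <=
  (chebyshevT R L).[(1 + x ^+ 2) / (1 - x ^+ 2)].
Proof.
move=> /andP[x0 x1]; pose z := (1 + x) / (1 - x).
have x1' : 0 < 1 - x by lra.
have x2' : 0 < 1 + x by lra.
have x3' : 0 < 1 - x ^+ 2 by nra.
have z0 : 0 < z by rewrite divr_gt0.
have -> : (1 + x ^+ 2) / (1 - x ^+ 2) = (z + z^-1) / 2.
  by rewrite /z; field; rewrite !gt_eqF.
rewrite chebyshevT_joukowsky ?gt_eqF // ler_pM2r ?invr_gt0 //.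
have Zz : expR (L%:R * (2 * x - x ^+ 2)) <= z ^+ L.
  rewrite expRM_natl lerXn2r ?nnegrE ?expR_ge0 ?(ltW z0) //.
  have e1 : expR (x - x ^+ 2) <= 1 + x.
    have := expR_ge1Dx (- (x - x ^+ 2)); rewrite expRN => h.
    have e0 := expR_gt0 (x - x ^+ 2).
    have : (1 - x + x ^+ 2) * expR (x - x ^+ 2) <= 1.
      rewrite -[leRHS](mulVf (lt0r_neq0 e0)) ler_pM2r //; lra.
    have x3 : 0 <= x ^+ 3 by rewrite exprn_ge0.
    have x4 : 0 < 1 - x + x ^+ 2 by nra.
    rewrite -ler_pdivlMl // => /le_trans; apply.
    rewrite mulr1 -[leLHS]mul1r ler_pdivrMr //.
    by rewrite (_ : (1 + x) * _ = 1 + x ^+ 3) ?lerDl //; ring.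
  have e2 : expR x <= (1 - x)^-1.
    have := expR_ge1Dx (- x); rewrite expRN => h.
    by rewrite -[leLHS]invrK lef_pV2 // posrE invr_gt0 expR_gt0.
  rewrite (_ : 2 * x - x ^+ 2 = (x - x ^+ 2) + x); last by ring.
  by rewrite expRD ler_pM ?expR_ge0.
have : 0 < z ^- L by rewrite invr_gt0 exprn_gt0.
by lra.
Qed.

Lemma fact_le_exp (R : realType) (m : nat) : (0 < m)%N ->
  m`!%:R * expR 1 ^+ m <= expR 1 * m%:R * m%:R ^+ m :> R.
Proof.
case: m => // m _; elim: m => [|m IHm]; first by rewrite (_ : 1`! = 1%N) // !expr1 !mul1r !mulr1.
have e0 : 0 < expR 1 :> R := expR_gt0 1.
have m0 : 0 < m.+1%:R :> R by rewrite ltr0n.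
have step : expR 1 * m.+1%:R ^+ m.+2 <= m.+2%:R ^+ m.+2 :> R.
  have m2 : 0 < m.+2%:R :> R by rewrite ltr0n.
  have h : expR (- (m.+2%:R)^-1) >= m.+1%:R / m.+2%:R :> R.
    apply: le_trans (expR_ge1Dx _).
    rewrite -[m.+2%:R]natr1; move: (m.+1%:R) m0 => c c0.
    by rewrite (_ : c / (c + 1) = 1 - (c + 1)^-1) //; field; lra.
  have : (m.+1%:R / m.+2%:R) ^+ m.+2 <= expR (- (m.+2%:R)^-1) ^+ m.+2 :> R.
    by rewrite lerXn2r ?nnegrE ?expR_ge0 // divr_ge0.
  rewrite -expRM_natl mulrN mulfV ?gt_eqF // expRN exprMn exprVn ler_pdivrMr ?exprn_gt0 //.
  by rewrite mulrC ler_pdivlMr // mulrC.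
rewrite factS natrM exprS.
have -> : m.+2%:R * (m.+1)`!%:R * (expR 1 * expR 1 ^+ m.+1) =
  m.+2%:R * expR 1 * ((m.+1)`!%:R * expR 1 ^+ m.+1) :> R by ring.
apply: (@le_trans _ _ (m.+2%:R * expR 1 * (expR 1 * m.+1%:R * m.+1%:R ^+ m.+1))).
  by rewrite ler_pM2l // mulr_gt0 // ltr0n.
have -> : m.+2%:R * expR 1 * (expR 1 * m.+1%:R * m.+1%:R ^+ m.+1) =
  m.+2%:R * expR 1 * (expR 1 * m.+1%:R ^+ m.+2) :> R by rewrite [_ ^+ m.+2]exprS; ring.
apply: (@le_trans _ _ (m.+2%:R * expR 1 * m.+2%:R ^+ m.+2)); last by rewrite [m.+2%:R * _]mulrC.
by rewrite ler_pM2l // mulr_gt0 // ltr0n.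
Qed.

Lemma bernoulli_le (R : realFieldType) (n : nat) (x : R) : 0 <= x <= 1 ->
  1 - n%:R * x <= (1 - x) ^+ n.
Proof.
move=> /andP[x0 x1]; elim: n => [|n IHn]; first by rewrite mul0r subr0.
rewrite exprS; apply: (@le_trans _ _ ((1 - x) * (1 - n%:R * x))).
  by rewrite -natr1; have := ler0n R n; nra.
by rewrite ler_wpM2l // subr_ge0.
Qed.

Lemma expn_sub_le_ffact (n m : nat) : (m <= n)%N -> ((n - m) ^ m <= n ^_ m)%N.
Proof.
elim: m n => [//|m IHm] [//|n] mn; rewrite expnS ffactSS subSS leq_mul //.
  by rewrite leqW // leq_subr.
exact: IHm.
Qed.

(** C(n, m) reaches (e n / m)^m up to a factor linear in m: for m^2 <= n / 2 the falling factorial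
    is at least n^m / 2, and m! is at most e m (m / e)^m. *)
Lemma expn_le_bin (R : realType) (n m : nat) : (0 < m)%N -> (2 * m ^ 2 <= n)%N ->
  (n%:R / m%:R) ^+ m * expR m%:R <= 2 * expR 1 * m%:R * 'C(n, m)%:R :> R.
Proof.
move=> m0 mn; have m0' : 0 < m%:R :> R by rewrite ltr0n.
have mn' : (m <= n)%N by nia.
have n0' : 0 < n%:R :> R by rewrite ltr0n (leq_trans m0).
have mm0 : 0 < m%:R ^+ m :> R by rewrite exprn_gt0.
have F0 : 0 < m`!%:R :> R by rewrite ltr0n fact_gt0.
have half : n%:R ^+ m <= 2 * (n%:R - m%:R) ^+ m :> R.
  have -> : n%:R - m%:R = n%:R * (1 - m%:R / n%:R) :> R by field; rewrite gt_eqF.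
  rewrite exprMn mulrCA ler_peMr ?exprn_ge0 //.
  have x01 : 0 <= (m%:R / n%:R : R) <= 1.
    by rewrite divr_ge0 //= ler_pdivrMr // mul1r ler_nat.
  have := bernoulli_le m x01.
  have : m%:R * (m%:R / n%:R) <= 2^-1 :> R.
    rewrite mulrA ler_pdivrMr // -natrM ler_pdivlMl // -natrM ler_nat.
    by rewrite mulnn.
  by move=> h1 h2; lra.
have bin : (n%:R - m%:R) ^+ m <= 'C(n, m)%:R * m`!%:R :> R.
  by rewrite -natrB // -natrX -natrM ler_nat bin_ffact expn_sub_le_ffact.
have fe := fact_le_exp R m0.
have C0 : 0 <= 'C(n, m)%:R :> R by [].
have e0 : 0 < expR 1 :> R := expR_gt0 1.
have -> : expR m%:R = expR 1 ^+ m :> R by rewrite -expRM_natl mulr1.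
rewrite -(ler_pM2r (mulr_gt0 F0 mm0)).
have -> : (n%:R / m%:R) ^+ m * expR 1 ^+ m * (m`!%:R * m%:R ^+ m) =
    n%:R ^+ m * (m`!%:R * expR 1 ^+ m) :> R.
  by rewrite expr_div_n; field; rewrite gt_eqF.
apply: (@le_trans _ _ (n%:R ^+ m * (expR 1 * m%:R * m%:R ^+ m))).
  by rewrite ler_wpM2l // exprn_ge0.
have -> : 2 * expR 1 * m%:R * 'C(n, m)%:R * (m`!%:R * m%:R ^+ m) =
   2 * ('C(n, m)%:R * m`!%:R) * (expR 1 * m%:R * m%:R ^+ m) :> R by ring.
apply: ler_wpM2r; first by positivity.
by apply: (le_trans half); rewrite ler_pM2l.
Qed.

Lemma chebyshevTN (R : comNzRingType) (n : nat) (x : R) :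
  (chebyshevT R n).[- x] = (-1) ^+ n * (chebyshevT R n).[x].
Proof.
rewrite -[LHS]mulr1.
apply: (@horner_chebyshev_rec _ _ _ _ _ (fun n => (-1) ^+ n * (chebyshevT R n).[x])) => [m||].
- rewrite /chebyshevT chebyshev_recSS hornerD hornerN hornerMn hornerM hornerX !exprS.
  by ring.
- by rewrite /chebyshevT /= !hornerC expr0.
- by rewrite /chebyshevT /= !hornerX expr1; ring.
Qed.

Definition cheb_coef (R : realType) (L : nat) (b c : R) (m : nat) : R :=
  (chebyshevT R L \Po (- b *: 'X + c%:P))`_m / (chebyshevT R L).[c].

Lemma cheb_coef0 (R : realType) (L : nat) (b c : R) : 1 <= c -> cheb_coef L b c 0 = 1.
Proof.
move=> c1; rewrite /cheb_coef -horner_coef0 horner_comp hornerD hornerZ hornerX hornerC.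
rewrite mulr0 add0r mulfV // gt_eqF //.
have /andP[h _] := @chebyshevT_le_exp R L 2 c (ltr1n _ 2) c1.
by apply: lt_le_trans h.
Qed.

(** Evaluation at x = m / n. The tangent bound gives |a_m| (m / n)^m <= E e^m, because the
    hypothesis on L b / sinhu u makes the part of the exponent that depends on x at most n x = m.
    The remaining e^m (n / m)^m is C(n, m) up to a linear factor. *)
Lemma norm_cheb_coef (R : realType) (n L m : nat) (b c u : R) : 1 < u ->
  0 <= b -> 1 <= c -> (m <= L)%N -> (2 * L ^ 2 <= n)%N ->
  L%:R * b / sinhu u <= n%:R ->
  `|cheb_coef L b c m| <=
  (1 + 2 * expR 1 * L%:R * expR (L%:R * (ln u + (c - coshu u) / sinhu u))) * 'C(n, m)%:R.
Proof.
move=> u1 b0 c1 mL Ln bn.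
set G := 2 * expR 1 * _ * _.
have G0 : 0 <= G by rewrite /G; positivity.
case: m mL => [|m] mL; first by rewrite cheb_coef0 // normr1 bin0 mulr1 lerDl.
have L0 : (0 < L)%N by apply: leq_ltn_trans mL.
have m0' : 0 < m.+1%:R :> R by rewrite ltr0n.
have n0 : (0 < n)%N by nia.
have n0' : 0 < n%:R :> R by rewrite ltr0n.
have S0 := sinhu_gt0 u1.
pose x : R := m.+1%:R / n%:R.
have x0 : 0 < x by rewrite /x; positivity.
have /andP[T1 _] := @chebyshevT_le_exp R L u c u1 c1.
have bxc : 1 <= b * x + c by rewrite (le_trans c1) // lerDr mulr_ge0 // ltW.
have /andP[_ TE] := @chebyshevT_le_exp R L u _ u1 bxc.
have := @norm_coef_chebyshev_lin R L m.+1 b c x b0 c1 (ltW x0).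
set a := (_ \Po _)`_m.+1 => ax.
have {}ax : `|cheb_coef L b c m.+1| * x ^+ m.+1 <=
    expR (L%:R * (ln u + (c - coshu u) / sinhu u)) * expR m.+1%:R.
  rewrite /cheb_coef -/a normrM normfV mulrAC ler_pdivrMr; last by rewrite normr_gt0 gt_eqF //
    (lt_le_trans ltr01).
  apply: (le_trans ax); apply: (le_trans TE).
  rewrite -[leLHS]mulr1 ler_pM ?expR_ge0 //; last by rewrite ger0_norm // (le_trans ler01).
  rewrite -expRD ler_expR.
  have -> : L%:R * (ln u + (b * x + c - coshu u) / sinhu u) =
     L%:R * (ln u + (c - coshu u) / sinhu u) + L%:R * b / sinhu u * x.
    by field; rewrite gt_eqF.
  rewrite lerD2l (le_trans (ler_wpM2r (ltW x0) bn)) //.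
  by rewrite /x mulrCA mulfV ?mulr1 // gt_eqF.
have eb := @expn_le_bin R n m.+1 isT.
have mn : (2 * m.+1 ^ 2 <= n)%N by rewrite (leq_trans _ Ln) // leq_mul2l leq_exp2r.
have {}eb := eb mn.
move: ax; rewrite -ler_pdivlMr ?exprn_gt0 // => /le_trans; apply.
rewrite -exprVn /x.
set E := expR (L%:R * _) in G0 *.
have -> : E * expR m.+1%:R * (m.+1%:R / n%:R)^-1 ^+ m.+1 =
  E * ((n%:R / m.+1%:R) ^+ m.+1 * expR m.+1%:R) by rewrite invf_div; ring.
have E0 : 0 < E by rewrite expR_gt0.
apply: (@le_trans _ _ (E * (2 * expR 1 * m.+1%:R * 'C(n, m.+1)%:R))).
  by rewrite ler_pM2l.
have -> : E * (2 * expR 1 * m.+1%:R * 'C(n, m.+1)%:R) =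
   2 * expR 1 * m.+1%:R * E * 'C(n, m.+1)%:R by ring.
rewrite ler_wpM2r // (@le_trans _ _ G) ?lerDr // /G -/E.
rewrite ler_pM2r // ler_pM2l ?ler_nat //; positivity.
Qed.

(* For y = p / (1 - p) the sum is (1 - p)^n T_L(c - b y) / T_L(c). *)
Lemma cheb_bias (R : realType) (n L : nat) (b c u p lo : R) : 1 < u ->
  0 < b -> 1 <= c -> (L <= n)%N -> 0 < lo -> lo <= p -> p < 1 -> b * lo = c - 1 ->
  L%:R * b / sinhu u <= n%:R -> ln u <= (coshu u + 1) / sinhu u ->
  `|\sum_(m < L.+1) cheb_coef L b c m * (p ^+ m * (1 - p) ^+ (n - m))| <=
  expR (n%:R * (p / (1 - p)) ^+ 2) / (chebyshevT R L).[c].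
Proof.
move=> u1 b0 c1 Ln lo0 lop p1 blo bn uS.
have S0 := sinhu_gt0 u1.
have p0 : 0 < p by apply: lt_le_trans lop.
have p1' : 0 < 1 - p by lra.
set y := p / (1 - p); have y0 : 0 < y by rewrite /y; positivity.
have loy : lo <= y.
  by apply: (le_trans lop); rewrite /y ler_pdivlMr //; nra.
have /andP[T1 _] := @chebyshevT_le_exp R L u c u1 c1.
have T0 : 0 < (chebyshevT R L).[c] by apply: lt_le_trans T1.
have -> : \sum_(m < L.+1) cheb_coef L b c m * (p ^+ m * (1 - p) ^+ (n - m)) =
    (1 - p) ^+ n * (chebyshevT R L).[- b * y + c] / (chebyshevT R L).[c].
  have -> : (chebyshevT R L).[- b * y + c] = (chebyshevT R L \Po (- b *: 'X + c%:P)).[y].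
    by rewrite horner_comp hornerD hornerZ hornerX hornerC.
  rewrite (@horner_coef_wide _ L.+1); last first.
    rewrite (leq_trans (size_comp_poly_leq _ _)) // ltnS.
    have sq : ((size (- b *: 'X + c%:P)%R).-1 <= 1)%N.
      have : (size (- b *: 'X + c%:P)%R <= 2)%N.
        rewrite (leq_trans (size_polyD _ _)) // geq_max (leq_trans (size_scale_leq _ _))
          ?size_polyX //.
        by rewrite (leq_trans (size_polyC_leq1 _)).
      by case: (size _) => [|[|[|]]].
    have sT : ((size (chebyshevT R L)).-1 <= L)%N.
      by have := size_chebyshevT R L; case: (size _).
    by rewrite -[X in (_ <= X)%N]muln1 leq_mul.
  rewrite mulr_sumr mulr_suml; apply: eq_bigr => m _; rewrite /cheb_coef.
  have -> : (1 - p) ^+ n = (1 - p) ^+ (n - m) * (1 - p) ^+ m.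
    by rewrite -exprD subnK // (leq_trans _ Ln) // -ltnS.
  rewrite /y expr_div_n; move: ((1 - p) ^+ (n - m)) => e.
  by field; rewrite !gt_eqF // exprn_gt0.
rewrite normrM normfV (gtr0_norm T0) ler_pM2r ?invr_gt0 // normrM.
have pn0 : 0 <= (1 - p) ^+ n by rewrite exprn_ge0 // ltW.
rewrite (ger0_norm pn0).
(* Up to y = (c + 1) / b the argument c - b y lies in [-1, 1]; beyond it, (1 - p)^n must compensate
   the growth of T. *)
have [yr|yr] := lerP (b * y) (c + 1).
  apply: (@le_trans _ _ 1); last by rewrite -expR0 ler_expR mulr_ge0 // sqr_ge0.
  rewrite mulr_ile1 ?exprn_ile1 ?(ltW p1') //; first by lra.
  apply: normr_chebyshevT_le1; rewrite mulNr.
  have : b * lo <= b * y by rewrite ler_pM2l.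
  by move=> ?; lra.
have bN : - b * y + c = - (b * y - c) by ring.
have Y1 : 1 <= b * y - c by lra.
have /andP[TY1 TYE] := @chebyshevT_le_exp R L u _ u1 Y1.
rewrite bN chebyshevTN normrM normrX normrN1 expr1n mul1r ger0_norm; last exact: le_trans TY1.
have exp_le : (chebyshevT R L).[b * y - c] <= expR (n%:R * y).
  apply: (le_trans TYE); rewrite ler_expR.
  have -> : L%:R * (ln u + (b * y - c - coshu u) / sinhu u) =
    L%:R * b / sinhu u * y - L%:R * ((c + coshu u) / sinhu u - ln u).
    by field; rewrite gt_eqF.
  have h1 : L%:R * b / sinhu u * y <= n%:R * y by rewrite ler_wpM2r // ltW.
  (* The condition on ln u makes the constant term of the tangent bound nonpositive. *)
  have h2 : 0 <= L%:R * ((c + coshu u) / sinhu u - ln u).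
    rewrite mulr_ge0 // subr_ge0 (le_trans uS) // ler_pM2r ?invr_gt0 //; lra.
  lra.
have y1 : 1 - p = (1 + y)^-1 by rewrite /y; field; rewrite gt_eqF //; lra.
(* Since 1 - p = 1 / (1 + y), the first-order parts of e^y and 1 - p cancel. *)
have e1 : expR y * (1 - p) <= expR (y ^+ 2).
  rewrite y1 ler_pdivrMr; last by lra.
  have := expR_ge1Dx (y ^+ 2 - y); rewrite expRB => h.
  have ey := expR_gt0 y.
  have {h} : (1 + (y ^+ 2 - y)) * expR y <= expR (y ^+ 2) by rewrite -ler_pdivlMr.
  move=> h; apply: (@le_trans _ _ ((1 + (y ^+ 2 - y)) * expR y * (1 + y))).
    rewrite mulrAC -[leLHS]mul1r ler_pM2r //.
    have -> : (1 + (y ^+ 2 - y)) * (1 + y) = 1 + y ^+ 3 by ring.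
    by rewrite lerDl exprn_ge0 // ltW.
  by rewrite ler_pM2r //; lra.
apply: (@le_trans _ _ ((1 - p) ^+ n * expR (n%:R * y))); first by rewrite ler_wpM2l.
rewrite !expRM_natl -exprMn mulrC lerXn2r ?nnegrE ?expR_ge0 //.
by rewrite mulr_ge0 ?expR_ge0 // ltW.
Qed.

(** A Chernoff bound for at most L occurrences: e^(L - m) >= 1 for m <= L, and the generating
    function of the binomial law at w = 1/e is (1 - p (1 - w))^n <= e^(- n p / 2). *)
Lemma cheb_tail (R : realType) (n L : nat) (a : nat -> R) (G p : R) :
  0 <= p <= 1 -> 0 <= G -> (L <= n)%N ->
  (forall m, (m <= L)%N -> `|a m| <= G * 'C(n, m)%:R) ->
  `|\sum_(m < L.+1) a m * (p ^+ m * (1 - p) ^+ (n - m))| <=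
  G * expR (L%:R - n%:R * p / 2).
Proof.
move=> /andP[p0 p1] G0 Ln aG; have p1' : 0 <= 1 - p by rewrite subr_ge0.
pose w := expR (-1 : R).
have w0 : 0 < w by exact: expR_gt0.
have w2 : w <= 2^-1.
  by rewrite /w expRN lef_pV2 ?posrE ?expR_gt0 //; have := expR_ge1Dx (1 : R); lra.
apply: (@le_trans _ _ (G * (expR L%:R * (p * w + (1 - p)) ^+ n))); last first.
  have -> : expR (L%:R - n%:R * p / 2) = expR L%:R * expR (- (p / 2)) ^+ n.
    by rewrite -expRM_natl -expRD; congr expR; ring.
  rewrite ler_wpM2l // ler_pM2l ?expR_gt0 // lerXn2r ?nnegrE ?expR_ge0 //.
    by rewrite addr_ge0 // mulr_ge0 // ltW.
  apply: le_trans (expR_ge1Dx _).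
  have : p * w <= p * 2^-1 by rewrite ler_wpM2l.
  by lra.
have binom : (p * w + (1 - p)) ^+ n =
    \sum_(m < n.+1) 'C(n, m)%:R * (p ^+ m * w ^+ m * (1 - p) ^+ (n - m)).
  by rewrite addrC exprDn; apply: eq_bigr => m _; rewrite exprMn -mulr_natl; ring.
rewrite binom !mulr_sumr (le_trans (ler_norm_sum _ _ _)) //.
rewrite (big_ord_widen_cond n.+1 xpredT
  (fun m => `|a m * (p ^+ m * (1 - p) ^+ (n - m))|)) // big_mkcond /=.
apply: ler_sum => m _; rewrite ltnS.
have pm0 : 0 <= p ^+ m * (1 - p) ^+ (n - m) by rewrite mulr_ge0 ?exprn_ge0.
have wm0 : 0 <= w ^+ m by rewrite exprn_ge0 // ltW.
case: leqP => mL; last first.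
  by positivity.
rewrite normrM (ger0_norm pm0).
apply: (@le_trans _ _ (G * 'C(n, m)%:R * (p ^+ m * (1 - p) ^+ (n - m)))).
  by rewrite ler_wpM2r // aG.
have ew : 1 <= expR L%:R * w ^+ m.
  rewrite /w -expRM_natl -expRD -[X in X <= _]expR0 ler_expR mulrN1 subr_ge0 ler_nat //.
have -> : G * (expR L%:R * ('C(n, m)%:R * (p ^+ m * w ^+ m * (1 - p) ^+ (n - m)))) =
    G * 'C(n, m)%:R * (p ^+ m * (1 - p) ^+ (n - m)) * (expR L%:R * w ^+ m).
  by move: ((1 - p) ^+ _) => x; ring.
by rewrite ler_peMr // mulr_ge0 // mulr_ge0.
Qed.

(** * Asymptotics of the upper bound *)

Lemma expR_dominates (R : realType) (A al : R) (m : nat) : 0 < al ->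
  exists2 t0, 1 <= t0 & forall t, t0 <= t -> A * t ^+ m <= expR (al * t).
Proof.
move=> al0.
pose B := `|A| * (m.+1)`!%:R / al ^+ m.+1.
have B0 : 0 <= B by rewrite /B !mulr_ge0 ?invr_ge0 ?exprn_ge0 // ltW.
exists (1 + B); first by rewrite lerDl.
move=> t tB; have t0 : 0 < t by lra.
have tB' : B <= t by lra.
apply: (@le_trans _ _ (`|A| * t ^+ m)).
  by rewrite ler_wpM2r ?ler_norm // exprn_ge0 // ltW.
have := @expR_ge1Dxn R (al * t) m (ltW (mulr_gt0 al0 t0)) => h.
apply: (@le_trans _ _ ((al * t) ^+ m.+1 / (m.+1)`!%:R)); last by lra.
rewrite exprMn ler_pdivlMr ?ltr0n ?fact_gt0 // [t ^+ m.+1]exprS mulrAC mulrA.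
rewrite ler_wpM2r ?exprn_ge0 ?(ltW t0) //.
by move: tB'; rewrite /B ler_pdivrMr ?exprn_gt0 // [t * _]mulrC.
Qed.

Lemma truncn_bounds (R : realType) (x : R) : 0 <= x ->
  x - 1 < (Num.truncn x)%:R <= x.
Proof.
move=> x0; have /andP[h1 h2] := truncn_itv x0.
by rewrite h1 andbT -natr1 in h2 *; lra.
Qed.

(* The Chebyshev polynomial is carried to the interval [1 / k, 1 / (k x^2)]. *)
Lemma cheb_achievable (R : realType) (k n L : nat) (eps u x p1 G : R) :
  (0 < k)%N -> 1 < u -> ln u <= (coshu u + 1) / sinhu u -> 0 < x < 1 ->
  G = 1 + 2 * expR 1 * L%:R *
    expR (L%:R * (ln u + ((1 + x ^+ 2) / (1 - x ^+ 2) - coshu u) / sinhu u)) ->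
  (L <= n)%N -> (2 * L ^ 2 <= n)%N ->
  L%:R * (2 * k%:R * x ^+ 2 / (1 - x ^+ 2)) / sinhu u <= n%:R ->
  0 < p1 <= 2^-1 -> n%:R * (2 * p1) ^+ 2 <= 2^-1 ->
  4 * expR (- (L%:R * (2 * x - x ^+ 2))) <= eps / 4 ->
  G * expR (L%:R - n%:R * p1 / 2) <= eps / 4 ->
  2 <= eps * k%:R ->
  n%:R * (4 * (1 + G)) ^+ 2 / (eps * k%:R / 4) ^+ 2 <= 10^-1 ->
  achievable k eps n.
Proof.
move=> k0 u1 uS /andP[x0 x1] GE Ln L2n bn /andP[p10 p11] np hT hG hk hv.
have k0' : 0 < k%:R :> R by rewrite ltr0n.
have x2 : 0 < 1 - x ^+ 2 by nra.
pose c := (1 + x ^+ 2) / (1 - x ^+ 2); pose b := 2 * k%:R * x ^+ 2 / (1 - x ^+ 2).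
have b0 : 0 < b by rewrite /b; positivity.
have c1 : 1 <= c by rewrite /c ler_pdivlMr //; have := sqr_ge0 x; lra.
have G0 : 0 <= G by rewrite GE; positivity.
have aG (m : nat) : (m <= L)%N -> `|cheb_coef L b c m| <= G * 'C(n, m)%:R.
  by move=> mL; rewrite GE; exact: norm_cheb_coef (ltW b0) c1 mL L2n bn.
have xL : 0 <= x < 1 by rewrite (ltW x0).
have Tge := chebyshevT_ge_exp L xL; rewrite -/c in Tge.
have T0 : 0 < (chebyshevT R L).[c].
  by apply: lt_le_trans Tge; rewrite divr_gt0 ?expR_gt0.
have epsk : 0 < eps * k%:R by lra.
have eps0 : 0 < eps by move: epsk; rewrite pmulr_lgt0.
apply: (@linear_achievable _ _ _ L _ G (eps / 4) (eps * k%:R / 4) (cheb_coef L b c)) => //.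
- exact: cheb_coef0.
- by rewrite divr_gt0.
- move=> p /andP[kp p1']; have p0 : 0 < p by rewrite (lt_le_trans _ kp) // invr_gt0.
  (* Masses above [p1] are covered by the tail bound; up to [p1] the factor e^(n y^2) of the bias is
     at most e^(1/2) <= 2. *)
  have [pp|pp] := lerP p p1; last first.
    apply: le_trans hG.
    apply: (le_trans (cheb_tail _ G0 Ln aG)); first by rewrite (ltW p0) p1'.
    rewrite ler_wpM2l // ler_expR lerD2l lerN2 ler_pM2r ?invr_gt0 // ler_wpM2l //.
    exact: ltW.
  have p_lt1 : p < 1 by lra.
  apply: le_trans hT.
  have bk : b * k%:R^-1 = c - 1.
    by rewrite /b /c; field; rewrite !gt_eqF.
  have k0V : 0 < k%:R^-1 :> R by rewrite invr_gt0.
  apply: (le_trans (cheb_bias u1 b0 c1 Ln k0V kp p_lt1 bk bn uS)).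
  rewrite ler_pdivrMr //.
  have e2 : expR (n%:R * (p / (1 - p)) ^+ 2) <= 2.
    apply: (@le_trans _ _ (expR (2^-1))).
      rewrite ler_expR; apply: le_trans np; rewrite ler_wpM2l //.
      have p1p : 0 < 1 - p by lra.
      rewrite lerXn2r ?nnegrE ?divr_ge0 ?mulr_ge0 ?(ltW p0) ?(ltW p10) ?(ltW p1p) //.
      by rewrite ler_pdivrMr //; nra.
    have h : 0 <= (2^-1 : R) <= 2^-1 by lra.
    have := expR_le_lin h; rewrite (_ : 1 + _ = 2); last by field; lra.
    by apply; lra.
  apply: (le_trans e2).
  apply: (@le_trans _ _ (4 * expR (- (L%:R * (2 * x - x ^+ 2))) *
     (expR (L%:R * (2 * x - x ^+ 2)) / 2))).
    rewrite expRN; set E := expR _; have E0 : 0 < E by exact: expR_gt0.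
    by rewrite le_eqVlt; apply/orP; left; apply/eqP; field; rewrite gt_eqF.
  by rewrite ler_wpM2l // mulr_ge0 ?expR_ge0.
- by lra.
Qed.

Lemma exists_sq_le (R : realFieldType) (c X D : R) : 0 < c -> 0 < X -> 0 < D ->
  exists dl, [/\ 0 < dl, dl <= 1, dl <= D & c * dl ^+ 2 <= X].
Proof.
move=> c0 X0 D0; exists (Num.min (Num.min 1 D) (X / c)).
have p0 : 0 < Num.min (Num.min 1 D) (X / c) by rewrite !lt_min ltr01 D0 divr_gt0.
have l1 : Num.min (Num.min 1 D) (X / c) <= 1 by rewrite !ge_min lexx.
have lD : Num.min (Num.min 1 D) (X / c) <= D by rewrite !ge_min lexx !orbT.
have lX : Num.min (Num.min 1 D) (X / c) <= X / c by rewrite !ge_min lexx !orbT.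
split => //; set d := Num.min _ _ in p0 l1 lD lX *.
apply: (@le_trans _ _ (c * d)); last by rewrite mulrC -ler_pdivlMr.
by rewrite ler_pM2l // expr2 ler_piMl // ltW.
Qed.

Lemma rateE (R : realType) (k : nat) (eps : R) : 0 < eps ->
  rate k eps = k%:R / ln k%:R * (- ln eps) ^+ 2.
Proof. by move=> e0; rewrite /rate lnV // posrE. Qed.

(** With l = ln k and e = - ln eps, the choice is n ~ c k e^2 / l, L ~ a l and x = sqrt(2 n / (k l))
    ~ sqrt(2 c) e / l. The bias exponent 2 L x is then about 2 a sqrt(2 c) e, and [kap] is any
    smaller multiple of e. The condition 4 a < sinhu u serves twice: for the slope, as L b is about
    4 a n, and for G, whose exponent is at most about 2 L / sinhu u and so stays below l / 2. *)
Lemma upper_regime (R : realType) (a u c kap e0 : R) :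
  1 < u -> ln u <= (coshu u + 1) / sinhu u -> 0 < a -> 4 * a < sinhu u ->
  0 < c -> 0 < e0 -> 0 < kap -> kap < 2 * a * Num.sqrt (2 * c) ->
  (forall e, e0 <= e -> 16 * expR (- (kap * e)) <= expR (- e)) ->
  exists dl t0 : R, 0 < dl /\ forall (k : nat) (eps : R), 0 < eps ->
    t0 <= ln k%:R -> e0 <= - ln eps -> - ln eps <= dl * ln k%:R ->
    exists2 n : nat, n%:R <= c * rate k eps + 1 & achievable k eps n.
Proof.
move=> u1 uS a0 aS c0 e00 kap0 kapc Hexp.
have S0 := sinhu_gt0 u1.
set S := sinhu u in aS S0 uS.
set sq := Num.sqrt (2 * c) in kapc.
have sq0 : 0 < sq by rewrite sqrtr_gt0 mulr_gt0.
have sq2 : sq ^+ 2 = 2 * c by rewrite sqr_sqrtr // ltW // mulr_gt0.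
(* The relative slack in 4 a < sinhu u. It yields G <= k^(1/2 - th) up to a factor of order ln k,
   with th = s1 / 4. *)
pose s1 := 1 - 4 * a / S.
have s10 : 0 < s1 by rewrite subr_gt0 ltr_pdivrMr // mul1r.
have aS' : a = S * (1 - s1) / 4 by rewrite /s1; field; rewrite gt_eqF.
have s11 : s1 < 1 by rewrite /s1; have : 0 < 4 * a / S by [positivity]; lra.
pose th := s1 / 4.
(* Half the relative slack of [kap]: one factor 1 - eta pays for rounding [L] down, another for the
   term x^2 in 2 x - x^2. *)
pose eta := (1 - kap / (2 * a * sq)) / 2.
have rho : 0 < kap / (2 * a * sq) < 1.
  by rewrite divr_gt0 ?mulr_gt0 //= ltr_pdivrMr ?mul1r // !mulr_gt0.
have /andP[rho0 rho1] := rho.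
have eta0 : 0 < eta by rewrite /eta; lra.
have eta1 : eta < 1 by rewrite /eta; lra.
have etaP : kap <= 2 * a * sq * (1 - eta) ^+ 2.
  have -> : kap = 2 * a * sq * (kap / (2 * a * sq)) by field; rewrite !gt_eqF.
  rewrite ler_pM2l ?mulr_gt0 //.
  have -> : kap / (2 * a * sq) = 1 - 2 * eta by rewrite /eta; field; rewrite !gt_eqF.
  by have := sqr_ge0 eta; lra.
clear rho rho0 rho1; clearbody eta s1.
(* The mass p1 will be K l / n; then n p1 / 2 = (a + 2) l outweighs both [L] and the size of G. *)
pose K := 2 * a + 4.
pose M := 1 + 2 * expR 1 * a.
have M0 : 0 < M by rewrite /M; positivity.
have X0 : 0 < Num.min (s1 / 2) (eta ^+ 2) by rewrite lt_min divr_gt0 ?exprn_gt0.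
have th0 : 0 < th by rewrite /th divr_gt0.
have th2 : 0 < th / 2 by rewrite divr_gt0.
have [dl [dl0 dl1 dlth dlX]] := exists_sq_le (mulr_gt0 (ltr0n R 4 : 0 < 4%:R) c0) X0 th2.
have th14 : th / 2 <= 1 / 8 by rewrite /th; lra.
have [ta ta1 taP] := @expR_dominates R (1 / (c * e0 ^+ 2)) 1 1 ltr01.
have [tb tb1 tbP] := @expR_dominates R (2 * a ^+ 2 / (c * e0 ^+ 2)) 1 3 ltr01.
have [tc tc1 tcP] := @expR_dominates R (8 * K ^+ 2 / (c * e0 ^+ 2)) 1 3 ltr01.
have [td td1 tdP] := @expR_dominates R (4 * M) 1 1 ltr01.
have h2 : 0 < 2^-1 :> R by [].
have [te te1 teP] := @expR_dominates R 2 2^-1 0 h2.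
have [tf tf1 tfP] := @expR_dominates R (20480 * c * M ^+ 2) th 3 th0.
exists dl, (ta + tb + tc + td + te + tf + (a * eta)^-1); split=> // k eps eps0.
set l := ln k%:R => tl e0e edl.
have aeV : 0 < (a * eta)^-1 by rewrite invr_gt0 mulr_gt0.
have [[tal tbl] [tcl tdl] [tel tfl] ael] : [/\ ta <= l /\ tb <= l, tc <= l /\ td <= l, te <= l
  /\ tf <= l & (a * eta)^-1 <= l].
  by move: tl ta1 tb1 tc1 td1 te1 tf1 aeV; clear; move=> *; repeat split; lra.
have l1 : 1 <= l by exact: le_trans tal.
have l0 : 0 < l by exact: lt_le_trans l1.
have k0' : 0 < k%:R :> R.
  by rewrite ltr0n lt0n; apply/negP => /eqP k0; move: l0; rewrite /l k0 ln0 // ltxx.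
have k0 : (0 < k)%N by rewrite -(ltr0n R).
have kE : k%:R = expR l by rewrite lnK ?posrE.
set e := - ln eps in e0e edl.
have epsE : eps = expR (- e) by rewrite opprK lnK ?posrE.
have ep : 0 < e by exact: lt_le_trans e0e.
pose nu := c * rate k eps.
have nuE : nu = c * (k%:R / l * e ^+ 2) by rewrite /nu rateE.
have nu_ge : c * e0 ^+ 2 * k%:R / l <= nu.
  rewrite nuE (_ : c * e0 ^+ 2 * k%:R / l = c * (k%:R / l * e0 ^+ 2)); last by ring.
  by rewrite ler_pM2l // ler_pM2l ?divr_gt0 // lerXn2r ?nnegrE ?(ltW e00) ?(ltW ep).
have ce0 : 0 < c * e0 ^+ 2 by rewrite mulr_gt0 ?exprn_gt0.
have nuX (A : R) (m : nat) : A / (c * e0 ^+ 2) * l ^+ m.+1 <= expR (1 * l) -> A * l ^+ m <= nu.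
  rewrite mul1r -kE => h; apply: le_trans nu_ge; rewrite ler_pdivlMr //.
  rewrite -[A * _ * l]mulrA -exprSr; move: h; rewrite mulrAC ler_pdivrMr // mulrC [k%:R *
    _]mulrC //.
have nu1 : 1 <= nu by have := nuX 1 0%N; rewrite expr0 mulr1; apply; apply: taP.
have nu0 : 0 < nu by exact: lt_le_trans nu1.
pose n := (Num.truncn nu).+1.
have /andP[nlo nhi] := truncn_itv (ltW nu0).
have n_gt : nu < n%:R by [].
have n_le : n%:R <= nu + 1 by rewrite /n -natr1 lerD2r.
have n_le2 : n%:R <= 2 * nu by move: n_le nu1; only_lra.
have n0' : 0 < n%:R :> R by exact: lt_trans n_gt.
exists n; first exact: n_le.
pose L := Num.truncn (a * l).
have /andP[Llo Lhi] := truncn_bounds (ltW (mulr_gt0 a0 l0)).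
rewrite -/L in Llo Lhi.
pose x := Num.sqrt (2 * n%:R / (k%:R * l)).
have kl0 : 0 < k%:R * l by rewrite mulr_gt0.
have x2E : x ^+ 2 = 2 * n%:R / (k%:R * l) by rewrite sqr_sqrtr // ltW // divr_gt0 // mulr_gt0.
have x0 : 0 < x by rewrite sqrtr_gt0 divr_gt0 // mulr_gt0.
have nukl : nu / (k%:R * l) = c * (e / l) ^+ 2 by rewrite nuE; field; rewrite !gt_eqF.
have el : e / l <= dl by rewrite ler_pdivrMr.
have el0 : 0 < e / l by rewrite divr_gt0.
have x2hi : x ^+ 2 <= Num.min (s1 / 2) (eta ^+ 2).
  apply: le_trans dlX; rewrite x2E.
  apply: (@le_trans _ _ (4 * (nu / (k%:R * l)))).
    by rewrite mulrA ler_pM2r ?invr_gt0 //; move: n_le2; only_lra.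
  rewrite nukl mulrA ler_pM2l ?mulr_gt0 // lerXn2r ?nnegrE ?(ltW el0) ?(ltW dl0) //.
have [x2s x2eta] : x ^+ 2 <= s1 / 2 /\ x ^+ 2 <= eta ^+ 2 by move: x2hi; rewrite le_min => /andP.
have xeta : x <= eta by rewrite -(ler_pXn2r (ltn0Sn 1)) ?nnegrE ?(ltW x0) ?(ltW eta0).
have xlo : sq * (e / l) <= x.
  rewrite -(ler_pXn2r (ltn0Sn 1)) ?nnegrE ?(ltW x0) ?mulr_ge0 ?invr_ge0 ?(ltW sq0) ?(ltW ep)
    ?(ltW l0) //.
  rewrite exprMn sq2 x2E (_ : 2 * c * (e / l) ^+ 2 = 2 * nu / (k%:R * l)); last by rewrite
    -[RHS]mulrA nukl; ring.
  by rewrite ler_pM2r ?invr_gt0 // ler_pM2l // (ltW n_gt).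
have x1 : x < 1 by apply: le_lt_trans eta1.
have x2' : 0 < 1 - x ^+ 2 by move: x2s s11; only_lra.
have Ll : L%:R <= a * l by [].
have alE : 1 <= eta * (a * l).
  move: ael; rewrite -[(a * eta)^-1]mul1r ler_pdivrMr ?(mulr_gt0 a0 eta0) // => h.
  by rewrite (_ : eta * (a * l) = l * (a * eta)) //; ring.
have Llo' : (1 - eta) * (a * l) <= L%:R by move: Llo alE; rewrite mulrBl; only_lra.
have L2n : (2 * L ^ 2 <= n)%N.
  rewrite -(ler_nat R) natrM natrX; apply: le_trans (ltW n_gt).
  apply: (@le_trans _ _ (2 * a ^+ 2 * l ^+ 2)); last by apply: nuX; apply: tbP.
  by rewrite -mulrA -exprMn ler_pM2l // lerXn2r ?nnegrE ?mulr_ge0 ?(ltW a0) ?(ltW l0).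
have Ln : (L <= n)%N.
  by apply: leq_trans L2n; rewrite -mulnn mulnA; case: (L) => // m; rewrite leq_pmull.
pose G := 1 + 2 * expR 1 * L%:R *
    expR (L%:R * (ln u + ((1 + x ^+ 2) / (1 - x ^+ 2) - coshu u) / sinhu u)).
have Gle : 1 + G <= 2 * M * l * expR ((2^-1 - th) * l).
  have E1 : 1 <= expR ((2^-1 - th) * l).
    by rewrite -[X in X <= _]expR0 ler_expR mulr_ge0 ?(ltW l0) // /th; move: s11; only_lra.
  have Ele : expR (L%:R * (ln u + ((1 + x ^+ 2) / (1 - x ^+ 2) - coshu u) / sinhu u)) <=
      expR ((2^-1 - th) * l).
    rewrite ler_expR -/S; set cx := _ / (1 - x ^+ 2).
    have cxE : 1 + cx = 2 / (1 - x ^+ 2) by rewrite /cx; field; rewrite gt_eqF.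
    apply: (@le_trans _ _ (L%:R * ((1 + cx) / S))).
      rewrite ler_wpM2l // (_ : (1 + cx) / S = (coshu u + 1) / S + (cx - coshu u) / S); last by
        ring.
      by rewrite lerD2r.
    apply: (@le_trans _ _ (a * l * ((1 + cx) / S))).
      by rewrite ler_wpM2r // cxE; apply: ltW; positivity.
    rewrite [a * l]mulrC -mulrA [leRHS]mulrC ler_pM2l // cxE [in leLHS]aS'.
    rewrite (_ : S * (1 - s1) / 4 * (2 / (1 - x ^+ 2) / S) = (1 - s1) / 2 / (1 - x ^+ 2)); last
      first.
      by field; rewrite !gt_eqF.
    rewrite ler_pdivrMr // /th; move: x2s s10 s11; clear; intros; nra.
  have Ml : 1 + G <= 2 * expR ((2^-1 - th) * l) +
      2 * expR 1 * (a * l) * expR ((2^-1 - th) * l).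
    rewrite /G addrA lerD //; first by move: E1; only_lra.
    by rewrite ler_pM ?expR_ge0 ?mulr_ge0 ?expR_ge0 // ler_pM2l // mulr_gt0 ?expR_gt0.
  apply: (le_trans Ml); set E := expR (_ * l) in E1 *.
  rewrite /M (_ : 2 * (1 + 2 * expR 1 * a) * l * E =
    2 * l * E + 2 * expR 1 * (a * l) * E + 2 * expR 1 * (a * l) * E); last by ring.
  have t1 : 2 * E <= 2 * l * E by rewrite ler_pM2r ?expR_gt0 // ler_peMr.
  have t2' : 0 <= 2 * expR 1 * (a * l) * E by apply: ltW; rewrite /E; positivity.
  by move: t1 t2'; only_lra.
have KK : 1 <= K by rewrite /K; move: a0; only_lra.
have K0 : 0 < K by exact: lt_le_trans KK.
have nl : 8 * K ^+ 2 * l ^+ 2 <= n%:R.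
  by apply: le_trans (ltW n_gt); apply: nuX; apply: tcP.
have Kl1 : 1 <= K * l by rewrite mulr_ege1.
apply: (@cheb_achievable _ k n L eps u x (K * l / n%:R) G) => //.
- by rewrite x0 x1.
- rewrite -/S (_ : L%:R * _ / _ = n%:R * (L%:R / l * 4 / ((1 - x ^+ 2) * S))); last first.
    by set d := 1 - _ in x2' *; rewrite x2E; field; rewrite !gt_eqF.
  have xS : 0 < (1 - x ^+ 2) * S by rewrite mulr_gt0.
  apply: ler_piMr => //; rewrite ler_pdivrMr // mul1r.
  apply: (@le_trans _ _ (a * 4)); first by rewrite ler_pM2r // ler_pdivrMr.
  by rewrite aS'; move: x2s s10 s11 S0; clear; intros; nra.
- rewrite divr_gt0 ?mulr_gt0 //= ler_pdivrMr //.
  by move: nl Kl1; rewrite -mulrA -exprMn; clear; intros; nra.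
- rewrite (_ : n%:R * _ = 4 * (K * l) ^+ 2 / n%:R); last by field; rewrite gt_eqF.
  rewrite ler_pdivrMr // exprMn; move: nl; rewrite -mulrA; only_lra.
- rewrite epsE ler_pdivlMr // (_ : 4 * expR _ * 4 = 16 * expR (- (L%:R * (2 * x - x ^+ 2))));
  last by ring.
  apply: le_trans (Hexp e e0e); rewrite ler_pM2l // ler_expR lerN2.
  apply: (@le_trans _ _ ((1 - eta) * (a * l) * (2 * (sq * (e / l)) * (1 - eta)))).
    rewrite (_ : _ * _ * _ = 2 * a * sq * (1 - eta) ^+ 2 * e); last by field; rewrite gt_eqF.
    by rewrite ler_pM2r.
  have ee0 : 0 <= 1 - eta by rewrite subr_ge0 ltW.
  rewrite ler_pM //.
  + by rewrite mulr_ge0 // mulr_ge0 // ltW.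
  + by apply: mulr_ge0 => //; apply: ltW; positivity.
  + rewrite (_ : 2 * x - x ^+ 2 = 2 * x * (1 - x / 2)); last by field.
    rewrite ler_pM //.
    * by apply: ltW; positivity.
    * by rewrite ler_pM2l.
    * by move: xeta x0; only_lra.
- apply: (@le_trans _ _ (2 * M * l * expR ((2^-1 - th) * l) * expR (a * l - K * l / 2))).
    rewrite ler_pM ?expR_ge0 //; first by rewrite /G; positivity.
      by apply: le_trans Gle; rewrite lerDr.
    by rewrite ler_expR (_ : n%:R * (K * l / n%:R) = K * l) ?lerD2r //; field; rewrite gt_eqF.
  have := tdP l tdl; rewrite expr1 mul1r => h4.
  have := teP l tel; rewrite expr0 mulr1 => h5.
  have el' : e <= th / 2 * l by apply: (le_trans edl); rewrite ler_pM2r.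
  rewrite epsE ler_pdivlMr //.
  rewrite (_ : 2 * M * l * _ * _ * 4 = 2 * (4 * M * l *
    (expR ((2^-1 - th) * l) * expR (a * l - K * l / 2)))); last by ring.
  rewrite -expRD; apply: (@le_trans _ _ (expR (2^-1 * l) * (expR l *
    expR ((2^-1 - th) * l + (a * l - K * l / 2))))).
    rewrite ler_pM //; first by apply: ltW; positivity.
    by rewrite ler_pM2r ?expR_gt0.
  rewrite -!expRD ler_expR.
  rewrite (_ : _ + _ = - (th * l)); last by rewrite /K; field.
  by move: el' (mulr_gt0 th0 l0); only_lra.
- rewrite epsE kE -expRD.
  have := teP l tel; rewrite expr0 mulr1 => /le_trans; apply; rewrite ler_expR.
  have el' : e <= th / 2 * l by apply: (le_trans edl); rewrite ler_pM2r.
  have el8 : th / 2 * l <= 1 / 8 * l by rewrite ler_pM2r.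
  by move: el' el8 l0; only_lra.
(* Up to powers of ln k, n G^2 / (eps k)^2 is at most k^(1 + (1 - 2 th) - 2 + 2 dl), and dl <= th /
   2 leaves k^(- th). *)
- have ek0 : 0 < eps * k%:R by rewrite mulr_gt0.
  rewrite ler_pdivrMr ?exprn_gt0 ?divr_gt0 //.
  have el' : e <= th / 2 * l by apply: (le_trans edl); rewrite ler_pM2r.
  set E := expR ((2^-1 - th) * l) in Gle.
  have GG : 0 <= 1 + G by rewrite /G; positivity.
  have n2 : n%:R <= 2 * c * expR l * l.
    apply: (le_trans n_le2); rewrite nuE kE -!mulrA ler_pM2l // ler_pM2l // ler_pM2l ?expR_gt0 //.
    rewrite mulrC ler_pdivrMr // -expr2 lerXn2r ?nnegrE ?(ltW ep) ?(ltW l0) //.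
    by apply: (le_trans edl); rewrite ler_piMl // ltW.
  apply: (@le_trans _ _ (2 * c * expR l * l * (4 * (2 * M * l * E)) ^+ 2)).
    rewrite ler_pM ?exprn_ge0 ?mulr_ge0 //.
    by rewrite lerXn2r ?nnegrE ?mulr_ge0 ?(ltW M0) ?(ltW l0) ?expR_ge0 // ler_pM2l.
  have := tfP l tfl => h6.
  have E2 : E ^+ 2 = expR (l - 2 * th * l).
    by rewrite /E -expRM_natl; congr expR; field.
  have ek2 : (eps * k%:R) ^+ 2 = expR (2 * l - 2 * e).
    by rewrite epsE kE -expRD -expRM_natl; congr expR; ring.
  rewrite expr_div_n ek2 !exprMn E2.
  have -> : 2 * c * expR l * l * (4 ^+ 2 * (2 ^+ 2 * M ^+ 2 * l ^+ 2 * expR (l - 2 * th * l))) =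
     20480 * c * M ^+ 2 * l ^+ 3 * (expR l * expR (l - 2 * th * l)) / 160 by field.
  have -> : 10^-1 * (expR (2 * l - 2 * e) / 4 ^+ 2) = expR (2 * l - 2 * e) / 160 by field.
  rewrite ler_pM2r // -expRD.
  apply: (@le_trans _ _ (expR (th * l) * expR (l + (l - 2 * th * l)))).
    by rewrite ler_pM2r ?expR_gt0.
  by rewrite -expRD ler_expR; move: el'; only_lra.
Qed.

(** * Asymptotics of the lower bound *)

Lemma expn_le_fact (R : realType) (m : nat) : m%:R ^+ m <= m`!%:R * expR m%:R :> R.
Proof.
case: m => [|m]; first by rewrite expr0 expR0 mulr1.
have := @expR_ge1Dxn R m.+1%:R m (ler0n R _).
move=> h; have F0 : 0 < (m.+1)`!%:R :> R by rewrite ltr0n fact_gt0.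
rewrite -ler_pdivrMl // mulrC; lra.
Qed.

Lemma bin_le_fact (R : realType) (n m : nat) : 'C(n, m)%:R * m`!%:R <= n%:R ^+ m :> R.
Proof.
rewrite -natrM -natrX ler_nat bin_ffact.
elim: m n => [//|m IHm] [|n]; first by rewrite ffact0n.
rewrite ffactSS expnS leq_mul // (leq_trans (IHm n)) //.
by case: (m) => // m'; rewrite leq_exp2r.
Qed.

(** The base lam n / (2 k) is at most m e^(-2 - eta) for m = L + 2, and m^m / m! <= e^m leaves
    e^(-(1 + eta) m). So one factor e^-1 is spent on the factorial, and the other will beat the k =
    e^l letters, with k^(- eta) to spare. The order L + 3 exceeds the exponent L + 2 of the
    normalization by one, whence n / k. *)
Lemma moment_gap_le (R : realType) (n k L : nat) (lam l eta : R) : (0 < k)%N ->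
  0 < lam -> 0 <= eta -> 0 <= l -> l <= L.+1%:R ->
  lam * n%:R / k%:R <= 2 * l * expR (- (2 + eta)) ->
  16 * (lam / 4) ^+ L.+2 * ('C(n, L.+3)%:R * (2 / k%:R) ^+ L.+3) <=
  32 * (n%:R / k%:R) * expR (- ((1 + eta) * l)).
Proof.
move=> k0 lam0 eta0 l0 lL h; have k0' : 0 < k%:R :> R by rewrite ltr0n.
pose m := L.+2; have m0 : 0 < m%:R :> R by rewrite ltr0n.
have F0 : 0 < m`!%:R :> R by rewrite ltr0n fact_gt0.
have lm : l <= m%:R by apply: (le_trans lL); rewrite ler_nat.
have C1 : 'C(n, m.+1)%:R * m`!%:R <= n%:R ^+ m.+1 :> R.
  apply: le_trans (bin_le_fact R n m.+1); rewrite ler_wpM2l // ler_nat.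
  by rewrite factS leq_pmull.
have q0 : 0 <= n%:R / k%:R :> R by rewrite divr_ge0.
have bnd : (lam / 4 * (2 / k%:R) * n%:R) ^+ m <= m`!%:R * expR (- ((1 + eta) * l)).
  have b1 : lam / 4 * (2 / k%:R) * n%:R <= m%:R * expR (- (2 + eta)).
    have -> : lam / 4 * (2 / k%:R) * n%:R = lam * n%:R / k%:R / 2 by field; rewrite gt_eqF.
    rewrite ler_pdivrMr // (le_trans h) // mulrAC -mulrA [2 * _]mulrC ler_pM2r // mulrC.
    by rewrite ler_pM2r ?expR_gt0.
  have b0 : 0 <= lam / 4 * (2 / k%:R) * n%:R by apply: mulr_ge0 => //; apply: ltW; positivity.
  apply: (@le_trans _ _ ((m%:R * expR (- (2 + eta))) ^+ m)).
    by rewrite lerXn2r ?nnegrE ?(le_trans b0).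
  rewrite exprMn -expRM_natl.
  apply: (@le_trans _ _ (m`!%:R * expR m%:R * expR (m%:R * - (2 + eta)))).
    by rewrite ler_wpM2r ?expR_ge0 // expn_le_fact.
  rewrite -mulrA -expRD ler_pM2l // ler_expR.
  have : (1 + eta) * l <= (1 + eta) * m%:R by rewrite ler_pM2l //; lra.
  by lra.
set X := lam / 4 * (2 / k%:R) * n%:R in bnd.
rewrite -(ler_pM2r F0).
have -> : 16 * (lam / 4) ^+ L.+2 * ('C(n, L.+3)%:R * (2 / k%:R) ^+ L.+3) * m`!%:R =
   16 * (lam / 4) ^+ m * (2 / k%:R) ^+ m.+1 * ('C(n, m.+1)%:R * m`!%:R).
  by rewrite /m; ring.
apply: (@le_trans _ _ (16 * (lam / 4) ^+ m * (2 / k%:R) ^+ m.+1 * n%:R ^+ m.+1)).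
  by rewrite ler_wpM2l //; apply: ltW; positivity.
have -> : 16 * (lam / 4) ^+ m * (2 / k%:R) ^+ m.+1 * n%:R ^+ m.+1 =
    32 * (n%:R / k%:R) * X ^+ m.
  by rewrite /X !exprMn ![_ ^+ m.+1]exprS; ring.
by rewrite -[leRHS]mulrA [_ * m`!%:R]mulrC ler_wpM2l.
Qed.

(** With l = ln k and e = - ln eps, lam = ga (l / e)^2 is the value for which lam n / k = 2 l e^(-2
    - eta) at n = c rate. Then sqrt lam = sqrt ga l / e, and the separation exponent 2 L sqrt(A /
    lam) is about 2 sqrt(A / ga) e, below kap e by hypothesis. The last hypothesis makes the
    separation exceed 2 eps with a margin for [D]. *)
Lemma lower_regime (R : realType) (c A tau eta e0 kap : R) :
  0 < c -> 1 < A -> 0 < tau < 1 -> 0 < eta -> 0 < e0 -> 0 < kap ->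
  2 * Num.sqrt A < kap * Num.sqrt (2 * expR (- (2 + eta)) / c) ->
  (forall e, e0 <= e -> 2 * (1 + tau) * expR (- e) <=
     (1 - tau) ^+ 2 * ((1 - A^-1) * (1 - tau) * expR (- (kap * e)) / (1 + kap * e / 2))) ->
  exists dl t0 : R, 0 < dl /\ forall (k n : nat) (eps : R), 0 < eps ->
    t0 <= ln k%:R -> e0 <= - ln eps -> - ln eps <= dl * ln k%:R ->
    n%:R <= c * rate k eps -> ~ achievable k eps n.
Proof.
move=> c0 A1 t01 eta0 e00 kap0; have /andP[tau0 tau1] := t01.
set ga := 2 * expR (- (2 + eta)) / c => kapga Hsep.
have ga0 : 0 < ga by rewrite /ga; positivity.
set sA := Num.sqrt A in kapga *; set sg := Num.sqrt ga in kapga.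
have A0 : 0 < A by exact: lt_trans A1.
have sA0 : 0 < sA by rewrite sqrtr_gt0.
have sg0 : 0 < sg by rewrite sqrtr_gt0.
have sg2 : sg ^+ 2 = ga by rewrite sqr_sqrtr // ltW.
pose g := kap * sg - 2 * sA.
have g0 : 0 < g by rewrite subr_gt0.
pose Lm := 3 * A + tau^-1.
have Lm0 : 0 < Lm by rewrite /Lm; positivity.
(* The three bounds on [dl] provide, in turn, a [D] below a fraction of eps k, room for the sqrt A
   subtracted in the denominator of the separation exponent, and sqrt lam >= 2 sqrt A. *)
have D1 : 0 < Num.min (8^-1) (Num.min (g / (2 * kap * sA)) (sg / (2 * sA))).
  by rewrite !lt_min invr_gt0 ltr0n /= !divr_gt0 ?mulr_gt0.
have [dl [dl0 dl1 dlD dlX]] := exists_sq_le Lm0 ga0 D1.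
move: dlD; rewrite !le_min => /and3P[dl8 dlg dlsg].
have h8 : 0 < 8^-1 :> R by [].
have h2 : 0 < 2^-1 :> R by [].
have [ta ta1 taP] := @expR_dominates R (320 * c) eta 1 eta0.
have [tb tb1 tbP] := @expR_dominates R (2 * ga / (tau ^+ 2 * e0 ^+ 2)) 1 3 ltr01.
have [tc tc1 tcP] := @expR_dominates R (40 * expR 2) 1 0 ltr01.
have [td td1 tdP] := @expR_dominates R 20 2^-1 0 h2.
have [te te1 teP] := @expR_dominates R (tau^-1) 8^-1 0 h8.
exists dl, (ta + tb + tc + td + te + 4 * sA / g); split=> // k n eps eps0.
set l := ln k%:R => tl e0e edl nle.
have sgV : 0 < 4 * sA / g by positivity.
have [[tal tbl] [tcl tdl] tel ael] : [/\ ta <= l /\ tb <= l, tc <= l /\ td <= l, te <= l & 4 *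
  sA / g <= l].
  by move: tl ta1 tb1 tc1 td1 te1 sgV; clear; move=> *; repeat split; lra.
have l1 : 1 <= l by exact: le_trans tal.
have l0 : 0 < l by exact: lt_le_trans l1.
have k0' : 0 < k%:R :> R.
  by rewrite ltr0n lt0n; apply/negP => /eqP k0; move: l0; rewrite /l k0 ln0 // ltxx.
have k0 : (0 < k)%N by rewrite -(ltr0n R).
have kE : k%:R = expR l by rewrite lnK ?posrE.
set e := - ln eps in e0e edl.
have epsE : eps = expR (- e) by rewrite opprK lnK ?posrE.
have ep : 0 < e by exact: lt_le_trans e0e.
rewrite rateE // -/l -/e in nle.
pose lam := ga * (l / e) ^+ 2.
have lam0 : 0 < lam by rewrite /lam; positivity.
have sl : Num.sqrt lam = sg * (l / e).
  by rewrite /lam sqrtrM ?(ltW ga0) // sqrtr_sqr gtr0_norm // divr_gt0.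
have el : e / l <= dl by rewrite ler_pdivrMr.
have le0 : 0 < l / e by rewrite divr_gt0.
have lamL : Lm <= lam.
  have : Lm * (e / l) ^+ 2 <= ga.
    apply: le_trans dlX; rewrite ler_pM2l // lerXn2r ?nnegrE ?divr_ge0 ?(ltW ep) ?(ltW l0) //.
    exact: ltW.
  rewrite /lam -ler_pdivlMr ?exprn_gt0 ?divr_gt0 // => /le_trans; apply.
  by rewrite -exprVn invf_div.
have lam3 : 3 * A <= lam by apply: le_trans lamL; rewrite /Lm lerDl invr_ge0 ltW.
have lamt : tau^-1 <= lam by apply: le_trans lamL; rewrite /Lm lerDr mulr_ge0 // ltW.
have lam1 : 1 <= lam by apply: le_trans lam3; move: A1; only_lra.
have lamhi : lam <= ga / e0 ^+ 2 * l ^+ 2.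
  rewrite /lam expr_div_n -[ga / _ * _]mulrA [_^-1 * _]mulrC ler_pM2l // ler_pM2l ?exprn_gt0 //.
  by rewrite lef_pV2 ?posrE ?exprn_gt0 // lerXn2r ?nnegrE ?(ltW e00) ?(ltW ep).
pose L := Num.truncn l.
have /andP[Llo Lhi] := truncn_bounds (ltW l0).
rewrite -/L in Llo Lhi.
have lL : l <= L.+1%:R by rewrite -natr1; move: Llo; only_lra.
have nk : n%:R / k%:R <= c * l.
  rewrite ler_pdivrMr // (le_trans nle) //.
  rewrite (_ : c * l * k%:R = c * (k%:R / l * l ^+ 2)); last by field; rewrite gt_eqF.
  rewrite ler_pM2l // ler_pM2l ?divr_gt0 // lerXn2r ?nnegrE ?(ltW ep) ?(ltW l0) //.
  by apply: (le_trans edl); rewrite ler_piMl // ltW.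
have lamn : lam * n%:R / k%:R <= 2 * l * expR (- (2 + eta)).
  rewrite ler_pdivrMr //; apply: (@le_trans _ _ (lam * (c * (k%:R / l * e ^+ 2)))).
    by rewrite ler_pM2l.
  rewrite le_eqVlt; apply/orP; left; apply/eqP.
  by rewrite /lam /ga; field; rewrite !gt_eqF.
have gap := @moment_gap_le R n k L lam l eta k0 lam0 (ltW eta0) (ltW l0) lL lamn.
(* k^(3/4) lies well above the standard deviation, of order sqrt k, and below tau eps k because eps
   >= k^(-1/8). *)
pose D := expR (3 / 4 * l).
apply: (@not_achievable_core R L n k eps A lam tau D) => //.
- exact: expR_gt0.
- have epsk : eps * k%:R = k%:R * expR (- e) by rewrite mulrC epsE.
  have DE : D <= k%:R * (tau * expR (- e)).
    have := teP l tel; rewrite expr0 mulr1 => h.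
    rewrite kE mulrCA -expRD -ler_pdivrMl //.
    apply: (@le_trans _ _ (expR (8^-1 * l) * D)); first by rewrite ler_pM2r // expR_gt0.
    rewrite /D -expRD ler_expR.
    have : e <= 8^-1 * l by apply: (le_trans edl); rewrite ler_pM2r.
    by only_lra.
  apply: (@le_trans _ _ (k%:R * (2 * (1 + tau) * expR (- e)))).
    rewrite epsk (_ : k%:R * (2 * _ * _) = 2 * (k%:R * expR (- e)) + 2 * (k%:R * (tau * expR (-
      e)))); last by ring.
    by rewrite lerD2l ler_pM2l.
  rewrite ler_pM2l // (le_trans (Hsep e e0e)) // ler_pM2l ?exprn_gt0 ?subr_gt0 //.
  rewrite /separation sl -/sA; set y := 2 * _ * _ / _.
  have den : 0 < sg * (l / e) - sA.
    rewrite subr_gt0 (@lt_le_trans _ _ (2 * sA)) //; first by move: sA0; only_lra.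
    have : 2 * sA * dl <= sg by rewrite mulrC -ler_pdivlMr ?mulr_gt0.
    move=> h; rewrite mulrA ler_pdivlMr //.
    apply: (@le_trans _ _ (2 * sA * (dl * l))); first by rewrite ler_pM2l ?mulr_gt0.
    by rewrite mulrA ler_pM2r.
  have y0 : 0 < y by rewrite /y; positivity; rewrite ltr0n.
  have ykap : y <= kap * e.
    rewrite /y ler_pdivrMr //.
    apply: (@le_trans _ _ (2 * (l + 1) * sA)).
      by rewrite ler_pM2r // ler_pM2l // -natr1 lerD2r.
    rewrite (_ : kap * e * _ = kap * sg * l - kap * sA * e); last by field; rewrite gt_eqF.
    have h1 : kap * sA * e <= g / 2 * l.
      apply: (@le_trans _ _ (kap * sA * (dl * l))); first by rewrite ler_pM2l ?mulr_gt0.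
      rewrite mulrA ler_pM2r // mulrC.
      move: dlg; rewrite ler_pdivlMr ?mulr_gt0 // => h.
      by rewrite ler_pdivlMr //; move: h; rewrite -!mulrA mulrCA [sA * _]mulrC !mulrA; only_lra.
    have h2' : 2 * sA <= g / 2 * l.
      move: ael; rewrite ler_pdivrMr // => h; rewrite mulrAC ler_pdivlMr //.
      by move: h; rewrite [l * g]mulrC; only_lra.
    have -> : kap * sg = g + 2 * sA by rewrite /g subrK.
    by move: h1 h2'; only_lra.
  have F1 : (1 - A^-1) * (1 - tau) <= (A - 1) * (lam - 1) / (A * lam).
    rewrite (_ : (A - 1) * (lam - 1) / (A * lam) = (1 - A^-1) * (1 - lam^-1)); last first.
      by field; rewrite !gt_eqF.
    rewrite ler_pM2l; last by rewrite subr_gt0 invf_lt1.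
    by rewrite lerD2l lerN2 -[leRHS]invrK lef_pV2 ?posrE ?invr_gt0.
  have F0 : 0 < (1 - A^-1) * (1 - tau).
    by rewrite mulr_gt0 ?subr_gt0 // invf_lt1.
  have ke0 : 0 < kap * e by rewrite mulr_gt0.
  rewrite ler_pM //.
  + by apply: ltW; rewrite mulr_gt0 ?expR_gt0.
  + by apply: ltW; positivity.
  + by rewrite ler_pM ?expR_ge0 ?(ltW F0) // ler_expR lerN2.
  + rewrite lef_pV2 ?posrE; [|by positivity|by positivity].
    by rewrite lerD2l ler_pM2r.
- have T1 : k%:R * (16 * (lam / 4) ^+ L.+2 * ('C(n, L.+3)%:R * (2 / k%:R) ^+ L.+3)) <= 1 / 10.
    apply: (@le_trans _ _ (k%:R * (32 * (c * l) * expR (- ((1 + eta) * l))))).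
      rewrite ler_pM2l // (le_trans gap) // ler_pM2r ?expR_gt0 // ler_pM2l //.
    rewrite kE (_ : expR l * _ = 32 * (c * l) * (expR l * expR (- ((1 + eta) * l)))); last by ring.
    rewrite -expRD (_ : l + _ = - (eta * l)); last by ring.
    rewrite expRN ler_pdivrMr ?expR_gt0 //.
    by have := taP l tal; rewrite expr1; only_lra.
  have T2 : (2 * k%:R + 2) * expR (tau / lam * (lam + 1 - tau * k%:R)) <= 1 / 10.
    have k1 : 1 <= k%:R :> R by rewrite ler1n.
    have ex : tau / lam * (lam + 1 - tau * k%:R) <= 2 - 2 * l.
      rewrite (_ : tau / lam * _ = tau + tau / lam - tau ^+ 2 * k%:R / lam); last first.
        by field; rewrite gt_eqF.
      have t1 : tau / lam <= 1 by rewrite ler_pdivrMr // mul1r (le_trans (ltW tau1)).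
      have t2 : 2 * l <= tau ^+ 2 * k%:R / lam.
        rewrite ler_pdivlMr //.
        apply: (@le_trans _ _ (2 * l * (ga / e0 ^+ 2 * l ^+ 2))).
          by rewrite ler_pM2l // mulr_gt0.
        have := tbP l tbl; rewrite mul1r -kE => h.
        have -> : 2 * l * (ga / e0 ^+ 2 * l ^+ 2) = tau ^+ 2 * (2 * ga / (tau ^+ 2 * e0 ^+ 2) *
          l ^+ 3).
          by field; rewrite !gt_eqF.
        by rewrite ler_pM2l ?exprn_gt0.
      by move: t1 t2 tau1; only_lra.
    apply: (@le_trans _ _ (4 * k%:R * expR (2 - 2 * l))).
      have a1 : 0 <= 2 * k%:R + 2 :> R by move: k1; only_lra.
      have a2 : 2 * k%:R + 2 <= 4 * k%:R :> R by move: k1; only_lra.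
      by rewrite ler_pM ?expR_ge0 ?ler_expR.
    rewrite kE expRD (_ : 4 * expR l * _ = 4 * expR 2 * (expR l * expR (- (2 * l)))); last by ring.
    rewrite -expRD (_ : l + _ = - l); last by ring.
    rewrite expRN ler_pdivrMr ?expR_gt0 //.
    by have := tcP l tcl; rewrite expr0 mul1r; only_lra.
  have T3 : 2 * k%:R / D ^+ 2 <= 1 / 10.
    rewrite /D -expRM_natl ler_pdivrMr ?expR_gt0 // kE.
    have -> : 2%:R * (3 / 4 * l) = l + 2^-1 * l by field.
    rewrite expRD.
    have := tdP l tdl; rewrite expr0 mulr1 => h.
    apply: (@le_trans _ _ (1 / 10 * 20 * expR l)); first by move: (expR_gt0 l); only_lra.
    by rewrite [expR l * _]mulrC mulrA ler_pM2r ?expR_gt0 // ler_pM2l.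
  apply: (@le_lt_trans _ _ (1 / 10 + 1 / 10 + 1 / 10)); first by rewrite lerD ?lerD.
  by only_lra.
Qed.

(** * Numerical constants *)

Lemma series_exp_coeff_le (R : realType) (x : R) (n : nat) : 0 <= x ->
  \sum_(i < n) x ^+ i / i`!%:R <= expR x.
Proof.
move=> x0; rewrite /expR -(big_mkord xpredT (fun i => x ^+ i / i`!%:R)).
apply: (@nondecreasing_cvgn_le _ (series (exp_coeff x))); last exact: is_cvg_series_exp_coeff.
apply/nondecreasing_seqP => m; rewrite !seriesEnat /= big_nat_recr //= lerDl.
by rewrite /exp_coeff /= divr_ge0 // exprn_ge0.
Qed.

(** The exponential series from index m on, truncated and divided by x^m / m!. The Horner form lets
    [lra] evaluate it at a rational point. *)
Fixpoint exp_horner (R : realType) (n m : nat) (x : R) : R :=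
  if n is n'.+1 then 1 + x / m.+1%:R * exp_horner n' m.+1 x else 1.

Lemma exp_horner_le (R : realType) (n : nat) (x : R) : 0 <= x -> exp_horner n 0 x <= expR x.
Proof.
move=> x0; apply: le_trans (series_exp_coeff_le n.+1 x0).
suff H m : x ^+ m / m`!%:R * exp_horner n m x = \sum_(i < n.+1) x ^+ (m + i) / (m + i)`!%:R.
  by have := H 0%N; rewrite expr0 fact0 divr1 mul1r => ->.
elim: n m => [|n IHn] m /=; first by rewrite big_ord1 addn0 mulr1.
rewrite big_ord_recl addn0 mulrDr mulr1; congr (_ + _).
have -> : x ^+ m / m`!%:R * (x / m.+1%:R * exp_horner n m.+1 x) =
    x ^+ m.+1 / (m.+1)`!%:R * exp_horner n m.+1 x.
  have F0 : m`!%:R != 0 :> R by rewrite pnatr_eq0 -lt0n fact_gt0.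
  have m0 : m.+1%:R != 0 :> R by rewrite pnatr_eq0.
  rewrite factS natrM exprSr; move: (m.+1%:R) (m`!%:R) m0 F0 => b f b0 f0.
  by field; rewrite b0 f0.
by rewrite IHn; apply: eq_bigr => i _; rewrite lift0 addnS addSn.
Qed.

(** As (coshu u + 1) / sinhu u = (u + 1) / (u - 1), the largest admissible u solves ln u = (u + 1) /
    (u - 1), about 4.6805. The u taken here is just below it; [a] is just below sinhu u / 4, about
    0.55835. *)
Lemma chebyshev_constants (R : realType) : exists u a : R,
  [/\ 1 < u, ln u <= (coshu u + 1) / sinhu u, 0 < a, 4 * a < sinhu u &
      (249 + 403 / 1000) / 100 <= 8 * a ^+ 2].
Proof.
pose u : R := (468 + 46 / 1000) / 100.
exists u, ((55 + 835 / 1000) / 100).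
have u0 : 0 < u by rewrite /u; lra.
have Su : sinhu u = (u - u^-1) / 2 by [].
have uV : u^-1 <= (213 + 655 / 1000) / 1000.
  by rewrite -[u^-1]mul1r ler_pdivrMr // /u; lra.
have uV0 : 0 < u^-1 by rewrite invr_gt0.
have S0 : 0 < sinhu u by rewrite /sinhu /u in uV *; lra.
split.
- by rewrite /u; lra.
- have E : (coshu u + 1) / sinhu u = (u + 1) / (u - 1).
    rewrite /coshu /sinhu; field.
    by rewrite !gt_eqF //; rewrite /u; lra.
  (* 1.5434 separates ln u from (u + 1) / (u - 1); twelve terms of the exponential series show that
     it is at least ln u. *)
  have x0 : 0 <= ((154 + 34 / 100) / 100 : R) by lra.
  have h := exp_horner_le 11 x0.
  rewrite -ler_expR lnK ?posrE //.
  apply: (@le_trans _ _ (expR ((154 + 34 / 100) / 100))).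
    by apply: le_trans h; rewrite /u /=; lra.
  by rewrite ler_expR E ler_pdivlMr /u; lra.
- by lra.
- by rewrite Su; rewrite /u in uV *; lra.
- by lra.
Qed.

(** * The sample complexity *)

Lemma nstar_le (R : realType) (k n : nat) (eps : R) : achievable k eps n ->
  (nstar k eps <= n%:R%:E)%E.
Proof. by move=> ach; apply: ereal_inf_lbound; exists n. Qed.

Lemma nstar_ge (R : realType) (k : nat) (eps x : R) :
  (forall n, achievable k eps n -> x <= n%:R) -> (x%:E <= nstar k eps)%E.
Proof.
by move=> ach; apply: le_ereal_inf_tmp => _ [n /ach xn <-]; rewrite lee_fin.
Qed.

Lemma coupon_bound (R : realType) (k : nat) (eps : R) : (1 < k)%N -> 0 < eps ->
  exists2 n : nat, n%:R <= k%:R * (ln k%:R + 10) + 1 :> R & achievable k eps n.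
Proof.
move=> k1 eps0; have k0 : (0 < k)%N by exact: ltnW.
have k0' : 0 < k%:R :> R by rewrite ltr0n.
have l0 : 0 <= ln (k%:R : R) by rewrite ln_ge0 // ler1n.
set x := k%:R * (ln k%:R + 10).
have x0 : 0 <= x by rewrite mulr_ge0 ?addr_ge0.
exists (Num.truncn x).+1.
  by have /andP[h _] := truncn_itv x0; rewrite -natr1 lerD2r.
have /andP[_ xn] := truncn_itv x0.
apply: coupon_achievable => //; set n := (Num.truncn x).+1 in xn *.
have kV : k%:R^-1 <= 1 :> R by rewrite invf_le1 // ler1n.
apply: (@le_trans _ _ (k%:R * expR (- (ln k%:R + 10)))).
  rewrite ler_pM2l //; apply: (@le_trans _ _ (expR (- k%:R^-1) ^+ n)).
    by rewrite lerXn2r ?nnegrE ?expR_ge0 ?subr_ge0 // expR_ge1Dx.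
  rewrite -expRM_natl ler_expR mulrN lerN2 ler_pdivlMr // mulrC.
  exact: ltW.
rewrite opprD expRD expRN lnK ?posrE // mulrA mulfV ?gt_eqF // mul1r expRN.
rewrite lef_pV2 ?posrE ?expR_gt0 //.
by have := expR_ge1Dx (10 : R); lra.
Qed.

Lemma rate_dominates (R : realType) (B e0 : R) : 0 < e0 ->
  exists2 t0 : R, 1 <= t0 & forall (k : nat) (eps : R), 0 < eps ->
    t0 <= ln k%:R -> e0 <= - ln eps -> B <= rate k eps.
Proof.
move=> e00; have [t0 t01 H] := @expR_dominates R (`|B| / e0 ^+ 2) 1 1 ltr01.
exists t0 => // k eps eps0 tk ek; rewrite rateE //.
have l0 : 0 < ln k%:R :> R by exact: lt_le_trans (lt_le_trans ltr01 t01) tk.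
have k0 : 0 < k%:R :> R.
  by rewrite lt0r ler0n andbT; apply: contraTneq l0 => ->; rewrite ln0 // ltxx.
have := H _ tk; rewrite expr1 mul1r lnK ?posrE // => kge.
apply: le_trans (ler_norm B) _.
have -> : `|B| = `|B| / e0 ^+ 2 * ln k%:R / ln k%:R * e0 ^+ 2.
  by field; rewrite !gt_eqF.
apply: ler_pM; rewrite ?divr_ge0 ?mulr_ge0 ?exprn_ge0 ?invr_ge0 ?exprn_ge0 ?(ltW l0) ?(ltW e00) //.
  by rewrite ler_pM2r // invr_gt0.
by rewrite lerXn2r // nnegrE ?(ltW e00) // (le_trans (ltW e00)).
Qed.

Lemma upper_asymptotic (R : realType) : exists dl t0 e0 : R, 0 < dl /\
  forall (k : nat) (eps : R), 0 < eps ->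
    t0 <= ln k%:R -> e0 <= - ln eps -> - ln eps <= dl * ln k%:R ->
    (nstar k eps <= (rate k eps / (2494 / 1000))%:E)%E.
Proof.
have [u [a [u1 uS a0 aS a2]]] := chebyshev_constants R.
(* 1 / 2.49402 lies strictly between 1 / (8 a^2) and 1 / 2.494: the first gap allows kap > 1, the
   second absorbs the rounding of n. *)
pose c : R := (2494 / 1000 + 2 / 1000 / 100)^-1.
have c0 : 0 < c by rewrite invr_gt0; lra.
have ac : 1 < 2 * a * Num.sqrt (2 * c).
  have c20 : 0 <= 2 * c by rewrite mulr_ge0 // ltW.
  rewrite -(ltr_pXn2r (ltn0Sn 1)) ?nnegrE //; last first.
    by rewrite mulr_ge0 ?sqrtr_ge0 // mulr_ge0 // ltW.
  rewrite expr1n exprMn sqr_sqrtr //.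
  have -> : (2 * a) ^+ 2 * (2 * c) = 8 * a ^+ 2 * c by ring.
  rewrite /c ltr_pdivlMr; last by only_lra.
  by move: a2; only_lra.
pose kap := (1 + 2 * a * Num.sqrt (2 * c)) / 2.
have kap1 : 1 < kap by rewrite /kap; move: ac; only_lra.
have kap2 : kap < 2 * a * Num.sqrt (2 * c) by rewrite /kap; move: ac; only_lra.
have kap0 : 0 < kap by move: kap1; only_lra.
have kB : 0 < kap - 1 by move: kap1; only_lra.
have l16 : 0 < ln (16 : R) by rewrite ln_gt0 // ltr1n.
have e00 : 0 < ln 16 / (kap - 1) by rewrite divr_gt0.
have [|dl [t0 [dl0 H]]] := upper_regime u1 uS a0 aS c0 e00 kap0 kap2.
  move=> e; rewrite ler_pdivrMr // => h.
  rewrite -[16 in leLHS]lnK ?posrE // -expRD ler_expR.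
  by move: h; rewrite mulrBr mulr1 [e * _]mulrC; only_lra.
pose s := (2494 / 1000)^-1 - c.
have s0 : 0 < s by rewrite /s /c subr_gt0 ltf_pV2 ?posrE; only_lra.
have [t1 t11 H1] := rate_dominates s^-1 e00.
exists dl, (Num.max t0 t1), (ln 16 / (kap - 1)); split=> // k eps eps0.
rewrite ge_max => /andP[tk0 tk1] ek ekd.
have [n nle ach] := H k eps eps0 tk0 ek ekd.
apply: le_trans (nstar_le ach) _; rewrite lee_fin; apply: le_trans nle _.
have := H1 k eps eps0 tk1 ek; rewrite -[s^-1]mul1r ler_pdivrMr // /s mulrBr.
by rewrite [c * _]mulrC; only_lra.
Qed.

(** Outside the scope of [upper_regime], either ln k is bounded or eps is below a power of 1 / k. In
    both cases - ln eps >= s ln k for a constant s, so that the rate is of order k ln k and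
    [coupon_bound] suffices. *)
Lemma upper_uniform (R : realType) (c0 : R) : 0 < c0 < 1 ->
  exists2 C : R, 0 < C & forall (k : nat) (eps : R), (0 < k)%N ->
    k%:R^-1 <= eps -> eps <= c0 -> (nstar k eps <= (C * rate k eps)%:E)%E.
Proof.
move=> /andP[c00 c01].
have [u [a [u1 uS a0 aS a2]]] := chebyshev_constants R.
pose e0 := - ln c0.
have e00 : 0 < e0 by rewrite /e0 oppr_gt0 ln_lt0 // c00.
have l16 : 0 < ln (16 : R) by rewrite ln_gt0 // ltr1n.
pose kap := 1 + ln 16 / e0.
have kap0 : 0 < kap by rewrite /kap; positivity.
pose c := (kap / a) ^+ 2.
have c0' : 0 < c by rewrite /c; positivity.
have kapc : kap < 2 * a * Num.sqrt (2 * c).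
  have c20 : 0 <= 2 * c by rewrite mulr_ge0 // ltW.
  rewrite -(ltr_pXn2r (ltn0Sn 1)) ?nnegrE //; first last.
  - by rewrite mulr_ge0 ?sqrtr_ge0 // mulr_ge0 // ltW.
  - exact: ltW.
  rewrite exprMn sqr_sqrtr //.
  have -> : (2 * a) ^+ 2 * (2 * c) = 8 * kap ^+ 2.
    by rewrite /c; field; rewrite gt_eqF.
  by rewrite ltr_pMl ?exprn_gt0 // ltr1n.
have [|dl [t0 [dl0 H]]] := upper_regime u1 uS a0 aS c0' e00 kap0 kapc.
  move=> e e0e; rewrite -[16 in leLHS]lnK ?posrE // -expRD ler_expR.
  rewrite /kap mulrDl mul1r opprD addrCA gerDl subr_le0 mulrAC.
  by rewrite ler_pdivlMr // ler_pM2l.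
pose t := Num.max t0 1; have t1 : 1 <= t by rewrite le_max lexx orbT.
have tt0 : 0 < t by exact: lt_le_trans t1.
pose s := Num.min dl (e0 / t).
have s0 : 0 < s by rewrite lt_min dl0 divr_gt0.
pose W := 1 + 11 / e0.
have W0 : 0 < W by rewrite /W; positivity.
exists (c + (e0 ^+ 2)^-1 + W / s ^+ 2); first by positivity.
move=> k eps k0 keps epsc.
have k0' : 0 < k%:R :> R by rewrite ltr0n.
have eps0 : 0 < eps by apply: lt_le_trans keps; rewrite invr_gt0.
have e0e : e0 <= - ln eps by rewrite lerN2 ler_ln ?posrE.
have ele : - ln eps <= ln k%:R.
  by rewrite lerNl -lnV ?posrE // ler_ln ?posrE ?invr_gt0.
set l := ln k%:R in ele *; set e := - ln eps in e0e ele *.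
have l0 : 0 < l by exact: lt_le_trans (lt_le_trans e00 e0e) ele.
have e0' : 0 < e by exact: lt_le_trans e0e.
have rateq : rate k eps = k%:R / l * e ^+ 2 by rewrite rateE.
have r0 : 0 < rate k eps by rewrite rateq; positivity.
have lk : l <= k%:R by rewrite -[leRHS]lnK ?posrE //; apply: le_trans (expR_ge1Dx _); rewrite lerDr.
have [/andP[tl el]|small] := boolP ((t0 <= l) && (e <= dl * l)).
  have [n nle ach] := H k eps eps0 tl e0e el.
  apply: le_trans (nstar_le ach) _; rewrite lee_fin; apply: le_trans nle _.
  rewrite -addrA mulrDl lerD2l mulrDl.
  apply: (@le_trans _ _ ((e0 ^+ 2)^-1 * rate k eps)); last first.
    by rewrite lerDl; positivity.
  rewrite mulrC ler_pdivlMr ?exprn_gt0 // mul1r rateq -[leLHS]mul1r.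
  apply: ler_pM; rewrite ?exprn_ge0 ?(ltW e00) //.
    by rewrite ler_pdivlMr // mul1r.
  by rewrite lerXn2r // nnegrE ltW.
have se : s * l <= e.
  move: small; rewrite negb_and -!ltNge => /orP[lt0|/ltW dle].
    apply: le_trans e0e; apply: (@le_trans _ _ (e0 / t * t)).
      apply: ler_pM; rewrite ?(ltW s0) ?(ltW l0) ?ge_min ?lexx ?orbT //.
      by rewrite le_max (ltW lt0).
    by rewrite divfK ?gt_eqF.
  by apply: le_trans dle; rewrite ler_pM2r // ge_min lexx.
have k1 : (1 < k)%N.
  rewrite ltn_neqAle k0 andbT; apply: contraTneq l0 => kE.
  by rewrite /l -kE ln1 ltxx.
have [n nle ach] := coupon_bound k1 eps0.
apply: le_trans (nstar_le ach) _; rewrite lee_fin; apply: le_trans nle _.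
apply: (@le_trans _ _ (W * (k%:R * l))).
  have kl : k%:R <= k%:R * l / e0.
    by rewrite ler_pdivlMr // ler_pM2l // (le_trans e0e).
  have k1' : 1 <= k%:R :> R by rewrite ler1n.
  rewrite /W mulrDl mul1r -/l mulrDr -addrA lerD2l mulrAC -mulrA.
  by move: kl k1'; only_lra.
have kl : k%:R * l <= rate k eps / s ^+ 2.
  rewrite ler_pdivlMr ?exprn_gt0 // rateq.
  have -> : k%:R * l * s ^+ 2 = k%:R / l * (s * l) ^+ 2 by field; rewrite gt_eqF.
  rewrite ler_pM2l ?divr_gt0 // lerXn2r // nnegrE ltW //.
  by rewrite mulr_gt0.
apply: (@le_trans _ _ (W * (rate k eps / s ^+ 2))).
  by rewrite ler_pM2l.
rewrite [_ / s ^+ 2]mulrC mulrA [leRHS]mulrDl lerDr; positivity.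
Qed.

(** For eps near 1/2 almost full separation is required, while the constant c may be small. So A is
    of the order of 1 / (1 - 2 c0), [kap] is small, and c is chosen to fit [lower_regime]. *)
Lemma lower_uniform_regime (R : realType) (c0 : R) : 0 < c0 < 2^-1 ->
  exists c dl t0 : R, [/\ 0 < c, 0 < dl & forall (k n : nat) (eps : R), 0 < eps ->
    t0 <= ln k%:R -> - ln c0 <= - ln eps -> - ln eps <= dl * ln k%:R ->
    achievable k eps n -> c * rate k eps <= n%:R].
Proof.
move=> /andP[c00 c02]; pose e0 := - ln c0.
have e00 : 0 < e0 by rewrite /e0 oppr_gt0 ln_lt0 // c00; move: c02; only_lra.
(* Now 2 c0 = 1 - 6 tau, and all reduces to (1 - 6 tau) (1 + tau)^2 <= (1 - tau)^4. *)
pose tau := (1 - 2 * c0) / 6.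
have tau0 : 0 < tau by rewrite /tau; move: c02; only_lra.
have tau6 : tau < 6^-1 by rewrite /tau; move: c00; only_lra.
have tau1 : tau < 1 by move: tau6; only_lra.
have lt0 : 0 < ln (1 + tau) by rewrite ln_gt0 // ltrDl.
have lt1 : ln (1 + tau) <= 1.
  by rewrite -ler_expR lnK ?posrE ?addr_gt0 // (le_trans _ (expR_ge1Dx _)) ?lerD2l ?(ltW tau1).
(* The factor 3/2 treats exp(- kap e) together with 1 + kap e / 2 <= exp(kap e / 2); the factor e0 +
   1 limits their joint loss at e0 to 1 + tau. *)
pose kap := ln (1 + tau) / ((3 / 2) * (e0 + 1)).
have kap0 : 0 < kap by rewrite divr_gt0 // !mulr_gt0 ?addr_gt0.
have kapE : (3 / 2) * kap * (e0 + 1) = ln (1 + tau).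
  by rewrite /kap; field; rewrite gt_eqF // addr_gt0.
have kap1 : (3 / 2) * kap <= 1.
  apply: le_trans lt1; rewrite -kapE ler_peMr ?lerDr ?(ltW e00) //.
  by rewrite mulr_ge0 ?(ltW kap0).
pose A := tau^-1.
have A1 : 1 < A by rewrite /A invf_gt1.
have A0 : 0 < A by exact: lt_trans A1.
pose c := expR (- (2 + 1)) * kap ^+ 2 / (4 * A).
have c0' : 0 < c by rewrite /c; positivity.
have t01 : 0 < tau < 1 by rewrite tau0.
have kapc : 2 * Num.sqrt A < kap * Num.sqrt (2 * expR (- (2 + 1)) / c).
  have h : 0 <= 2 * expR (- (2 + 1)) / c by rewrite ltW //; positivity.
  rewrite -(ltr_pXn2r (ltn0Sn 1)) ?nnegrE; try by rewrite mulr_ge0 ?sqrtr_ge0 ?(ltW kap0).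
  rewrite exprMn [X in _ < X]exprMn !sqr_sqrtr ?(ltW A0) //.
  have -> : kap ^+ 2 * (2 * expR (- (2 + 1)) / c) = 8 * A.
    by rewrite /c; field; rewrite !gt_eqF ?expR_gt0.
  by rewrite ltr_pM2r //; only_lra.
have [|dl [t0 [dl0 H]]] := lower_regime c0' A1 t01 ltr01 e00 kap0 kapc.
  move=> e e0e; have ep : 0 < e by exact: lt_le_trans e0e.
  have ke : 0 < kap * e by rewrite mulr_gt0.
  have d0 : 0 < 1 + kap * e / 2 by rewrite addr_gt0 // divr_gt0.
  have -> : 1 - A^-1 = 1 - tau by rewrite /A invrK.
  have st1 : 0 < 1 - tau by rewrite subr_gt0.
  apply: (@le_trans _ _ ((1 - tau) ^+ 4 * expR (- ((3 / 2) * kap * e)))); last first.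
    have -> : (1 - tau) ^+ 2 * ((1 - tau) * (1 - tau) * expR (- (kap * e)) / (1 + kap * e / 2))
      = (1 - tau) ^+ 4 * (expR (- (kap * e)) / (1 + kap * e / 2)).
      by field; rewrite gt_eqF //; move: ke; only_lra.
    rewrite ler_pM2l ?exprn_gt0 // ler_pdivlMr //.
    have -> : - (kap * e) = - ((3 / 2) * kap * e) + kap * e / 2 by field.
    by rewrite expRD ler_pM2l ?expR_gt0 // expR_ge1Dx.
  have -> : expR (- e) = expR (- (1 - (3 / 2) * kap) * e) * expR (- ((3 / 2) * kap * e)).
    by rewrite -expRD; congr expR; field.
  rewrite mulrA ler_pM2r ?expR_gt0 //.
  have h1 : expR (- (1 - (3 / 2) * kap) * e) <= c0 * (1 + tau).
    have tp : 0 < 1 + tau by rewrite addr_gt0.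
    rewrite -[c0 in leRHS]lnK ?posrE // -[1 + tau in leRHS]lnK ?posrE // -expRD ler_expR.
    have k0 : 0 <= 1 - 3 / 2 * kap by rewrite subr_ge0.
    have := ler_wpM2l k0 e0e; have : 0 <= 3 / 2 * kap by rewrite mulr_ge0 ?(ltW kap0).
    by move: kapE; rewrite /e0 mulNr mulrDr; move: (3 / 2 * kap) => x; nra.
  apply: (@le_trans _ _ (2 * (1 + tau) * (c0 * (1 + tau)))).
    by rewrite ler_pM2l // mulr_gt0 // addr_gt0.
  have -> : c0 = (1 - 6 * tau) / 2 by rewrite /tau; field.
  move: tau0 tau1; clear; intros.
  have : 0 <= tau ^+ 2 * (1 - tau) by rewrite mulr_ge0 ?sqr_ge0 ?subr_ge0 ?ltW.
  have : 0 <= tau ^+ 2 by rewrite sqr_ge0.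
  have : 0 <= tau ^+ 3 by rewrite exprn_ge0 ?ltW.
  have : 0 <= tau ^+ 4 by rewrite exprn_ge0 ?ltW.
  have -> : 2 * (1 + tau) * ((1 - 6 * tau) / 2 * (1 + tau)) =
    1 - 4 * tau - 11 * tau ^+ 2 - 6 * tau ^+ 3 by field.
  have -> : (1 - tau) ^+ 4 = 1 - 4 * tau + 2 * tau ^+ 2 + 4 * (tau ^+ 2 * (1 - tau)) + tau ^+ 4
    by ring.
  by only_lra.
exists c, dl, t0; split=> // k n eps eps0 tk ek ekd ach.
by rewrite leNgt; apply/negP => /ltW h; exact: H k n eps eps0 tk ek ekd h ach.
Qed.

(** For bounded ln k the rate is bounded and n >= 1 suffices; this is where the premise with [k./2]
    enters. For eps below k^(- dl), an estimator for eps also serves k^(- dl), where the rate is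
    dl^2 k ln k, while the rate at eps is at most k ln k. *)
Lemma lower_uniform (R : realType) (c0 : R) : 0 < c0 < 2^-1 ->
  exists2 c : R, 0 < c & forall (k : nat) (eps : R), (0 < k)%N ->
    k%:R^-1 <= eps -> eps <= c0 -> eps * k%:R <= k./2%:R ->
    ((c * rate k eps)%:E <= nstar k eps)%E.
Proof.
move=> c0P; have /andP[c00 c02] := c0P.
have [c [dl [t0 [cp dl0 H]]]] := lower_uniform_regime c0P.
pose e0 := - ln c0.
have e00 : 0 < e0 by rewrite /e0 oppr_gt0 ln_lt0 // c00; move: c02; only_lra.
pose M := Num.max t0 (e0 / dl).
exists (Num.min c (Num.min (c * dl ^+ 2) (expR (- (2 * M))))).
  by rewrite !lt_min cp expR_gt0 andbT mulr_gt0 // exprn_gt0.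
move=> k eps k0 keps epsc epsk.
have k0' : 0 < k%:R :> R by rewrite ltr0n.
have eps0 : 0 < eps by apply: lt_le_trans keps; rewrite invr_gt0.
have e0e : e0 <= - ln eps by rewrite lerN2 ler_ln ?posrE.
have ele : - ln eps <= ln k%:R.
  by rewrite lerNl -lnV ?posrE // ler_ln ?posrE ?invr_gt0.
have rateq : rate k eps = k%:R / ln k%:R * (- ln eps) ^+ 2 by rewrite rateE.
set l := ln k%:R in ele rateq *; set e := - ln eps in e0e ele rateq *.
have l0 : 0 < l by exact: lt_le_trans (lt_le_trans e00 e0e) ele.
have ep : 0 < e by exact: lt_le_trans e0e.
have r0 : 0 < rate k eps by rewrite rateq; positivity.
have rkl : rate k eps <= k%:R * l.
  rewrite rateq; have -> : k%:R * l = k%:R / l * l ^+ 2 by field; rewrite gt_eqF.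
  by rewrite ler_pM2l ?divr_gt0 // lerXn2r // nnegrE ltW.
apply: nstar_ge => n ach.
have [|lM] := leP M l; last first.
  apply: (@le_trans _ _ (expR (- (2 * M)) * rate k eps)).
    by rewrite ler_pM2r // !ge_min lexx !orbT.
  have n1 : 1 <= n%:R :> R by rewrite ler1n (achievable_gt0 k0 epsk ach).
  apply: le_trans n1; rewrite expRN mulrC ler_pdivrMr ?expR_gt0 // mul1r.
  apply: le_trans rkl _; apply: (@le_trans _ _ (k%:R * k%:R)).
    rewrite ler_pM2l // -[leRHS]lnK ?posrE //; apply: le_trans (expR_ge1Dx _).
    by rewrite lerDr.
  rewrite -[k%:R]lnK ?posrE // -expRD ler_expR.
  by move: (ltW lM); rewrite /l; only_lra.
rewrite ge_max => /andP[tl el].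
have [edl|/ltW edl] := leP e (dl * l).
  apply: le_trans (H k n eps eps0 tl e0e edl ach).
  by rewrite ler_pM2r // ge_min lexx.
have leE : eps <= expR (- (dl * l)).
  by rewrite -[leLHS]lnK ?posrE // ler_expR lerNr.
have /H := le_achievable k0 leE ach.
rewrite expRK opprK lexx tl /= => h.
have := h (expR_gt0 _) isT; rewrite mulrC -ler_pdivrMr // => /(_ el isT).
rewrite rateE ?expR_gt0 // expRK opprK => {}h; apply: le_trans h.
apply: (@le_trans _ _ (c * dl ^+ 2 * (k%:R * l))).
  apply: ler_pM => //; [|exact: ltW|by rewrite !ge_min lexx orbT].
  by rewrite ltW // !lt_min cp expR_gt0 andbT mulr_gt0 // exprn_gt0.
rewrite le_eqVlt; apply/orP; left; apply/eqP; rewrite -/l.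
by field; rewrite gt_eqF.
Qed.

(** For large e = - ln eps the factor exp(- s e) absorbs all constants and the linear factor, so tau
    = 1/2 will do. The constant is affected only by A = 1 + s, kap = 1 - s and eta = s, and s = de /
    8 suffices by (1 + s) (1 - 8 s) < (1 - s)^3. *)
Lemma lower_asymptotic (R : realType) (de : R) : 0 < de < 1 ->
  exists dl t0 e0 : R, 0 < dl /\
  forall (k : nat) (eps : R), 0 < eps ->
    t0 <= ln k%:R -> e0 <= - ln eps -> - ln eps <= dl * ln k%:R ->
    (((1 - de) / (2 * expR 1 ^+ 2) * rate k eps)%:E <= nstar k eps)%E.
Proof.
move=> /andP[de0 de1]; pose s := de / 8.
have s0 : 0 < s by rewrite /s; move: de0; only_lra.
have s8 : s < 8^-1 by rewrite /s; move: de1; only_lra.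
pose c : R := (1 - de) / (2 * expR 1 ^+ 2).
have c0 : 0 < c.
  by rewrite divr_gt0 ?subr_gt0 // mulr_gt0 // exprn_gt0 // expR_gt0.
have A1 : 1 < 1 + s by rewrite ltrDl.
have A0 : 0 < 1 + s by exact: lt_trans A1.
have kap0 : 0 < 1 - s by move: s8; only_lra.
have th : 0 < (2^-1 : R) < 1 by apply/andP; split; only_lra.
have kapc : 2 * Num.sqrt (1 + s) < (1 - s) * Num.sqrt (2 * expR (- (2 + s)) / c).
  have h : 0 <= 2 * expR (- (2 + s)) / c by rewrite ltW //; positivity.
  rewrite -(ltr_pXn2r (ltn0Sn 1)) ?nnegrE; try by rewrite mulr_ge0 ?sqrtr_ge0 ?(ltW kap0).
  rewrite exprMn [X in _ < X]exprMn !sqr_sqrtr ?(ltW A0) //.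
  have -> : 2 * expR (- (2 + s)) / c = 4 * expR (- s) / (1 - de).
    have -> : expR (- (2 + s)) = expR (- s) / expR 1 ^+ 2.
      by rewrite -expRM_natl -expRN -expRD; congr expR; ring.
    by rewrite /c; field; rewrite !gt_eqF ?expR_gt0 ?subr_gt0.
  rewrite mulrA ltr_pdivlMr ?subr_gt0 //.
  apply: (@lt_le_trans _ _ (4 * (1 - s) ^+ 3)).
    have -> : de = 8 * s by rewrite /s; field.
    by move: s0 s8; clear; intros; nra.
  have -> : 4 * (1 - s) ^+ 3 = (1 - s) ^+ 2 * (4 * (1 - s)) by ring.
  by rewrite ler_pM2l ?exprn_gt0 // ler_pM2l // expR_ge1Dx.
have [e0 e01 e0P] := @expR_dominates R (48 * (1 + s) / s) s 1 s0.
have e00 : 0 < e0 by exact: lt_le_trans e01.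
have [|dl [t0 [dl0 H]]] := lower_regime c0 A1 th s0 e00 kap0 kapc.
  move=> e e0e; have ep : 0 < e by exact: lt_le_trans e0e.
  have e1 : 1 <= e by exact: le_trans e0e.
  have d0 : 0 < 1 + (1 - s) * e / 2 by rewrite addr_gt0 // divr_gt0 // mulr_gt0.
  have -> : - e = - ((1 - s) * e) - s * e by ring.
  have -> : (1 - 2^-1) ^+ 2 * ((1 - (1 + s)^-1) * (1 - 2^-1) * expR (- ((1 - s) * e)) / (1 + (1
    - s) * e / 2))
     = s / (8 * (1 + s) * (1 + (1 - s) * e / 2)) * expR (- ((1 - s) * e)).
    have d2 : 2 + (1 - s) * e != 0 by rewrite gt_eqF // addr_gt0 // mulr_gt0.
    by field; rewrite d2 gt_eqF.
  rewrite expRD mulrA [leLHS]mulrAC ler_pM2r ?expR_gt0 //.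
  rewrite expRN ler_pdivrMr ?expR_gt0 //.
  have /= := e0P e e0e; rewrite expr1 => h.
  apply: (@le_trans _ _ (s / (8 * (1 + s) * (1 + (1 - s) * e / 2)) * (48 * (1 + s) / s * e)));
    last first.
    rewrite ler_pM2l // divr_gt0 // mulr_gt0 // mulr_gt0 //.
  have -> : s / (8 * (1 + s) * (1 + (1 - s) * e / 2)) * (48 * (1 + s) / s * e) =
     6 * e / (1 + (1 - s) * e / 2).
    have d2 : 2 + (1 - s) * e != 0 by rewrite gt_eqF // addr_gt0 // mulr_gt0.
    by field; rewrite d2 !gt_eqF.
  rewrite ler_pdivlMr //.
  have : (1 - s) * e <= e by rewrite ler_piMl ?(ltW ep) // gerBl ltW.
  by move: e1; move: ((1 - s) * e) => x; only_lra.
exists dl, t0, e0; split=> // k eps eps0 tk ek ekd.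
apply: nstar_ge => n ach.
by rewrite leNgt; apply/negP => /ltW h; exact: H k n eps eps0 tk ek ekd h ach.
Qed.

(** From eps = k^r one has - ln eps = - r ln k, so that r tending to 0 gives the last bound for
    every [dl]. *)
Lemma near_regime (R : realType) (eps r : nat -> R) :
  eps k @[k --> \oo] --> (0 : R) -> r k @[k --> \oo] --> (0 : R) ->
  (\forall k \near \oo, eps k = k%:R `^ r k) ->
  forall dl t0 e0 : R, 0 < dl -> \forall k \near \oo,
    [/\ 0 < eps k, t0 <= ln k%:R, e0 <= - ln (eps k) & - ln (eps k) <= dl * ln k%:R].
Proof.
move=> eps0 r0 epsr dl t0 e0 dl0.
have h1 : \forall k \near \oo, (`|eps k| < expR (- e0)).
  have /cvgrPdist_lt/(_ _ (expR_gt0 (- e0))) := eps0.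
  by apply: filterS => k; rewrite sub0r normrN.
have h2 : \forall k \near \oo, (`|r k| < dl).
  have /cvgrPdist_lt/(_ _ dl0) := r0.
  by apply: filterS => k; rewrite sub0r normrN.
have h3 : \forall k \near \oo, (expR t0 <= k%:R :> R) by exact: nbhs_infty_ger.
have h4 : \forall k \near \oo, (1 <= k%:R :> R) by exact: nbhs_infty_ger.
near=> k.
have k1 : 1 <= k%:R :> R by near: k.
have k0 : 0 < k%:R :> R by exact: lt_le_trans k1.
have l0 : 0 <= ln k%:R :> R by rewrite ln_ge0.
have ek : eps k = k%:R `^ r k by near: k.
have ep : 0 < eps k by rewrite ek powR_gt0.
split=> //.
- by rewrite -ler_expR lnK ?posrE //; near: k.
- rewrite lerNr -ler_expR lnK ?posrE // ltW //; apply: le_lt_trans (ler_norm _) _.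
  by near: k.
- rewrite ek ln_powR -mulNr ler_wpM2r // ltW //.
  apply: le_lt_trans (ler_norm _) _; rewrite normrN; near: k; exact: h2.
Unshelve. all: end_near.
Qed.

Lemma rate_ge0 (R : realType) (k : nat) (eps : R) : (0 < k)%N -> 0 <= rate k eps.
Proof.
move=> k0; rewrite /rate mulr_ge0 ?sqr_ge0 // divr_ge0 // ln_ge0 //.
by rewrite ler1n.
Qed.

Unset Implicit Arguments.

(* If eps * k > floor(k/2), which for eps <= c0 < 1/2 can only happen for odd
   k < 1/(1-2*c0), the constant estimator ceil(k/2) has error below eps * k, so
   nstar k eps = 0 and a positive lower bound is false. The premise of the
   lower bound excludes exactly this case. *)
Theorem theorem2 (R : realType) :
  (forall c0 : R, c0 < 2^-1 ->
     exists c C : R, [/\ 0 < c, c <= C &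
       forall (k : nat) (eps : R), (0 < k)%N -> k%:R^-1 <= eps -> eps <= c0 ->
         (eps * k%:R <= (k./2)%:R -> ((c * rate k eps)%:E <= nstar k eps)%E) /\
         (nstar k eps <= (C * rate k eps)%:E)%E])
  /\
  (forall eps : nat -> R,
     eps k @[k --> \oo] --> (0 : R) ->
     (exists r : nat -> R, r k @[k --> \oo] --> (0 : R) /\
        \forall k \near \oo, eps k = k%:R `^ r k) ->
     exists d d' : nat -> R,
       [/\ d k @[k --> \oo] --> (0 : R), d' k @[k --> \oo] --> (0 : R) &
         \forall k \near \oo,
           (((1 + d k) / (2 * expR 1 ^+ 2) * rate k (eps k))%:E
              <= nstar k (eps k))%E /\
           (nstar k (eps k)
              <= ((1 + d' k) / (2494 / 1000) * rate k (eps k))%:E)%E]).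
Proof.
split=> [c0 c02|eps eps0 [r [r0 epsr]]].
  have [c00|c00] := leP c0 0.
    (* No eps qualifies here, since 1 / k is positive. *)
    exists 1, 1; split=> // k eps k0 keps epsc; exfalso.
    suff : 0 < c0 by rewrite ltNge c00.
    by apply: lt_le_trans epsc; apply: lt_le_trans keps; rewrite invr_gt0 ltr0n.
  have c0P : 0 < c0 < 2^-1 by rewrite c00.
  have c01 : 0 < c0 < 1 by rewrite c00 (lt_trans c02) //; only_lra.
  have [c cp cP] := lower_uniform c0P; have [C Cp CP] := upper_uniform c01.
  exists c, (Num.max c C); split=> [//||k eps k0 keps epsc].
    by rewrite le_max lexx.
  split=> [|]; first exact: cP.
  apply: le_trans (CP k eps k0 keps epsc) _; rewrite lee_fin.
  by rewrite ler_wpM2r ?rate_ge0 // le_max lexx orbT.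
have regime := near_regime eps0 r0 epsr.
pose ref k : R := rate k (eps k) / (2 * expR 1 ^+ 2).
(* The largest nonpositive error for which the lower bound holds. *)
pose d k := Num.min 0 (fine (nstar k (eps k)) / ref k - 1).
have fin_ref : \forall k \near \oo, 0 < ref k /\
    (nstar k (eps k) <= (rate k (eps k) / (2494 / 1000))%:E)%E.
  have [dl [t0 [e0 [dl0 H]]]] := upper_asymptotic R.
  have [t1 _ H1] := rate_dominates (1 : R) (ltr01 : 0 < 1 :> R).
  have := regime dl (Num.max t0 t1) (Num.max e0 1) dl0.
  apply: filterS => k [ek]; rewrite !ge_max => /andP[tk tk1] /andP[e0k e1k] edl.
  split; last exact: H.
  apply: divr_gt0; first exact: lt_le_trans (H1 k (eps k) ek tk1 e1k).
  by apply: mulr_gt0 => //; rewrite exprn_gt0 // expR_gt0.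
(* [fine] would send +oo to 0, so [nstar] has to be known finite before it is replaced by a real
   number. *)
have nstar_fin k : (nstar k (eps k) <= (rate k (eps k) / (2494 / 1000))%:E)%E ->
    nstar k (eps k) = (fine (nstar k (eps k)))%:E.
  move=> h; rewrite fineK // ge0_fin_numE ?(le_lt_trans h) ?ltry //.
  by apply: nstar_ge => n _; exact: ler0n.
(* The upper error can be 0, because the gap between 2.494 and 8 a^2 has already absorbed the
   lower-order terms. *)
exists d, (fun=> 0); split; first 1 last.
- exact: cvg_cst.
- near=> k; have [rk nk] : 0 < ref k /\
      (nstar k (eps k) <= (rate k (eps k) / (2494 / 1000))%:E)%E by near: k.
  split; last by rewrite addr0 mul1r mulrC.
  rewrite (nstar_fin k nk) lee_fin -mulrA [_^-1 * _]mulrC -/(ref k).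
  rewrite -ler_pdivlMr // addrC -lerBrDr ge_min lexx orbT //.
apply/cvgrPdist_le => de de0.
pose de' := Num.min de (2^-1).
have de'P : 0 < de' < 1.
  rewrite lt_min de0 invr_gt0 ltr0n /=; apply: le_lt_trans (_ : 2^-1 < 1).
    by rewrite ge_min lexx orbT.
  by only_lra.
have [dl [t0 [e0 [dl0 H]]]] := lower_asymptotic de'P.
have reg := regime dl t0 e0 dl0.
near=> k.
have [rk nk] : 0 < ref k /\
    (nstar k (eps k) <= (rate k (eps k) / (2494 / 1000))%:E)%E by near: k.
have [ek tk e0k edl] : [/\ 0 < eps k, t0 <= ln k%:R, e0 <= - ln (eps k)
    & - ln (eps k) <= dl * ln k%:R] by near: k.
have := H k (eps k) ek tk e0k edl.
rewrite (nstar_fin k nk) lee_fin -mulrA [_^-1 * _]mulrC -/(ref k).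
rewrite -ler_pdivlMr // => h.
have d0 : d k <= 0 by rewrite ge_min lexx.
rewrite sub0r normrN ler0_norm // lerNl le_min oppr_le0 (ltW de0) /=.
have : de' <= de by rewrite ge_min lexx.
by move: h; only_lra.
Unshelve. all: end_near.
Qed.
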